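(* Let $k$ be a real valued field of residual exponential characteristic $p$ and let $\mathcal{A}$ be a weakly cartesian normed $k$-algebra. Then $\mathcal{A}$ is geometrically spectral over $k$ if and only if there exists a $p$-versal extension $l/k$ of real valued fields such that $\mathcal{A}_l=\mathcal{A}\otimes_k l$ (with the tensor product seminorm) is spectral.
   Context: All rings are commutative and all seminorms are non-archimedean (and submultiplicative on rings). A real valued field is a field with a non-archimedean multiplicative norm with values in $\mathbb{R}_{\ge 0}$; an extension of real valued fields $l/k$ is a field extension in which the valuation of $l$ extends that of $k$. The residual exponential characteristic $p$ of $k$ is the characteristic of the residue field if that is positive, and $p=1$ otherwise. The tensor product seminorm is $\|x\|=\inf_{x=\sum a_i\otimes b_i}\max_i\|a_i\|\,\|b_i\|$. A seminormed ring is spectral (power-multiplicative) if $|a^n|=|a|^n$ for all $a$ and $n\ge 0$. A seminormed $k$-algebra $\mathcal{A}$ is geometrically spectral if $\mathcal{A}\otimes_k l$ with the tensor seminorm is spectral for every extension of real valued fields $l/k$. Weakly cartesian: elements $\{e_i\}_{i\in I}$ of a seminormed $k$-vector space $V$ are $r$-orthogonal, $r\in(0,1]$, if $\|\sum_i a_ie_i\|\ge r\max_i\|a_ie_i\|$ for all finite linear combinations with $a_i\in k$. $V$ is weakly cartesian if every finite-dimensional subspace has a basis that is $r$-orthogonal for some $r\in(0,1]$. (For finite-dimensional normed spaces, having an $r$-orthogonal basis for some $r>0$ is equivalent to having one for every $r\in(0,1)$.) $p$-versal: an element $a\in k$ is $p$-regular (in $k$) if $|pa|<\inf_{c\in k}|a-c^p|$.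 Set $|a|_{k/p}=\inf_{c\in k}|a-c^p|$ if $a$ is $p$-regular in $k$, and $|a|_{k/p}=0$ otherwise; similarly define $|a|_{l/p}$ for $a\in l$ using $l$ in place of $k$. An extension of real valued fields $l/k$ is $p$-versal (of thickness $r$) if there exists $r<1$ such that $|a|_{l/p}\le r|a|_{k/p}$ for every $p$-regular element $a\in k$. (If $p=1$ there are no $p$-regular elements and every extension is $p$-versal.) *)

(* Defs.v *)
From HB Require Import structures.
From mathcomp Require Import all_boot all_order all_algebra.
From mathcomp Require Import generic_quotient ring_quotient.
From mathcomp Require Import boolp classical_sets reals.

Set Implicit Arguments.
Unset Strict Implicit.
Unset Printing Implicit Defensive.

Import Order.TTheory GRing.Theory Num.Theory.
Local Open Scope ring_scope.
Local Open Scope quotient_scope.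

Record valued_field (R : realType) := ValuedField {
  vf_field :> fieldType;
  vnorm : vf_field -> R;
  vnorm_ge0 : forall x, 0 <= vnorm x;
  vnorm0 : vnorm 0 = 0;
  vnorm0_eq0 : forall x, vnorm x = 0 -> x = 0;
  vnorm1 : vnorm 1 = 1;
  vnormM : forall x y, vnorm (x * y) = vnorm x * vnorm y;
  vnormD : forall x y, vnorm (x + y) <= Num.max (vnorm x) (vnorm y)
}.

Section ResidueField.
Variables (R : realType) (k : valued_field R).

Lemma vnormN (x : k) : vnorm (- x) = vnorm x.
Proof.
have n1 : vnorm (-1 : k) = 1.
  apply/eqP; rewrite -(@pexpr_eq1 _ _ 2) ?vnorm_ge0 //.
  by rewrite expr2 -vnormM mulrNN mulr1 vnorm1.
by rewrite -mulN1r vnormM n1 mul1r.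
Qed.

Definition vring : {pred k} := [pred x | vnorm x <= 1].

Lemma vring_subring : subring_closed vring.
Proof.
split=> [|x y|x y]; rewrite !inE ?vnorm1 // => hx hy.
  by apply: le_trans (vnormD _ _) _; rewrite vnormN ge_max hx hy.
by rewrite vnormM mulr_ile1 ?vnorm_ge0.
Qed.

HB.instance Definition _ := GRing.isSubringClosed.Build k vring vring_subring.

Record valuation_ring := ValuationRing {
  vr_val :> k;
  vr_valP : vr_val \in vring
}.

HB.instance Definition _ := [isSub for vr_val].
HB.instance Definition _ := [Choice of valuation_ring by <:].
HB.instance Definition _ := [SubChoice_isSubComNzRing of valuation_ring by <:].

Definition maxideal : {pred valuation_ring} :=
  [pred x | vnorm (vr_val x) < 1].

Lemma maxideal_idealr : idealr_closed maxideal.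
Proof.
split=> [||a u v]; rewrite ?inE /= ?vnorm0 ?ltr01 ?vnorm1 ?ltxx // => hu hv.
apply: le_lt_trans (vnormD _ _) _; rewrite gt_max hv andbT.
rewrite vnormM; apply: le_lt_trans hu.
by rewrite ler_piMl ?vnorm_ge0 //; exact: (vr_valP a).
Qed.

HB.instance Definition _ :=
  isIdealr.Build valuation_ring maxideal maxideal_idealr.

(* Only the ring structure of {|x| <= 1} / {|x| < 1} is recorded: it suffices
   to define the characteristic. *)
Definition residue_field : comNzRingType := {ideal_quot maxideal}.

Lemma residue_pchar (q : nat) :
  (q \in [pchar residue_field]) = prime q && (vnorm (q%:R : k) < 1).
Proof.
rewrite inE; congr (_ && _).
rewrite -(rmorph_nat (\pi_{ideal_quot maxideal})).
rewrite -(rmorph0 (\pi_{ideal_quot maxideal})).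
rewrite -Quotient.idealrBE subr0 inE.
by rewrite -[vr_val _]/(val _) rmorph_nat.
Qed.

Definition residual_exp_char (p : nat) : Prop :=
  p \in [pchar residue_field] \/ (p = 1%N /\ [pchar residue_field] =i pred0).

End ResidueField.

(* comAlgType would exclude the zero ring, hence the structure morphism. *)
Record algebra (K : fieldType) := Algebra {
  alg_ring :> comPzRingType;
  alg_map : {rmorphism K -> alg_ring}
}.

(* A with its K-vector space structure, c *: v being alg_map A c * v. *)
Definition alg_vect (K : fieldType) (A : algebra K) : Type := A.

Section AlgVect.
Variables (K : fieldType) (A : algebra K).

HB.instance Definition _ := GRing.Zmodule.on (alg_vect A).

Definition alg_scale (c : K) (x : alg_vect A) : alg_vect A :=
  alg_map A c * (x : A).

Lemma alg_scaleA a b v : alg_scale a (alg_scale b v) = alg_scale (a * b) v.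
Proof. by rewrite /alg_scale rmorphM mulrA. Qed.

Lemma alg_scale1 : left_id 1 alg_scale.
Proof. by move=> v; rewrite /alg_scale rmorph1 mul1r. Qed.

Lemma alg_scaleDr : right_distributive alg_scale +%R.
Proof. by move=> a u v; rewrite /alg_scale mulrDr. Qed.

Lemma alg_scaleDl v : {morph alg_scale^~ v : a b / a + b}.
Proof. by move=> a b; rewrite /alg_scale rmorphD mulrDl. Qed.

HB.instance Definition _ := GRing.Zmodule_isLmodule.Build K (alg_vect A)
  alg_scaleA alg_scale1 alg_scaleDr alg_scaleDl.

End AlgVect.

Section TensorProduct.
Variables (K : fieldType) (A B : algebra K).
Implicit Types s t u : seq (A * B).

(* [:: (a1, b1); ...; (an, bn)] stands for the formal sum of the ai (x) bi. *)
Inductive tensor_rel : seq (A * B) -> seq (A * B) -> Prop :=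
| trel_refl s : tensor_rel s s
| trel_sym s t : tensor_rel s t -> tensor_rel t s
| trel_trans s t u : tensor_rel s t -> tensor_rel t u -> tensor_rel s u
| trel_perm s t : perm_eq s t -> tensor_rel s t
| trel_cat s t u : tensor_rel s t -> tensor_rel (s ++ u) (t ++ u)
| trel_zero b : tensor_rel [:: (0, b)] [::]
| trel_addl a a' b : tensor_rel [:: (a + a', b)] [:: (a, b); (a', b)]
| trel_addr a b b' : tensor_rel [:: (a, b + b')] [:: (a, b); (a, b')]
| trel_bal c a b :
    tensor_rel [:: (alg_map A c * a, b)] [:: (a, alg_map B c * b)].

Definition tensor_relb s t : bool := `[< tensor_rel s t >].

Lemma tensor_relb_equiv : equiv_class_of tensor_relb.
Proof.
split=> [s|s t|s t u].
- by apply/asboolP; apply: trel_refl.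
- by apply/asboolP/asboolP; apply: trel_sym.
- by move=> /asboolP h1 /asboolP h2; apply/asboolP; apply: trel_trans h1 h2.
Qed.

Canonical tensor_equiv := EquivRelPack tensor_relb_equiv.

Definition tensor := {eq_quot tensor_equiv}.
HB.instance Definition _ := Choice.on tensor.
HB.instance Definition _ := EqQuotient.on tensor.

Lemma tensorP s t : \pi_tensor s = \pi_tensor t <-> tensor_rel s t.
Proof.
split=> [/eqmodP/asboolP //|h].
by apply/eqmodP; apply/asboolP.
Qed.

Lemma trel_cat2 s s' t t' :
  tensor_rel s s' -> tensor_rel t t' -> tensor_rel (s ++ t) (s' ++ t').
Proof.
move=> hs ht; apply: trel_trans (trel_cat t hs) _.
apply: trel_trans (trel_perm _) (trel_trans (trel_cat s' ht) (trel_perm _)).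
  by rewrite perm_catC.
by rewrite perm_catC.
Qed.

Definition tneg s := [seq (- x.1, x.2) | x <- s].
Definition tmul s t := [seq (x.1 * y.1, x.2 * y.2) | x <- s, y <- t].

Lemma tneg_rel s t : tensor_rel s t -> tensor_rel (tneg s) (tneg t).
Proof.
rewrite /tneg; elim=> {s t}.
- by move=> s; apply: trel_refl.
- by move=> s t _; apply: trel_sym.
- by move=> s t u _ h1 _; apply: trel_trans.
- by move=> s t h; apply/trel_perm/perm_map.
- by move=> s t u _ h; rewrite !map_cat; apply: trel_cat.
- by move=> b /=; rewrite oppr0; apply: trel_zero.
- by move=> a a' b /=; rewrite opprD; apply: trel_addl.
- by move=> a b b' /=; apply: trel_addr.
- by move=> c a b /=; rewrite -mulrN; apply: trel_bal.
Qed.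

Lemma tnegK s : tensor_rel (tneg s ++ s) [::].
Proof.
elim: s => [|[a b] s IHs] /=; first exact: trel_refl.
apply: (@trel_trans _ ([:: (- a, b); (a, b)] ++ (tneg s ++ s))).
  apply: trel_perm; rewrite /= perm_cons.
  by rewrite -cat_rcons -cats1 -!catA perm_catCA.
rewrite -[[::]]/([::] ++ [::] : seq (A * B)); apply: trel_cat2 => //.
apply: trel_trans (trel_sym (trel_addl _ _ _)) _.
by rewrite addNr; apply: trel_zero.
Qed.

Lemma tmul_cons x s t : tmul (x :: s) t = tmul [:: x] t ++ tmul s t.
Proof. by rewrite /tmul /= cats0. Qed.

Lemma tmul1_cons x y t :
  tmul [:: x] (y :: t) = (x.1 * y.1, x.2 * y.2) :: tmul [:: x] t.
Proof. by []. Qed.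

Lemma tmul_mapl x t : tmul [:: x] t = [seq (x.1 * y.1, x.2 * y.2) | y <- t].
Proof. by rewrite /tmul /= cats0. Qed.

Lemma tmul_catl s1 s2 t : tmul (s1 ++ s2) t = tmul s1 t ++ tmul s2 t.
Proof. by rewrite /tmul allpairs_cat. Qed.

Lemma tmulC s t : perm_eq (tmul s t) (tmul t s).
Proof.
elim: t => [|y t IHt]; first by rewrite /tmul allpairs0r.
rewrite tmul_cons tmul_mapl perm_allpairs_consr.
rewrite (eq_map (_ : _ =1 fun x => (y.1 * x.1, y.2 * x.2))) ?perm_cat2l //.
by move=> x; rewrite mulrC [x.2 * _]mulrC.
Qed.

Lemma tmulA s t u : tmul s (tmul t u) = tmul (tmul s t) u.
Proof.
elim: s => [//|x s IHs]; rewrite tmul_cons (tmul_cons x s t) tmul_catl -IHs.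
congr (_ ++ _); elim: t {IHs} => [//|y t IHt].
rewrite tmul1_cons !(tmul_cons _ t) (tmul_cons _ (tmul _ t)) -IHt !tmul_mapl.
rewrite map_cat -map_comp; congr (_ ++ _).
by apply: eq_map => z /=; rewrite !mulrA.
Qed.

Lemma tmul1 s : tmul [:: (1, 1)] s = s.
Proof.
by rewrite tmul_mapl -[RHS]map_id; apply: eq_map => -[a b] /=; rewrite !mul1r.
Qed.

Lemma tmul_rell s t u : tensor_rel s t -> tensor_rel (tmul s u) (tmul t u).
Proof.
elim=> {s t}.
- by move=> s; apply: trel_refl.
- by move=> s t _; apply: trel_sym.
- by move=> s t v _ h1 _; apply: trel_trans.
- by move=> s t h; apply/trel_perm/perm_allpairs.
- by move=> s t v _ h; rewrite !tmul_catl; apply: trel_cat.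
- move=> b; elim: u => [|y u IHu]; first exact: trel_refl.
  rewrite tmul1_cons /= mul0r -cat1s -[tmul [::] _]/([::] ++ [::]).
  by apply: trel_cat2 => //; apply: trel_zero.
- move=> a a' b; elim: u => [|y u IHu]; first exact: trel_refl.
  rewrite tmul1_cons /= mulrDl -cat1s.
  apply: trel_trans (trel_cat2 (trel_addl _ _ _) IHu) _.
  apply: trel_perm; rewrite [X in perm_eq _ X]tmul_cons tmul1_cons.
  rewrite (tmul_cons (a, b)) /= perm_cons perm_sym.
  by rewrite (perm_catCA _ [:: _]).
- move=> a b b'; elim: u => [|y u IHu]; first exact: trel_refl.
  rewrite tmul1_cons /= mulrDl -cat1s.
  apply: trel_trans (trel_cat2 (trel_addr _ _ _) IHu) _.
  apply: trel_perm; rewrite [X in perm_eq _ X]tmul_cons tmul1_cons.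
  rewrite (tmul_cons (a, b)) /= perm_cons perm_sym.
  by rewrite (perm_catCA _ [:: _]).
- move=> c a b; elim: u => [|y u IHu]; first exact: trel_refl.
  rewrite !tmul1_cons /= -!mulrA -cat1s -[X in tensor_rel _ X]cat1s.
  by apply: trel_cat2 => //; apply: trel_bal.
Qed.

Lemma tmul_rel s s' t t' :
  tensor_rel s s' -> tensor_rel t t' -> tensor_rel (tmul s t) (tmul s' t').
Proof.
move=> hs ht; apply: trel_trans (tmul_rell t hs) _.
apply: trel_trans (trel_perm (tmulC _ _)) _.
exact: trel_trans (tmul_rell s' ht) (trel_perm (tmulC _ _)).
Qed.

Lemma trel_repr s : tensor_rel (repr (\pi_tensor s)) s.
Proof. by apply/tensorP; rewrite reprK. Qed.

Lemma tensorW (P : tensor -> Prop) :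
  (forall s, P (\pi_tensor s)) -> forall x, P x.
Proof. by move=> h x; rewrite -[x]reprK. Qed.

Definition tensor_add (x y : tensor) : tensor := \pi_tensor (repr x ++ repr y).
Definition tensor_opp (x : tensor) : tensor := \pi_tensor (tneg (repr x)).
Definition tensor_mul (x y : tensor) : tensor :=
  \pi_tensor (tmul (repr x) (repr y)).

Lemma tensor_addE s t :
  tensor_add (\pi_tensor s) (\pi_tensor t) = \pi_tensor (s ++ t).
Proof. by apply/tensorP/trel_cat2; apply: trel_repr. Qed.

Lemma tensor_oppE s : tensor_opp (\pi_tensor s) = \pi_tensor (tneg s).
Proof. by apply/tensorP/tneg_rel/trel_repr. Qed.

Lemma tensor_mulE s t :
  tensor_mul (\pi_tensor s) (\pi_tensor t) = \pi_tensor (tmul s t).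
Proof. by apply/tensorP/tmul_rel; apply: trel_repr. Qed.

Lemma tensor_addA : associative tensor_add.
Proof.
elim/tensorW=> s; elim/tensorW=> t; elim/tensorW=> u.
by rewrite (tensor_addE s t) (tensor_addE t u) !tensor_addE catA.
Qed.

Lemma tensor_addC : commutative tensor_add.
Proof.
elim/tensorW=> s; elim/tensorW=> t; rewrite !tensor_addE.
by apply/tensorP/trel_perm; rewrite perm_catC.
Qed.

Lemma tensor_add0 : left_id (\pi_tensor [::]) tensor_add.
Proof. by elim/tensorW=> s; rewrite tensor_addE. Qed.

Lemma tensor_addN : left_inverse (\pi_tensor [::]) tensor_opp tensor_add.
Proof.
elim/tensorW=> s; rewrite (tensor_oppE s) tensor_addE.
by apply/tensorP; exact: tnegK.
Qed.

HB.instance Definition _ := GRing.isZmodule.Build tensor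
  tensor_addA tensor_addC tensor_add0 tensor_addN.

Lemma tensor_mulA : associative tensor_mul.
Proof.
elim/tensorW=> s; elim/tensorW=> t; elim/tensorW=> u.
by rewrite (tensor_mulE s t) (tensor_mulE t u) !tensor_mulE tmulA.
Qed.

Lemma tensor_mulC : commutative tensor_mul.
Proof.
elim/tensorW=> s; elim/tensorW=> t; rewrite !tensor_mulE.
by apply/tensorP; exact: trel_perm (tmulC _ _).
Qed.

Lemma tensor_mul1 : left_id (\pi_tensor [:: (1, 1)]) tensor_mul.
Proof. by elim/tensorW=> s; rewrite tensor_mulE tmul1. Qed.

Lemma tensor_mulDl : left_distributive tensor_mul tensor_add.
Proof.
elim/tensorW=> s; elim/tensorW=> t; elim/tensorW=> u.
rewrite (tensor_addE s t) (tensor_mulE s u) (tensor_mulE t u).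
by rewrite tensor_mulE tensor_addE tmul_catl.
Qed.

HB.instance Definition _ := GRing.Zmodule_isComPzRing.Build tensor
  tensor_mulA tensor_mulC tensor_mul1 tensor_mulDl.

Definition tens (a : A) (b : B) : tensor := \pi_tensor [:: (a, b)].

Lemma tensDl a a' b : tens (a + a') b = tens a b + tens a' b.
Proof.
rewrite -[_ + _ in RHS]/(tensor_add _ _) tensor_addE.
by apply/tensorP/trel_addl.
Qed.

Lemma tensDr a b b' : tens a (b + b') = tens a b + tens a b'.
Proof.
rewrite -[_ + _ in RHS]/(tensor_add _ _) tensor_addE.
by apply/tensorP/trel_addr.
Qed.

Lemma tens_bal c a b : tens (alg_map A c * a) b = tens a (alg_map B c * b).
Proof. by apply/tensorP/trel_bal. Qed.

Lemma tensM a b a' b' : tens a b * tens a' b' = tens (a * a') (b * b').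
Proof. by rewrite -[_ * _ in LHS]/(tensor_mul _ _) tensor_mulE. Qed.

Lemma tens11 : tens 1 1 = 1. Proof. by []. Qed.

Lemma tensorE s : \pi_tensor s = \sum_(x <- s) tens x.1 x.2.
Proof.
elim: s => [|[a b] s IHs]; first by rewrite big_nil.
by rewrite big_cons -IHs -[_ + _]/(tensor_add _ _) tensor_addE.
Qed.

Lemma tensor_sum (x : tensor) :
  exists s, x = \sum_(ab <- s) tens ab.1 ab.2.
Proof. by exists (repr x); rewrite -tensorE reprK. Qed.

Lemma tensor_univ (M : zmodType) (f : A -> B -> M) :
    (forall a a' b, f (a + a') b = f a b + f a' b) ->
    (forall a b b', f a (b + b') = f a b + f a b') ->
    (forall c a b, f (alg_map A c * a) b = f a (alg_map B c * b)) ->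
  exists! h : tensor -> M,
    {morph h : x y / x + y} /\ forall a b, h (tens a b) = f a b.
Proof.
move=> fDl fDr fbal; pose g s := \sum_(x <- s) f x.1 x.2.
have f0 b : f 0 b = 0 by apply: (addrI (f 0 b)); rewrite -fDl !addr0.
have g_rel s t : tensor_rel s t -> g s = g t.
  elim=> {s t} //; rewrite /g.
  - by move=> s t u _ -> _ ->.
  - by move=> s t h; apply: perm_big.
  - by move=> s t u _ h; rewrite !big_cat h.
  - by move=> b; rewrite big_seq1 big_nil.
  - by move=> a a' b; rewrite !big_cons !big_nil !addr0 fDl.
  - by move=> a b b'; rewrite !big_cons !big_nil !addr0 fDr.
  - by move=> c a b; rewrite !big_seq1 fbal.
have gE s : g (repr (\pi_tensor s)) = g s by apply/g_rel/trel_repr.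
exists (fun x => g (repr x)); split=> [|h [hD hf]].
  split=> [x y|a b]; last by rewrite gE /g big_seq1.
  rewrite -[x]reprK -[y]reprK -[_ + _ in LHS]/(tensor_add _ _) tensor_addE.
  by rewrite !gE /g big_cat.
have h0 : h 0 = 0 by apply: (addrI (h 0)); rewrite -hD !addr0.
apply: funext => x; rewrite -[in RHS](reprK x) tensorE.
rewrite (big_morph h hD h0) /g; apply: eq_bigr => i _.
by rewrite hf.
Qed.

End TensorProduct.

Record valued_ext (R : realType) (k : valued_field R) := ValuedExt {
  ext_field :> valued_field R;
  ext_map : {rmorphism k -> ext_field};
  ext_norm : forall c, vnorm (ext_map c) = vnorm c
}.

Definition ext_alg (R : realType) (k : valued_field R) (l : valued_ext k) :
  algebra k := Algebra (ext_map l).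

(* A seminormed k-algebra is a seminormed k-vector space (snormZ) with a
   submultiplicative seminorm; no condition on snorm 1 is imposed. *)
Record seminormed_alg (R : realType) (k : valued_field R) := SeminormedAlg {
  sn_alg :> algebra k;
  snorm : sn_alg -> R;
  snorm_ge0 : forall x, 0 <= snorm x;
  snormD : forall x y, snorm (x + y) <= Num.max (snorm x) (snorm y);
  snormM : forall x y, snorm (x * y) <= snorm x * snorm y;
  snormZ : forall c x, snorm (alg_map sn_alg c * x) = vnorm c * snorm x
}.

Record normed_alg (R : realType) (k : valued_field R) := NormedAlg {
  n_alg :> seminormed_alg k;
  snorm0_eq0 : forall x : n_alg, snorm x = 0 -> x = 0
}.

Definition spectral (R : realType) (B : comPzRingType) (N : B -> R) : Prop :=
  forall (b : B) (n : nat), N (b ^+ n) = N b ^+ n.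

Section BaseChange.
Variables (R : realType) (k : valued_field R).
Variables (A : seminormed_alg k) (l : valued_ext k).

Definition base_change : comPzRingType := tensor A (ext_alg l).

Definition tensor_snorm (x : base_change) : R :=
  inf [set r | exists2 s : seq (A * l),
         x = \sum_(ab <- s) tens (A := A) (B := ext_alg l) ab.1 ab.2 &
         r = \big[Num.max/0]_(ab <- s) (snorm ab.1 * vnorm ab.2)]%classic.

End BaseChange.

Arguments tensor_snorm {R k} A l x.

Definition geometrically_spectral (R : realType) (k : valued_field R)
    (A : seminormed_alg k) : Prop :=
  forall l : valued_ext k, spectral (tensor_snorm A l).

Section WeaklyCartesian.
Variables (R : realType) (k : valued_field R) (V : lmodType k) (N : V -> R).

Definition family_span n (e : 'I_n -> V) : set V :=
  [set v | exists c : 'I_n -> k, v = \sum_i c i *: e i]%classic.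

Definition family_free n (e : 'I_n -> V) : Prop :=
  forall c : 'I_n -> k, \sum_i c i *: e i = 0 -> forall i, c i = 0.

Definition is_basis (W : set V) n (e : 'I_n -> V) : Prop :=
  family_free e /\ W = family_span e.

Definition findim_subspace (W : set V) : Prop :=
  exists n (e : 'I_n -> V), is_basis W e.

Definition r_orthogonal (r : R) n (e : 'I_n -> V) : Prop :=
  forall c : 'I_n -> k,
    r * \big[Num.max/0]_i N (c i *: e i) <= N (\sum_i c i *: e i).

Definition weakly_cartesian : Prop :=
  forall W : set V, findim_subspace W ->
    exists n (e : 'I_n -> V), is_basis W e /\
      exists r : R, [/\ 0 < r, r <= 1 & r_orthogonal r e].

End WeaklyCartesian.

Definition weakly_cartesian_alg (R : realType) (k : valued_field R)
    (A : seminormed_alg k) : Prop :=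
  @weakly_cartesian R k (alg_vect A) (@snorm R k A).

Section PVersal.
Variables (R : realType) (p : nat).

(* The set is nonempty and bounded below by 0, so inf is the genuine infimum;
   the same holds for tensor_snorm. *)
Definition pdist (k : valued_field R) (a : k) : R :=
  inf [set vnorm (a - c ^+ p) | c in [set: k]]%classic.

Definition p_regular (k : valued_field R) (a : k) : Prop :=
  vnorm (p%:R * a) < pdist a.

Definition pnorm (k : valued_field R) (a : k) : R :=
  if `[< p_regular a >] then pdist a else 0.

Definition p_versal (k : valued_field R) (l : valued_ext k) : Prop :=
  exists2 r : R, r < 1 &
    forall a : k, p_regular a -> pnorm (ext_map l a) <= r * pnorm a.

End PVersal.

(* Main.v *)
(* A lower bound for the tensor product seminorm is obtained from linear forms
   that almost preserve norms on finitely many vectors; it makes A -> A (x)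
   l isometric and keeps orthogonal families of A orthogonal in A (x) l, so
   weak cartesianity reduces everything to r-orthogonal families e_1, ...,
   e_n with r close to 1.

   Wild case (p prime). In (sum e_i (x) b_i)^p = sum e_i^p (x) b_i^p + p z the
   last term is small, so A (x) m is spectral as soon as the e_i^p are
   nearly orthogonal in A. Over a p-versal l every c in k is, up to a fixed
   factor < 1, a p-th power d^p, so sum c_i e_i^p is close to (sum e_i (x)
   d_i)^p, whose norm is known because A (x) l is spectral.

   Tame case (p = 1). Let x = sum e_i (x) b_i with b_0 = 1 have spectral radius
   s. Two embeddings sigma, tau of m into some M give sigma x - tau x =
   sum_(i > 0) e_i (x) (sigma b_i - tau b_i), which has fewer terms and
   spectral radius at most s. Choosing them with |sigma b_i - tau b_i| at
   least the distance of b_i to k, induction shows that b_i is close to an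
   element c_i of k, and x is close to sum c_i e_i in A, where the norm is
   spectral. The embeddings come from a multiplicative seminorm on m (x)_k m
   attaining the spectral radius of b (x) 1 - 1 (x) b (Zorn); in residue
   characteristic 0 this radius is at least the distance of b to k, by a
   Newton polygon argument.

   Conversely, adjoining p-th roots of all elements of k to k, again by a
   multiplicative seminorm on a quotient of k[X_a : a in k], gives a
   p-versal extension. *)

From HB Require Import structures.
Require Import Defs.
From mathcomp Require Import all_boot all_order all_algebra.
From mathcomp Require Import generic_quotient.
From mathcomp Require Import boolp classical_sets reals.
From mathcomp Require Import ring lra.

Set Implicit Arguments.
Unset Strict Implicit.
Unset Printing Implicit Defensive.

Import Order.TTheory GRing.Theory Num.Theory.
Local Open Scope ring_scope.

(** * Real estimates and seminorms *)

(** None of the infima involved need be attained: neither the tensor seminorm, nor the distance from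
    a vector to a subspace, nor the distance from [b] to [k], since no field is assumed complete.
    Orthogonal bases are therefore available only up to a factor [t < 1], and each argument must
    lose a controlled power of [t] before [t] tends to 1. Linear forms on an infinite-dimensional
    [A] need not be bounded either, which is why they are only asked to be nearly contractive on the
    vectors of one tensor representation.

    The tensor product of two valued fields over [k] has no canonical valuation. A multiplicative
    seminorm on it supplies a common extension, and the real work is a lower bound for the powers of
    one element: the difference of the two copies of [b], or merely 1 when roots are adjoined.

    Residue characteristic 0 enters through an average: if [P] is monic over [k], the mean of its
    roots lies in [k], at distance at least [delta] from [b], and integers have absolute value 1.
    Nothing of the kind survives when the degree is divisible by the residue characteristic, which
    forces the separate wild argument. *)

Section RealEstimates.
Variable R : realType.
Implicit Types a b c s t u x y : R.

Lemma bernoulli t n : 0 <= t -> 1 + (t - 1) *+ n <= t ^+ n.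
Proof.
move=> t0; elim: n => [|n IHn]; first by rewrite mulr0n addr0 expr0.
case: n IHn => [|n] IHn; first by rewrite mulr1n expr1 addrC subrK.
case: (lerP 0 (1 + (t - 1) *+ n.+1)) => [h|h].
  rewrite exprS; apply: le_trans (ler_wpM2l t0 IHn).
  have : 0 <= (t - 1) ^+ 2 *+ n.+1 by rewrite mulrn_wge0 // sqr_ge0.
  rewrite [(t - 1) *+ n.+2]mulrS -[(t - 1) ^+ 2 *+ _]mulr_natr.
  rewrite -[(t - 1) *+ n.+1]mulr_natr.
  by set m := n.+1%:R => h2; nra.
apply: (@le_trans _ _ 0); last exact: exprn_ge0.
rewrite mulrSr addrA; apply: (@le_trans _ _ (t - 1)); first by rewrite gerDr ltW.
rewrite leNgt; apply/negP => t1; move: h; apply/negP; rewrite -leNgt.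
by rewrite addr_ge0 // mulrn_wge0 // ltW.
Qed.

Lemma expr_lt1_small t c : 0 <= t -> t < 1 -> 0 < c -> exists n, t ^+ n < c.
Proof.
move=> t0 t1 c0; have [->|tn0] := eqVneq t 0.
  by exists 1%N; rewrite expr1.
have tp : 0 < t by rewrite lt_neqAle eq_sym tn0.
have s0 : 0 < t^-1 - 1 by rewrite subr_gt0 invf_gt1.
have [n hn] : exists n : nat, c^-1 < n%:R * (t^-1 - 1).
  exists (Num.bound (c^-1 / (t^-1 - 1))).
  rewrite -ltr_pdivrMr //; apply: archi_boundP.
  by rewrite divr_ge0 // ltW // invr_gt0.
exists n; rewrite -[c]invrK -[t]invrK exprVn ltf_pV2 ?posrE ?invr_gt0 ?exprn_gt0 ?invr_gt0 //.
apply: lt_le_trans hn _; apply: le_trans (bernoulli _ _); last by rewrite invr_ge0.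
by rewrite mulr_natl lerDr ler01.
Qed.

(** If [b < a], some power of [b / a] falls below [1 / c]. This stands in for taking n-th roots,
    under which the constant would disappear. *)
Lemma bounded_powers_le a b c :
  0 <= a -> 0 < b -> (forall n, a ^+ n <= c * b ^+ n) -> a <= b.
Proof.
move=> a0 b0 h; rewrite leNgt; apply/negP => ab.
have a1 : 0 < a := lt_trans b0 ab.
have c0 : 0 < c by have := h 0; rewrite !expr0 mulr1; apply: lt_le_trans ltr01.
have [|||n] := @expr_lt1_small (b / a) c^-1.
- by rewrite divr_ge0 // ltW.
- by rewrite ltr_pdivrMr // mul1r.
- by rewrite invr_gt0.
rewrite expr_div_n ltr_pdivrMr ?exprn_gt0 // mulrC ltr_pdivlMr // mulrC.
by apply/negP; rewrite -leNgt.
Qed.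

(* The inequality passes to the limit t -> 1. *)
Lemma le_of_lt1_scaling r n a b : r < 1 -> 0 <= a ->
  (forall t, r < t -> 0 < t -> t < 1 -> t ^+ n * a <= b) -> a <= b.
Proof.
move=> r1 a0 h; rewrite leNgt; apply/negP => ba.
have ap : 0 < a.
  rewrite lt_neqAle a0 andbT eq_sym; apply/negP => /eqP a00.
  move: ba; rewrite a00 ltNge; apply/negP; rewrite negbK.
  have m1 : Num.max r 0 < 1 by rewrite gt_max r1 ltr01.
  have [ml mr] := midf_lt m1; move: ml; rewrite gt_max => /andP[m2 m3].
  by have := h _ m2 m3 mr; rewrite a00 mulr0.
(* Bernoulli gives [t ^+ n >= 1 - n e] for [t > 1 - e], and [e] is chosen so that
   [n e a < a - b]. *)
pose e := (a - b) / (a * n.+1%:R).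
have e0 : 0 < e by rewrite divr_gt0 ?subr_gt0 ?mulr_gt0 ?ltr0n.
have m1 : Num.max (Num.max r 0) (1 - e) < 1.
  by rewrite !gt_max r1 ltr01 ltrBlDr ltrDl e0.
have [ml mr] := midf_lt m1; move: ml; set t := (_ / _).
rewrite !gt_max -/t -andbA => /and3P[m2 m3 m4].
have := h t m2 m3 mr; apply/negP; rewrite -ltNge.
have /lt_le_trans : b < (1 + (t - 1) *+ n) * a.
  have : - (e *+ n) <= (t - 1) *+ n.
    by rewrite -mulNrn; apply: ler_wMn2r; lra.
  have -> : e *+ n = e * n%:R by rewrite mulr_natr.
  move=> h2; have : e * n%:R * a < a - b.
    rewrite /e -[X in _ < X]mul1r; have -> : (a - b) / (a * n.+1%:R) * n%:R * a
      = (n%:R / n.+1%:R) * (a - b).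
      by field; rewrite (gt_eqF ap) addrC natr1 pnatr_eq0.
    by rewrite ltr_pM2r ?subr_gt0 // ltr_pdivrMr ?ltr0n // mul1r ltr_nat.
  move=> h3; have : (1 + (t - 1) *+ n) * a >= (1 - e * n%:R) * a by rewrite ler_pM2r // lerD2l.
  by rewrite mulrBl mul1r; lra.
apply; rewrite ler_pM2r //; apply: bernoulli; exact: ltW.
Qed.

Lemma exists_gt1_pow n c : 1 < c -> exists2 t, 1 < t & t ^+ n < c.
Proof.
move=> c1; have c0 := lt_trans ltr01 c1.
apply: contrapT => /forall2NP h.
suff: c <= 1 by rewrite leNgt c1.
apply: (@le_of_lt1_scaling 0 n) => // [|t _ t0 t1]; first exact: ltW.
have [|] := h t^-1; first by rewrite invf_gt1.
move=> /negP; rewrite -leNgt exprVn => ht.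
by rewrite -ler_pdivlMl ?exprn_gt0 // mulr1.
Qed.

Lemma exists_nth_root n x : (0 < n)%N -> 0 <= x -> exists2 y, 0 <= y & y ^+ n = x.
Proof.
move=> n0 x0; have [|z /andP[z0 _] /rootP] :=
  @poly_ivt R ('X^n - x%:P) 0 (1 + x) (addr_ge0 ler01 x0).
  rewrite !hornerE expr0n gtn_eqF // sub0r oppr_le0 x0 /= subr_ge0.
  case: n n0 => // n _; rewrite exprS; apply: (@le_trans _ _ (1 + x)).
    by rewrite lerDr ler01.
  rewrite ler_peMr ?addr_ge0 // exprn_ege1 // lerDl //.
by rewrite !hornerE => /eqP; rewrite subr_eq0 => /eqP <-; exists z.
Qed.

End RealEstimates.

Section MoreReal.
Variable R : realType.
Implicit Types a b c : R.

Lemma le_of_gt a b : (forall c, b < c -> a <= c) -> a <= b.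
Proof.
move=> h; rewrite leNgt; apply/negP => ba.
by have := h _ (midf_lt ba).1; rewrite leNgt (midf_lt ba).2.
Qed.

Lemma le_mul_of_gt x a b : 0 <= a -> 0 <= b ->
  (forall c d, a < c -> b < d -> x <= c * d) -> x <= a * b.
Proof.
move=> a0 b0 h; apply/ler_addgt0Pr => e e0.
(* The excess of [(a + d) (b + d)] over [a b] is [d (a + b) + d ^ 2], and [d <= 1] gives
   [d ^ 2 <= d]; hence the [+ 1] in the denominator. *)
pose d := Num.min 1 (e / (a + b + 1)).
have ab : 0 < a + b + 1 by rewrite ltr_wpDl ?addr_ge0.
have d0 : 0 < d by rewrite lt_min ltr01 divr_gt0.
have d1 : d <= 1 by rewrite ge_min lexx.
have d2 : d * (a + b + 1) <= e by rewrite -ler_pdivlMr // ge_min lexx orbT.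
apply: le_trans (h (a + d) (b + d) _ _) _; rewrite ?ltrDl //.
suff : d * d <= d by lra.
by rewrite ler_piMl // ltW.
Qed.

Lemma bigmax0_le (I : eqType) (s : seq I) (F : I -> R) c :
  0 <= c -> (forall i, i \in s -> F i <= c) -> \big[Num.max/0]_(i <- s) F i <= c.
Proof.
move=> c0; elim: s => [|i s IHs] h; first by rewrite big_nil.
rewrite big_cons ge_max h ?mem_head //= IHs // => j js.
by apply: h; rewrite inE js orbT.
Qed.

Lemma bigmax0_ge (I : eqType) (s : seq I) (F : I -> R) i :
  i \in s -> F i <= \big[Num.max/0]_(i <- s) F i.
Proof.
elim: s => [//|j s IHs]; rewrite inE big_cons le_max => /predU1P[->|/IHs->].
  by rewrite lexx.
by rewrite orbT.
Qed.

Lemma bigmax0_ge0 (I : Type) (s : seq I) (F : I -> R) :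
  0 <= \big[Num.max/0]_(i <- s) F i.
Proof.
elim: s => [|i s IHs]; first by rewrite big_nil.
by rewrite big_cons le_max IHs orbT.
Qed.

Lemma bigmax0_attained (I : eqType) (s : seq I) (F : I -> R) :
  0 < \big[Num.max/0]_(i <- s) F i ->
  exists2 i, i \in s & \big[Num.max/0]_(i <- s) F i = F i.
Proof.
elim: s => [|i s IHs]; rewrite ?big_nil ?ltxx // big_cons.
have [_ /IHs[j js ->]|le _] := ltP (F i) (\big[Num.max/0]_(i <- s) F i).
  by exists j; rewrite // inE js orbT.
by exists i; rewrite ?mem_head.
Qed.

End MoreReal.

(** Submultiplicativity only leaves [N 1 = 0] or [N 1 >= 1]. The zero seminorm qualifies, so each
    use must secure [N 1 = 1] separately. *)
Record is_snorm (R : realType) (B : comPzRingType) (N : B -> R) : Prop :=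
  IsSnorm {
    sn_ge0 : forall x, 0 <= N x;
    sn_0 : N 0 = 0;
    sn_B : forall x y, N (x - y) <= Num.max (N x) (N y);
    sn_M : forall x y, N (x * y) <= N x * N y
  }.

Section SeminormTheory.
Variables (R : realType) (B : comPzRingType) (N : B -> R).
Hypothesis hN : is_snorm N.
Implicit Types x y : B.

Lemma sn_N x : N (- x) = N x.
Proof.
have h y : N (- y) <= N y.
  have := sn_B hN 0 y; rewrite sub0r (sn_0 hN) => /le_trans; apply.
  by rewrite ge_max lexx (sn_ge0 hN).
by apply/eqP; rewrite eq_le h -{1}[x]opprK h.
Qed.

Lemma sn_D x y : N (x + y) <= Num.max (N x) (N y).
Proof. by rewrite -{1}[y]opprK -[N y]sn_N sn_B. Qed.

Lemma sn_sum (I : eqType) (s : seq I) (F : I -> B) c :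
  0 <= c -> (forall i, i \in s -> N (F i) <= c) -> N (\sum_(i <- s) F i) <= c.
Proof.
move=> c0; elim: s => [|i s IHs] h; first by rewrite big_nil (sn_0 hN).
rewrite big_cons; apply: le_trans (sn_D _ _) _.
rewrite ge_max h ?mem_head //= IHs // => j js.
by apply: h; rewrite inE js orbT.
Qed.

Lemma sn_Mn x n : N (x *+ n) <= N x.
Proof.
elim: n => [|n IHn]; first by rewrite mulr0n (sn_0 hN) (sn_ge0 hN).
by rewrite mulrS; apply: le_trans (sn_D _ _) _; rewrite ge_max lexx IHn.
Qed.

Lemma sn_X x n : N 1 <= 1 -> N (x ^+ n) <= N x ^+ n.
Proof.
move=> n1; elim: n => [|n IHn]; first by rewrite !expr0.
rewrite !exprS; apply: le_trans (sn_M hN _ _) _.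
by apply: ler_wpM2l IHn; apply: (sn_ge0 hN).
Qed.

Lemma sn_XS x n : N (x ^+ n.+1) <= N x ^+ n.+1.
Proof.
elim: n => [|n IHn]; first by rewrite !expr1.
rewrite exprS (exprS (N x)); apply: le_trans (sn_M hN _ _) _.
by apply: ler_wpM2l IHn; apply: (sn_ge0 hN).
Qed.

Lemma sn_max_eq x y : N y < N x -> N (x + y) = N x.
Proof.
move=> h; apply/eqP; rewrite eq_le; apply/andP; split.
  by apply: le_trans (sn_D _ _) _; rewrite ge_max lexx ltW.
have := sn_B hN (x + y) y; rewrite addrK le_max => /orP[//|].
by rewrite leNgt h.
Qed.

(** Iteration settles the exponents [q ^ j]. A strict loss in [x ^+ n] would persist in
    [x ^+ n * x ^+ (q ^ n - n)], whose exponent is of that kind. *)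
Lemma power_mult_of_prime q : N 1 = 1 -> (1 < q)%N ->
  (forall x, N x ^+ q <= N (x ^+ q)) -> forall x n, N (x ^+ n) = N x ^+ n.
Proof.
move=> n1 q1 hq x n; apply/eqP; rewrite eq_le sn_X ?n1 //=.
have [->|x0] := eqVneq (N x) 0.
  by case: n => [|n]; rewrite ?expr0 ?n1 // expr0n (sn_ge0 hN).
have hqj j : N x ^+ (q ^ j) <= N (x ^+ (q ^ j)).
  elim: j => [|j IHj]; first by rewrite expn0 !expr1.
  rewrite expnSr !exprM; apply: le_trans (hq _).
  by rewrite lerXn2r // nnegrE ?exprn_ge0 ?(sn_ge0 hN).
have nq : (n <= q ^ n)%N by apply/ltnW/ltn_expl.
have := hqj n; rewrite -(subnKC nq) !exprD => h.
have := le_trans h (sn_M hN _ _).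
move=> /le_trans /(_ (ler_wpM2l (sn_ge0 hN _) (sn_X x (q ^ n - n) _))).
rewrite n1 => /(_ (lexx _)).
by rewrite ler_pM2r // exprn_gt0 // lt_neqAle eq_sym x0 (sn_ge0 hN).
Qed.

Definition powbounded c x := exists C, forall n, N (x ^+ n) <= C * c ^+ n.

(** By the ultrametric inequality the binomial coefficients cost nothing, so the two constants
    simply multiply. *)
Lemma powboundedB c x y : 0 <= c ->
  powbounded c x -> powbounded c y -> powbounded c (x - y).
Proof.
move=> c0 [C hx] [D hy].
have h z E n : (N (z ^+ n) <= E * c ^+ n) -> N (z ^+ n) <= `|E| * c ^+ n.
  move=> /le_trans; apply; rewrite ler_wpM2r ?exprn_ge0 // ler_norm //.
exists (`|C| * `|D|) => n; rewrite exprBn_comm; last exact: mulrC.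
apply: sn_sum => [|i _]; first by rewrite !mulr_ge0 ?exprn_ge0.
apply: le_trans (sn_Mn _ _) _; rewrite -(mulrA ((-1) ^+ _)) -signr_odd mulr_sign.
set z := x ^+ _ * _; have -> : N (if odd i then - z else z) = N z.
  by case: odd; rewrite ?sn_N.
apply: le_trans (sn_M hN _ _) _.
apply: le_trans (ler_pM (sn_ge0 hN _) (sn_ge0 hN _) (h _ _ _ (hx _)) (h _ _ _ (hy _))) _.
rewrite mulrACA -exprD subnK //.
by rewrite -ltnS.
Qed.

Lemma powboundedM c d x y : 0 <= c -> 0 <= d ->
  powbounded c x -> powbounded d y -> powbounded (c * d) (x * y).
Proof.
move=> c0 d0 [C hx] [D hy]; exists (`|C| * `|D|) => n.
rewrite exprMn; apply: le_trans (sn_M hN _ _) _.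
rewrite [(c * d) ^+ n]exprMn mulrACA; apply: ler_pM => //; try exact: (sn_ge0 hN).
  by apply: le_trans (hx n) _; rewrite ler_wpM2r ?exprn_ge0 // ler_norm.
by apply: le_trans (hy n) _; rewrite ler_wpM2r ?exprn_ge0 // ler_norm.
Qed.

Lemma powbounded_norm c x : N x <= c -> powbounded c x.
Proof.
move=> xc; have c0 := le_trans (sn_ge0 hN x) xc.
exists (Num.max 1 (N 1)) => -[|n].
  by rewrite !expr0 mulr1 le_max lexx orbT.
apply: le_trans (sn_XS _ _) _; apply: (@le_trans _ _ (c ^+ n.+1)).
  by rewrite lerXn2r ?nnegrE ?(sn_ge0 hN).
by rewrite ler_peMl ?exprn_ge0 // le_max lexx.
Qed.

Lemma powbounded_le c d x : 0 <= c -> c <= d -> powbounded c x -> powbounded d x.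
Proof.
move=> c0 cd [C h]; exists `|C| => n; apply: le_trans (h n) _.
apply: (@le_trans _ _ (`|C| * c ^+ n)).
  by rewrite ler_wpM2r ?exprn_ge0 // ler_norm.
by rewrite ler_wpM2l // lerXn2r // nnegrE // (le_trans c0).
Qed.

Lemma powbounded_sqr c x : 0 < c -> powbounded (c ^+ 2) (x ^+ 2) -> powbounded c x.
Proof.
move=> c0 [C h]; have hC m : N (x ^+ m.*2) <= `|C| * c ^+ m.*2.
  rewrite -mul2n !exprM; apply: le_trans (h _) _.
  by rewrite ler_wpM2r ?ler_norm // !exprn_ge0 // ltW.
exists (Num.max `|C| (N x * `|C| / c)) => n.
have cn m : 0 <= c ^+ m by rewrite exprn_ge0 // ltW.
rewrite -[n]odd_double_half; case: odd; rewrite ?add1n ?add0n.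
  rewrite !exprS; apply: le_trans (sn_M hN _ _) _.
  apply: le_trans (ler_wpM2l (sn_ge0 hN x) (hC _)) _.
  rewrite mulrA mulrA ler_wpM2r // -ler_pdivrMr //.
  by rewrite le_max lexx orbT.
by apply: le_trans (hC _) _; rewrite ler_wpM2r // le_max lexx.
Qed.

End SeminormTheory.

(** * Multiplicative seminorms and their valued fields *)

Section InfNonneg.
Variables (R : realType) (P : set R).
Hypothesis P0 : forall r, P r -> 0 <= r.

Lemma inf_le_mem r : P r -> inf P <= r.
Proof. by move=> Pr; apply: ge_inf => //; exists 0. Qed.

Lemma inf_lt_mem c : inf P < c -> (exists r, P r) -> exists2 r, P r & r < c.
Proof.
by move=> h ne; have [r Pr rc] := inf_lt ne h; exists r.
Qed.

Lemma le_inf_mem c : (exists r, P r) -> (forall r, P r -> c <= r) -> c <= inf P.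
Proof. by move=> ne h; apply: lb_le_inf. Qed.

End InfNonneg.

(** * Spectral radius, localization and minimal seminorms *)

Section SpectralRadius.
Variables (R : realType) (B : comPzRingType) (N : B -> R).
Hypothesis hN : is_snorm N.

(** The limit of the n-th roots of [N (x ^+ n)], written as an infimum of growth rates so that no
    limit has to be shown to exist. *)
Definition spectral_radius x : R := inf [set c | 0 < c /\ powbounded N c x]%classic.

Let mem_ge0 x (c : R) : [set c | 0 < c /\ powbounded N c x]%classic c -> 0 <= c.
Proof. by case=> /ltW. Qed.

Lemma spectral_radius_le x c : 0 < c -> powbounded N c x -> spectral_radius x <= c.
Proof. by move=> c0 h; apply: inf_le_mem => // ?; apply: mem_ge0. Qed.

Lemma spectral_radius_lt x c : spectral_radius x < c -> powbounded N c x.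
Proof.
move=> /inf_lt_mem[|d [d0 h] dc].
  exists (N x + 1); split; first by rewrite ltr_wpDl ?(sn_ge0 hN).
  by apply: powbounded_norm => //; rewrite lerDl.
by apply: powbounded_le h; rewrite ltW.
Qed.

Lemma spectral_radius_ge0 x : 0 <= spectral_radius x.
Proof.
apply: le_inf_mem; last by move=> r [/ltW].
exists (N x + 1); split; first by rewrite ltr_wpDl ?(sn_ge0 hN).
by apply: powbounded_norm => //; rewrite lerDl.
Qed.

Lemma spectral_radius_norm x : spectral_radius x <= N x.
Proof.
apply: le_of_gt => c h; apply: spectral_radius_le.
  by apply: le_lt_trans h; apply: (sn_ge0 hN).
exact/powbounded_norm/ltW.
Qed.

Lemma spectral_radius_snorm : is_snorm spectral_radius.
Proof.
split=> [||x y|x y]; first exact: spectral_radius_ge0.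
- apply/eqP; rewrite eq_le spectral_radius_ge0 andbT.
  by apply: le_trans (spectral_radius_norm _) _; rewrite (sn_0 hN).
- apply: le_of_gt => c; rewrite gt_max => /andP[xc yc].
  have c0 : 0 < c by apply: le_lt_trans xc; apply: spectral_radius_ge0.
  apply: spectral_radius_le => //.
  by apply: powboundedB; rewrite ?ltW //; apply: spectral_radius_lt.
- apply: le_mul_of_gt; try exact: spectral_radius_ge0.
  move=> c d xc yd.
  have c0 : 0 < c by apply: le_lt_trans xc; apply: spectral_radius_ge0.
  have d0 : 0 < d by apply: le_lt_trans yd; apply: spectral_radius_ge0.
  apply: spectral_radius_le; first exact: mulr_gt0.
  by apply: powboundedM; rewrite ?ltW //; apply: spectral_radius_lt.
Qed.

(** Passing to the spectral radius preserves the lower bound on the powers of [x], so a seminorm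
    minimal under that constraint can be compared with its spectral radius. *)
Lemma spectral_radius_expr s x : 0 <= s -> (forall n, s ^+ n <= N (x ^+ n)) ->
  forall n, s ^+ n <= spectral_radius (x ^+ n).
Proof.
move=> s0 hx n; apply: le_inf_mem.
  exists (N (x ^+ n) + 1); split; first by rewrite ltr_wpDl ?(sn_ge0 hN).
  by apply: powbounded_norm => //; rewrite lerDl.
move=> c [c0 [C hC]]; apply: (@bounded_powers_le _ _ _ C) => // [|j].
  exact: exprn_ge0.
by rewrite -exprM; apply: le_trans (hx _) _; rewrite exprM.
Qed.

End SpectralRadius.

Section Localization.
Variables (R : realType) (B : comPzRingType) (N : B -> R) (g : B).
Hypotheses (hN : is_snorm N) (g0 : 0 < N g).

(** The seminorm that [B] receives from its localization at [g] when the inverse of [g] is given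
    norm [(N g)^-1]. The quotients decrease with [n], so the infimum is a limit. *)
Definition loc_snorm h : R := inf [set N (h * g ^+ n) / N g ^+ n | n in [set: nat]]%classic.

Let ge0 h (c : R) :
  [set N (h * g ^+ n) / N g ^+ n | n in [set: nat]]%classic c -> 0 <= c.
Proof.
by case=> n _ <-; rewrite divr_ge0 ?exprn_ge0 ?(sn_ge0 hN).
Qed.

Let ne h : exists c : R,
  [set N (h * g ^+ n) / N g ^+ n | n in [set: nat]]%classic c.
Proof. by exists (N (h * g ^+ 0) / N g ^+ 0); exists 0. Qed.

Lemma loc_snorm_le h n : loc_snorm h <= N (h * g ^+ n) / N g ^+ n.
Proof. by apply: inf_le_mem; [apply: ge0|exists n]. Qed.

Lemma loc_snorm_lt h c : loc_snorm h < c ->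
  exists n, forall m, N (h * g ^+ (n + m)) < c * N g ^+ (n + m).
Proof.
move=> /inf_lt_mem[//|r [n _ <-]].
rewrite ltr_pdivrMr ?exprn_gt0 // => hn; exists n => m.
case: m => [|m]; first by rewrite addn0.
rewrite !exprD !mulrA; apply: le_lt_trans (sn_M hN _ _) _.
apply: (@le_lt_trans _ _ (N (h * g ^+ n) * N g ^+ m.+1)).
  by rewrite ler_wpM2l ?(sn_ge0 hN) // sn_XS.
by rewrite ltr_pM2r // exprn_gt0.
Qed.

Lemma loc_snorm_norm h : loc_snorm h <= N h.
Proof. by apply: le_trans (loc_snorm_le _ 0) _; rewrite !expr0 mulr1 divr1. Qed.

Lemma loc_snorm_ge h c :
  (forall n, c * N g ^+ n <= N (h * g ^+ n)) -> c <= loc_snorm h.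
Proof.
by move=> hc; apply: le_inf_mem => // _ [n _ <-]; rewrite ler_pdivlMr ?exprn_gt0.
Qed.

Lemma loc_snorm_ge0 h : 0 <= loc_snorm h.
Proof. by apply: loc_snorm_ge => n; rewrite mul0r (sn_ge0 hN). Qed.

Lemma loc_snorm_snorm : is_snorm loc_snorm.
Proof.
split=> [||x y|x y]; first exact: loc_snorm_ge0.
- apply/eqP; rewrite eq_le loc_snorm_ge0 andbT.
  by apply: le_trans (loc_snorm_norm _) _; rewrite (sn_0 hN).
- apply: le_of_gt => c; rewrite gt_max => /andP[/loc_snorm_lt[n hn] /loc_snorm_lt[m hm]].
  apply: le_trans (loc_snorm_le _ (n + m)) _; rewrite ler_pdivrMr ?exprn_gt0 //.
  rewrite mulrBl; apply: le_trans (sn_B hN _ _) _.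
  by rewrite ge_max (ltW (hn m)) /= addnC (ltW (hm n)).
- apply: le_mul_of_gt; try exact: loc_snorm_ge0.
  move=> c d /loc_snorm_lt[n hn] /loc_snorm_lt[m hm].
  apply: le_trans (loc_snorm_le _ (n + m)) _; rewrite ler_pdivrMr ?exprn_gt0 //.
  rewrite !exprD (mulrACA x) (mulrACA c).
  apply: le_trans (sn_M hN _ _) _; apply: ler_pM; try exact: (sn_ge0 hN).
    by have := hn 0; rewrite addn0 => /ltW.
  by have := hm 0; rewrite addn0 => /ltW.
Qed.

End Localization.

Section Berkovich.
Variables (R : realType) (B : comPzRingType) (N0 : B -> R) (f : B) (s : R).
Hypotheses (hN0 : is_snorm N0) (s0 : 0 < s).
Hypothesis hf : forall n, s ^+ n <= N0 (f ^+ n).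

(** The last condition passes to infima, and at [n = 0] it reads [1 <= N 1], which excludes the zero
    seminorm. *)
Let admissible (N : B -> R) :=
  [/\ is_snorm N, forall x, N x <= N0 x & forall n, s ^+ n <= N (f ^+ n)].

Let exists_minimal : exists2 N, admissible N &
  forall N', admissible N' -> (forall x, N' x <= N x) -> forall x, N x <= N' x.
Proof.
pose T := {N : B -> R | admissible N}.
pose r (N N' : T) : bool := `[< forall x, sval N' x <= sval N x >].
have a0 : admissible N0 by [].
have [|||[N aN] mN] := @ZL_preorder T (exist _ N0 a0) r.
- by move=> t; apply/asboolP.
- move=> u v w /asboolP uv /asboolP vw; apply/asboolP => x.
  exact: le_trans (vw x) (uv x).
(* The order [r] is reversed, so a chain is bounded by its pointwise infimum. This is again a
   seminorm because a single member of the chain comes close to the infimum at two given points. The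
   empty chain is bounded by [N0]. *)
- move=> A totA; have [[t At]|nA] := pselect (exists t, A t); last first.
    by exists (exist _ N0 a0) => t At; case: nA; exists t.
  pose M x := inf [set sval N x | N in A]%classic.
  have P0 x (c : R) : [set sval N x | N in A]%classic c -> 0 <= c.
    by case=> -[N [hN ? ?]] _ <-; apply: (sn_ge0 hN).
  have ne x : exists c, [set sval N x | N in A]%classic c.
    by exists (sval t x); exists t.
  have Mle N x : A N -> M x <= sval N x.
    by move=> AN; apply: inf_le_mem; [apply: P0|exists N].
  have Mlt x c : M x < c -> exists2 N, A N & sval N x < c.
    by move=> /inf_lt_mem[//|_ [N AN <-]]; exists N.
  have Mge0 x : 0 <= M x by apply: le_inf_mem => // c; apply: P0.
  have Mlt2 x y c d : M x < c -> M y < d ->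
      exists N, [/\ A N, sval N x < c & sval N y < d].
    move=> /Mlt[N AN Nx] /Mlt[N' AN' Ny].
    have [/asboolP h|/asboolP h] := totA _ _ AN AN'.
      by exists N'; split=> //; apply: le_lt_trans (h x) Nx.
    by exists N; split=> //; apply: le_lt_trans (h y) Ny.
  have hM : admissible M.
    split=> [|x|n].
    - split=> [//||x y|x y].
      + apply/eqP; rewrite eq_le Mge0 andbT; apply: le_trans (Mle _ _ At) _.
        by case: (svalP t) => ht _ _; rewrite (sn_0 ht).
      + apply: le_of_gt => c; rewrite gt_max => /andP[xc yc].
        have [N [AN Nx Ny]] := Mlt2 _ _ _ _ xc yc.
        apply: le_trans (Mle _ _ AN) _; case: (svalP N) => hN _ _.
        by apply: le_trans (sn_B hN _ _) _; rewrite ge_max !ltW.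
      + apply: le_mul_of_gt => // c d xc yd.
        have [N [AN Nx Ny]] := Mlt2 _ _ _ _ xc yd.
        apply: le_trans (Mle _ _ AN) _; case: (svalP N) => hN _ _.
        apply: le_trans (sn_M hN _ _) _.
        by apply: ler_pM; rewrite ?(sn_ge0 hN) // ltW.
    - by apply: le_trans (Mle _ _ At) _; case: (svalP t).
    - apply: le_inf_mem => // _ [N AN <-].
      by case: (svalP N).
  exists (exist _ M hM) => N AN; apply/asboolP => x /=; exact: Mle.
exists N => // N' aN' h x.
have /asboolP := mN (exist _ N' aN') (asboolT h); exact.
Qed.

(* A minimal seminorm among those bounded by N0 with N (f ^+ n) >= s ^+ n
   equals its own spectral radius, hence is power-multiplicative; then it
   equals its localizations, first at f and then at every g with N g > 0. *)
Lemma exists_multiplicative_snorm : exists2 N : B -> R,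
  is_snorm N & [/\ forall x, N x <= N0 x, N 1 = 1,
    forall x y, N (x * y) = N x * N y & s <= N f].
Proof.
have [N [hN NN0 Nf] minN] := exists_minimal.
have rho_min x c : 0 < c -> powbounded N c x -> N x <= c.
  move=> c0 /(spectral_radius_le c0); apply: le_trans; apply: minN.
    split; first exact: spectral_radius_snorm.
      by move=> y; apply: le_trans (NN0 y); apply: spectral_radius_norm.
    by apply: spectral_radius_expr => //; apply: ltW.
  by move=> y; apply: spectral_radius_norm.
have N1 : N 1 = 1.
  apply/eqP; rewrite eq_le; apply/andP; split; last first.
    by have := Nf 0; rewrite !expr0.
  by apply: rho_min => //; exists (N 1) => n; rewrite !expr1n mulr1.
have NX : forall x n, N (x ^+ n) = N x ^+ n.
  apply: (power_mult_of_prime hN N1 (isT : 1 < 2)%N) => x.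
  have h0 := sn_ge0 hN (x ^+ 2).
  suff h : N x <= Num.sqrt (N (x ^+ 2)).
    rewrite -[leRHS]sqr_sqrtr // lerXn2r // nnegrE ?(sn_ge0 hN) //.
    exact: sqrtr_ge0.
  apply: le_of_gt => c hc; have c0 : 0 < c := le_lt_trans (sqrtr_ge0 _) hc.
  apply: rho_min => //; apply: powbounded_sqr => //; apply: powbounded_norm => //.
  rewrite -[leLHS]sqr_sqrtr //; apply/ltW.
  by rewrite ltrXn2r ?nnegrE ?sqrtr_ge0 // ltW.
have loc_min g : 0 < N g -> (forall n, s ^+ n <= loc_snorm N g (f ^+ n)) ->
    forall h, N (h * g) = N h * N g.
  move=> g0 hg h; apply/eqP; rewrite eq_le (sn_M hN) /=.
  rewrite -ler_pdivlMr //; apply: (@le_trans _ _ (loc_snorm N g h)).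
    apply: minN => [|y]; last exact: loc_snorm_norm.
    split=> //; first exact: loc_snorm_snorm.
    by move=> y; apply: le_trans (NN0 y); apply: loc_snorm_norm.
  by apply: le_trans (loc_snorm_le g hN h 1) _; rewrite !expr1.
have Nfs : s <= N f by have := Nf 1; rewrite !expr1.
have Nf0 : 0 < N f by apply: lt_le_trans Nfs.
have Nfn n : s ^+ n <= N f ^+ n by rewrite lerXn2r // nnegrE ltW.
have fmul h : N (h * f) = N h * N f.
  apply: loc_min => // n; apply: loc_snorm_ge => // m.
  by rewrite -exprD NX exprD ler_wpM2r ?exprn_ge0 // ltW.
exists N => //; split=> // x y; have [y0|y0] := eqVneq (N y) 0.
  apply/eqP; rewrite y0 mulr0 eq_le (sn_ge0 hN) andbT.
  by apply: le_trans (sn_M hN _ _) _; rewrite y0 mulr0.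
have yp : 0 < N y by rewrite lt_neqAle eq_sym y0 (sn_ge0 hN).
apply: loc_min => // n; apply: loc_snorm_ge => // m.
have -> : N (f ^+ n * y ^+ m) = N f ^+ n * N y ^+ m.
  elim: n => [|n IHn]; first by rewrite !expr0 !mul1r NX.
  by rewrite !exprS -mulrA mulrC fmul IHn mulrC mulrA.
by rewrite ler_wpM2r // exprn_ge0 // ltW.
Qed.

End Berkovich.

(** * The valued field of a multiplicative seminorm *)

Section ResidueValuedField.
Local Open Scope quotient_scope.
Variables (R : realType) (B : comPzRingType) (N : B -> R).
Hypothesis hN : is_snorm N.
Hypothesis N1 : N 1 = 1.
Hypothesis NM : forall x y, N (x * y) = N x * N y.

(** The elements of seminorm 0 form a prime ideal. Fractions over its quotient are built in one
    step, with vanishing of [N] in place of equality in [ratio_rel]. *)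
Definition ratio := {u : B * B | N u.2 != 0}.
Implicit Types u v w : ratio.
Definition rnum u : B := (val u).1.
Definition rden u : B := (val u).2.

Lemma rden_neq0 u : N (rden u) != 0. Proof. exact: (valP u). Qed.

Definition ratio_rel u v : bool := N (rnum u * rden v - rnum v * rden u) == 0.

Lemma snorm0_mul x y : (N (x * y) == 0) = (N x == 0) || (N y == 0).
Proof. by rewrite NM mulf_eq0. Qed.

Lemma snorm0_sub x y : N x == 0 -> N y == 0 -> N (x - y) == 0.
Proof.
move=> /eqP x0 /eqP y0; rewrite eq_le (sn_ge0 hN) andbT.
by apply: le_trans (sn_B hN _ _) _; rewrite x0 y0 maxxx.
Qed.

Lemma snorm0_add x y : N x == 0 -> N y == 0 -> N (x + y) == 0.
Proof. by move=> x0 y0; rewrite -[y]opprK snorm0_sub // sn_N. Qed.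

Lemma snorm0_cancel y x : N y != 0 -> N (y * x) == 0 -> N x == 0.
Proof. by rewrite snorm0_mul => /negPf->. Qed.

Lemma snorm0_eq x y : N (x - y) == 0 -> N x = N y.
Proof.
move=> /eqP h; have le (a b : B) : N (a - b) = 0 -> N a <= N b.
  move=> e; rewrite -[a](subrK b); apply: le_trans (sn_D hN _ _) _.
  by rewrite e ge_max (sn_ge0 hN) lexx.
by apply/eqP; rewrite eq_le !le // -(sn_N hN) opprB.
Qed.

Lemma ratio_rel_equiv : equiv_class_of ratio_rel.
Proof.
split=> [u|u v|v u w]; rewrite /ratio_rel.
- by rewrite subrr (sn_0 hN).
- by rewrite -(sn_N hN) opprB.
- move=> uv vw; apply: (snorm0_cancel (rden_neq0 v)).
  have -> : rden v * (rnum u * rden w - rnum w * rden u)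
    = rden w * (rnum u * rden v - rnum v * rden u)
      + rden u * (rnum v * rden w - rnum w * rden v) by ring.
  by apply: snorm0_add; rewrite snorm0_mul ?uv ?vw orbT.
Qed.

Canonical ratio_equiv := EquivRelPack ratio_rel_equiv.

Definition ratio_field := {eq_quot ratio_equiv}.
HB.instance Definition _ := Choice.on ratio_field.
HB.instance Definition _ := EqQuotient.on ratio_field.

Definition ratio_pi u : ratio_field := \pi_ratio_field u.

Lemma ratio_piP u v : (ratio_pi u = ratio_pi v) <-> ratio_rel u v.
Proof. by split=> [/eqmodP|h]; last apply/eqmodP. Qed.

Lemma ratio_piK (x : ratio_field) : ratio_pi (repr x) = x.
Proof. exact: reprK. Qed.

Lemma ratio_repr u : ratio_rel (repr (ratio_pi u)) u.
Proof. by apply/ratio_piP; rewrite ratio_piK. Qed.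

Lemma ratioW (P : ratio_field -> Prop) : (forall u, P (ratio_pi u)) -> forall x, P x.
Proof. by move=> h x; rewrite -[x]ratio_piK. Qed.

Definition mkratio x y (h : N y != 0) : ratio := exist _ (x, y) h.

Lemma den_mul u v : N (rden u * rden v) != 0.
Proof. by rewrite snorm0_mul negb_or !rden_neq0. Qed.

Lemma den1 : N 1 != 0. Proof. by rewrite N1 oner_eq0. Qed.

Definition ratio_of x : ratio := mkratio x den1.
Definition radd u v := mkratio (rnum u * rden v + rnum v * rden u) (den_mul u v).
Definition ropp u := mkratio (- rnum u) (rden_neq0 u).
Definition rmul u v := mkratio (rnum u * rnum v) (den_mul u v).
Definition rinv u :=
  if pselect (N (rnum u) != 0) is left h then mkratio (rden u) h else ratio_of 0.

Definition fadd (x y : ratio_field) := ratio_pi (radd (repr x) (repr y)).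
Definition fopp (x : ratio_field) := ratio_pi (ropp (repr x)).
Definition fmul (x y : ratio_field) := ratio_pi (rmul (repr x) (repr y)).
Definition finv (x : ratio_field) := ratio_pi (rinv (repr x)).

Lemma rnum_mk x y h : rnum (@mkratio x y h) = x. Proof. by []. Qed.
Lemma rden_mk x y h : rden (@mkratio x y h) = y. Proof. by []. Qed.
Definition ratioE := (rnum_mk, rden_mk).

Lemma faddE u v : fadd (ratio_pi u) (ratio_pi v) = ratio_pi (radd u v).
Proof.
apply/ratio_piP; have := ratio_repr u; have := ratio_repr v.
rewrite /ratio_rel; set v' := repr (ratio_pi v); set u' := repr (ratio_pi u) => hv hu /=.
rewrite -[N _ == 0]/(N ((rnum u' * rden v' + rnum v' * rden u') * (rden u * rden v)
  - (rnum u * rden v + rnum v * rden u) * (rden u' * rden v')) == 0).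
have -> : (rnum u' * rden v' + rnum v' * rden u') * (rden u * rden v)
    - (rnum u * rden v + rnum v * rden u) * (rden u' * rden v')
  = (rden v * rden v') * (rnum u' * rden u - rnum u * rden u')
    + (rden u * rden u') * (rnum v' * rden v - rnum v * rden v') by ring.
by apply: snorm0_add; rewrite snorm0_mul ?hu ?hv orbT.
Qed.

Lemma foppE u : fopp (ratio_pi u) = ratio_pi (ropp u).
Proof.
apply/ratio_piP; have := ratio_repr u.
rewrite /ratio_rel; set u' := repr _ => hu /=.
rewrite -[N _ == 0]/(N (- rnum u' * rden u - - rnum u * rden u') == 0).
have -> : - rnum u' * rden u - - rnum u * rden u'
  = - (rnum u' * rden u - rnum u * rden u') by ring.
by rewrite (sn_N hN).
Qed.

Lemma fmulE u v : fmul (ratio_pi u) (ratio_pi v) = ratio_pi (rmul u v).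
Proof.
apply/ratio_piP; have := ratio_repr u; have := ratio_repr v.
rewrite /ratio_rel; set v' := repr (ratio_pi v); set u' := repr (ratio_pi u) => hv hu /=.
rewrite -[N _ == 0]/(N ((rnum u' * rnum v') * (rden u * rden v)
  - (rnum u * rnum v) * (rden u' * rden v')) == 0).
have -> : (rnum u' * rnum v') * (rden u * rden v)
    - (rnum u * rnum v) * (rden u' * rden v')
  = (rnum v' * rden v) * (rnum u' * rden u - rnum u * rden u')
    + (rnum u * rden u') * (rnum v' * rden v - rnum v * rden v') by ring.
by apply: snorm0_add; rewrite snorm0_mul ?hu ?hv orbT.
Qed.

Lemma ratio_pi_eq u v : rnum u * rden v = rnum v * rden u -> ratio_pi u = ratio_pi v.
Proof. by move=> e; apply/ratio_piP; rewrite /ratio_rel e subrr (sn_0 hN). Qed.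

Lemma faddA : associative fadd.
Proof.
elim/ratioW=> u; elim/ratioW=> v; elim/ratioW=> w; rewrite !faddE.
by apply: ratio_pi_eq; rewrite !ratioE; ring.
Qed.

Lemma faddC : commutative fadd.
Proof.
elim/ratioW=> u; elim/ratioW=> v; rewrite !faddE.
by apply: ratio_pi_eq; rewrite !ratioE; ring.
Qed.

Lemma fadd0 : left_id (ratio_pi (ratio_of 0)) fadd.
Proof.
elim/ratioW=> u; rewrite !faddE.
by apply: ratio_pi_eq; rewrite !ratioE; ring.
Qed.

Lemma faddN : left_inverse (ratio_pi (ratio_of 0)) fopp fadd.
Proof.
elim/ratioW=> u; rewrite foppE !faddE.
by apply: ratio_pi_eq; rewrite !ratioE; ring.
Qed.

HB.instance Definition _ := GRing.isZmodule.Build ratio_field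
  faddA faddC fadd0 faddN.

Lemma fmulA : associative fmul.
Proof.
elim/ratioW=> u; elim/ratioW=> v; elim/ratioW=> w; rewrite !fmulE.
by apply: ratio_pi_eq; rewrite !ratioE; ring.
Qed.

Lemma fmulC : commutative fmul.
Proof.
elim/ratioW=> u; elim/ratioW=> v; rewrite !fmulE.
by apply: ratio_pi_eq; rewrite !ratioE; ring.
Qed.

Lemma fmul1 : left_id (ratio_pi (ratio_of 1)) fmul.
Proof.
elim/ratioW=> u; rewrite !fmulE.
by apply: ratio_pi_eq; rewrite !ratioE; ring.
Qed.

Lemma fmulDl : left_distributive fmul +%R.
Proof.
elim/ratioW=> u; elim/ratioW=> v; elim/ratioW=> w.
rewrite -[ratio_pi u + _]/(fadd _ _) -[RHS]/(fadd _ _) !(faddE, fmulE).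
by apply: ratio_pi_eq; rewrite !ratioE; ring.
Qed.

Lemma fone_neq0 : ratio_pi (ratio_of 1) != 0.
Proof.
apply/negP => /eqP/ratio_piP; rewrite /ratio_rel /rnum /rden /=.
by rewrite !mulr1 subr0 (negPf den1).
Qed.

HB.instance Definition _ := GRing.Zmodule_isComNzRing.Build ratio_field
  fmulA fmulC fmul1 fmulDl fone_neq0.

Lemma ratio_pi_eq0 u : (ratio_pi u == 0) = (N (rnum u) == 0).
Proof.
apply/eqP/idP => [/ratio_piP|h]; last apply/ratio_piP; rewrite /ratio_rel /=.
  by rewrite {2}/rden {2}/rnum /= mulr1 mul0r subr0.
by rewrite {2}/rden {2}/rnum /= mulr1 mul0r subr0.
Qed.

Lemma fmulV x : x != 0 -> fmul (finv x) x = 1.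
Proof.
elim/ratioW: x => u u0; rewrite -{2}(ratio_piK (ratio_pi u)) /finv fmulE.
have : N (rnum (repr (ratio_pi u))) != 0 by rewrite -ratio_pi_eq0 ratio_piK.
set v := repr _; rewrite /rinv; case: pselect => // h _.
by apply: ratio_pi_eq; rewrite !ratioE; ring.
Qed.

Lemma finv0 : finv 0 = 0.
Proof.
rewrite /finv /rinv; case: pselect => [h|//].
by have := h; rewrite -ratio_pi_eq0 ratio_piK eqxx.
Qed.

HB.instance Definition _ := GRing.ComNzRing_isField.Build ratio_field
  fmulV finv0.

Definition fnorm (x : ratio_field) : R := N (rnum (repr x)) / N (rden (repr x)).

Lemma fnormE u : fnorm (ratio_pi u) = N (rnum u) / N (rden u).
Proof.
have := ratio_repr u; rewrite /ratio_rel /fnorm; set v := repr _.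
move=> /snorm0_eq; rewrite !NM => e.
by apply/eqP; rewrite eqr_div ?rden_neq0 // e.
Qed.

Lemma fnormM x y : fnorm (x * y) = fnorm x * fnorm y.
Proof.
elim/ratioW: x => u; elim/ratioW: y => v.
by rewrite -[_ * _ in LHS]/(fmul _ _) fmulE !fnormE !NM mulf_div.
Qed.

Lemma fnormD x y : fnorm (x + y) <= Num.max (fnorm x) (fnorm y).
Proof.
elim/ratioW: x => u; elim/ratioW: y => v.
rewrite -[_ + _ in leLHS]/(fadd _ _) faddE !fnormE.
have d0 w : 0 < N (rden w) by rewrite lt_neqAle eq_sym rden_neq0 (sn_ge0 hN).
rewrite NM ler_pdivrMr ?mulr_gt0 //; apply: le_trans (sn_D hN _ _) _.
rewrite !NM ge_max; apply/andP; split.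
  rewrite mulrA ler_wpM2r ?(sn_ge0 hN) // -ler_pdivrMr //.
  by rewrite le_max lexx.
rewrite [X in _ <= _ * X]mulrC mulrA ler_wpM2r ?(sn_ge0 hN) // -ler_pdivrMr //.
by rewrite le_max lexx orbT.
Qed.

Lemma fnorm_ge0 x : 0 <= fnorm x.
Proof. by rewrite divr_ge0 ?(sn_ge0 hN). Qed.

Lemma fnorm0 : fnorm 0 = 0.
Proof. by rewrite fnormE /rnum /= (sn_0 hN) mul0r. Qed.

Lemma fnorm1 : fnorm 1 = 1.
Proof. by rewrite fnormE /rnum /= N1 divr1. Qed.

Lemma fnorm0_eq0 x : fnorm x = 0 -> x = 0.
Proof.
elim/ratioW: x => u; rewrite fnormE => /eqP; rewrite mulf_eq0 invr_eq0.
by rewrite (negPf (rden_neq0 u)) orbF -ratio_pi_eq0 => /eqP.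
Qed.

Definition ratio_valued_field : valued_field R :=
  @ValuedField R ratio_field fnorm fnorm_ge0 fnorm0 fnorm0_eq0 fnorm1 fnormM fnormD.

Definition to_ratio (x : B) : ratio_valued_field := ratio_pi (ratio_of x).

Lemma to_ratio_zmod : zmod_morphism to_ratio.
Proof.
move=> x y; rewrite /to_ratio -[RHS]/(fadd _ (fopp _)) foppE faddE.
by apply: ratio_pi_eq; rewrite !ratioE; ring.
Qed.

Lemma to_ratio_monoid : monoid_morphism to_ratio.
Proof.
split=> [//|x y]; rewrite /to_ratio -[RHS]/(fmul _ _) fmulE.
by apply: ratio_pi_eq; rewrite !ratioE; ring.
Qed.

HB.instance Definition _ :=
  GRing.isZmodMorphism.Build B ratio_valued_field to_ratio to_ratio_zmod.
HB.instance Definition _ :=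
  GRing.isMonoidMorphism.Build B ratio_valued_field to_ratio to_ratio_monoid.

Lemma exists_valued_field : exists (F : valued_field R) (h : {rmorphism B -> F}),
  forall x, vnorm (h x) = N x.
Proof.
exists ratio_valued_field, to_ratio => x.
by rewrite /= fnormE /rnum /rden /= N1 divr1.
Qed.

End ResidueValuedField.

(** * Tensor product seminorms *)

Section GeneratedSeminorm.
Variables (R : realType) (B : comPzRingType) (I : eqType).
Variables (g : I -> B) (w : I -> R) (rel : B -> B -> Prop).
Hypothesis w0 : forall i, 0 <= w i.
Hypothesis rel0 : rel 0 0.
Hypothesis relB : forall x x' y y', rel x x' -> rel y y' -> rel (x - y) (x' - y').
Hypothesis relM : forall x x' y y', rel x x' -> rel y y' -> rel (x * y) (x' * y').
Hypothesis gM : forall i j, exists k, g i * g j = g k /\ w k <= w i * w j.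
Hypothesis gN : forall i, exists k, - g i = g k /\ w k = w i.
Hypothesis g_span : forall x, exists s, rel x (\sum_(i <- s) g i).

(** Two instances are used: with [rel] equality and pure tensors as generators, the tensor product
    seminorm; with [rel] a congruence and monomials as generators, a quotient seminorm, obtained
    without forming the quotient ring. *)
Definition gen_snorm (x : B) : R :=
  inf [set r | exists2 s : seq I,
    rel x (\sum_(i <- s) g i) & r = \big[Num.max/0]_(i <- s) w i]%classic.

Let mem_ge0 x (r : R) : [set r | exists2 s : seq I,
    rel x (\sum_(i <- s) g i) & r = \big[Num.max/0]_(i <- s) w i]%classic r -> 0 <= r.
Proof. by case=> s _ ->; apply: bigmax0_ge0. Qed.

Lemma gen_snorm_le x s c : rel x (\sum_(i <- s) g i) -> 0 <= c ->
  (forall i, i \in s -> w i <= c) -> gen_snorm x <= c.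
Proof.
move=> xs c0 h; apply: (@le_trans _ _ (\big[Num.max/0]_(i <- s) w i)).
  by apply: inf_le_mem; [apply: mem_ge0|exists s].
exact: bigmax0_le.
Qed.

Lemma gen_snorm_lt x c : gen_snorm x < c ->
  exists2 s, rel x (\sum_(i <- s) g i) & forall i, i \in s -> w i < c.
Proof.
move=> /inf_lt_mem[|_ [s xs ->] h].
  by have [s xs] := g_span x; exists (\big[Num.max/0]_(i <- s) w i), s.
by exists s => // i /(bigmax0_ge w)/le_lt_trans; apply.
Qed.

Lemma gen_snorm_ge x c :
  (forall s, rel x (\sum_(i <- s) g i) -> c <= \big[Num.max/0]_(i <- s) w i) ->
  c <= gen_snorm x.
Proof.
move=> h; apply: le_inf_mem => [|_ [s xs ->]]; last exact: h.
by have [s xs] := g_span x; exists (\big[Num.max/0]_(i <- s) w i), s.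
Qed.

Lemma gen_snorm_ge0 x : 0 <= gen_snorm x.
Proof. by apply: gen_snorm_ge => s _; apply: bigmax0_ge0. Qed.

Let gN_seq s : exists2 t, - (\sum_(i <- s) g i) = \sum_(i <- t) g i &
  forall c, (forall i, i \in s -> w i < c) -> forall i, i \in t -> w i < c.
Proof.
elim: s => [|i s [t et ht]]; first by exists [::]; rewrite ?big_nil ?oppr0.
have [j [ej wj]] := gN i; exists (j :: t); first by rewrite !big_cons -et -ej opprD.
move=> c hc k; rewrite inE => /predU1P[->|kt].
  by rewrite wj hc ?mem_head.
by apply: ht kt => m ms; apply: hc; rewrite inE ms orbT.
Qed.

Let gM_seq s t c d : (forall i, i \in s -> w i < c) -> (forall i, i \in t -> w i < d) ->
  exists2 u, (\sum_(i <- s) g i) * (\sum_(i <- t) g i) = \sum_(i <- u) g i &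
    forall i, i \in u -> w i <= c * d.
Proof.
move=> hs ht; elim: s hs => [|i s IHs] hs; first by exists [::]; rewrite ?big_nil ?mul0r.
have [|u eu hu] := IHs; first by move=> j js; apply: hs; rewrite inE js orbT.
have wi : w i < c by rewrite hs ?mem_head.
have [v ev hv] : exists2 v, g i * (\sum_(i <- t) g i) = \sum_(i <- v) g i &
    forall i, i \in v -> w i <= c * d.
  elim: t ht {eu IHs} => [|j t IHt] ht; first by exists [::]; rewrite ?big_nil ?mulr0.
  have [|v ev hv] := IHt; first by move=> k kt; apply: ht; rewrite inE kt orbT.
  have [k [ek wk]] := gM i j; exists (k :: v).
    by rewrite !big_cons mulrDr ek ev.
  move=> m; rewrite inE => /predU1P[->|]; last exact: hv.
  by apply: le_trans wk _; apply: ler_pM => //; apply/ltW => //; apply: ht; rewrite mem_head.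
exists (v ++ u); first by rewrite big_cat big_cons mulrDl eu ev.
by move=> j; rewrite mem_cat => /orP[/hv|/hu].
Qed.

Lemma gen_snorm_snorm : is_snorm gen_snorm.
Proof.
split=> [||x y|x y]; first exact: gen_snorm_ge0.
- apply/eqP; rewrite eq_le gen_snorm_ge0 andbT.
  by apply: (@gen_snorm_le _ [::]); rewrite ?big_nil.
- apply: le_of_gt => c; rewrite gt_max => /andP[xc yc].
  have c0 : 0 <= c by apply: ltW; apply: le_lt_trans xc; apply: gen_snorm_ge0.
  have [s xs hs] := gen_snorm_lt xc; have [t yt ht] := gen_snorm_lt yc.
  have [t' et' ht'] := gN_seq t.
  apply: (@gen_snorm_le _ (s ++ t')) => //.
    by rewrite big_cat -et'; apply: relB.
  by move=> i; rewrite mem_cat => /orP[/hs|/(ht' _ ht)] /ltW.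
- apply: le_mul_of_gt; try exact: gen_snorm_ge0.
  move=> c d xc yd.
  have c0 : 0 <= c by apply: ltW; apply: le_lt_trans xc; apply: gen_snorm_ge0.
  have d0 : 0 <= d by apply: ltW; apply: le_lt_trans yd; apply: gen_snorm_ge0.
  have [s xs hs] := gen_snorm_lt xc; have [t yt ht] := gen_snorm_lt yd.
  have [u eu hu] := gM_seq hs ht.
  apply: (@gen_snorm_le _ u) => //; last exact: mulr_ge0.
  by rewrite -eu; apply: relM.
Qed.

End GeneratedSeminorm.

Section AlgebraSeminorm.
Variables (R : realType) (k : valued_field R) (A : seminormed_alg k).

Lemma snorm_alg_snorm : is_snorm (@snorm R k A).
Proof.
have h0 : snorm (0 : A) = 0.
  by have := snormZ (s := A) 0 0; rewrite vnorm0 mul0r mulr0.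
split=> [|//|x y|]; [exact: snorm_ge0| |exact: snormM].
apply: le_trans (snormD _ _) _.
by have := snormZ (s := A) (-1) y; rewrite rmorphN1 mulN1r vnormN vnorm1 mul1r => ->.
Qed.

End AlgebraSeminorm.

Section FieldSeminorm.
Variables (R : realType) (k : valued_field R).

Lemma vnorm_snorm : is_snorm (@vnorm R k).
Proof.
split=> [|||x y]; [exact: vnorm_ge0|exact: vnorm0| |by rewrite vnormM].
by move=> x y; apply: le_trans (vnormD _ _) _; rewrite vnormN.
Qed.

Lemma vnormX (x : k) n : vnorm (x ^+ n) = vnorm x ^+ n.
Proof. by elim: n => [|n IHn]; rewrite ?expr0 ?vnorm1 // !exprS vnormM IHn. Qed.

Lemma vnorm_eq0 (x : k) : (vnorm x == 0) = (x == 0).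
Proof.
by apply/eqP/eqP => [/vnorm0_eq0|->] //; rewrite vnorm0.
Qed.

Lemma vnorm_gt0 (x : k) : (0 < vnorm x) = (x != 0).
Proof. by rewrite lt_neqAle eq_sym vnorm_eq0 vnorm_ge0 andbT. Qed.

Lemma vnormV (x : k) : vnorm x^-1 = (vnorm x)^-1.
Proof.
have [->|x0] := eqVneq x 0; first by rewrite invr0 vnorm0 invr0.
apply: (mulfI (x := vnorm x)); first by rewrite vnorm_eq0.
by rewrite -vnormM !divff ?vnorm1 ?vnorm_eq0.
Qed.

Lemma vnorm_nat n : vnorm (n%:R : k) <= 1.
Proof. by rewrite -[n%:R]/(1 *+ n); apply: le_trans (sn_Mn vnorm_snorm _ _) _; rewrite vnorm1. Qed.

End FieldSeminorm.

(** The bound at [x^-1] becomes the reverse bound at [x], since [N (h x) * N (h x^-1) = 1]. *)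
Lemma contractive_field_morphism_isometric (R : realType) (B : comPzRingType)
    (N : B -> R) (k : valued_field R) (h : {rmorphism k -> B}) :
  is_snorm N -> N 1 = 1 -> (forall x y, N (x * y) = N x * N y) ->
  (forall x, N (h x) <= vnorm x) -> forall x, N (h x) = vnorm x.
Proof.
move=> hN N1 NM hh x; have [->|x0] := eqVneq x 0.
  by rewrite rmorph0 (sn_0 hN) vnorm0.
apply/eqP; rewrite eq_le hh /=; have xp : 0 < vnorm x by rewrite vnorm_gt0.
have e1 : N (h x) * N (h x^-1) = 1 by rewrite -NM -rmorphM divff // rmorph1.
have : N (h x) * N (h x^-1) <= N (h x) / vnorm x.
  by rewrite ler_wpM2l ?(sn_ge0 hN) // -vnormV.
by rewrite e1 ler_pdivlMr // mul1r.
Qed.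

Section TensorSeminorm.
Variables (R : realType) (k : valued_field R) (A : seminormed_alg k).
Variable l : valued_ext k.
Local Notation T := (base_change A l).
Local Notation N := (tensor_snorm A l).
Local Notation "a (x) b" := (@tens k A (ext_alg l) a b : T)
  (at level 40, left associativity).

Let g (u : A * l) : T := u.1 (x) u.2.
Let w (u : A * l) : R := snorm u.1 * vnorm u.2.

Let w0 u : 0 <= w u.
Proof. by rewrite mulr_ge0 ?snorm_ge0 ?vnorm_ge0. Qed.

Lemma tens0l (b : l) : 0 (x) b = 0.
Proof.
by apply: (addrI (0 (x) b)); rewrite -[LHS](@tensDl k A (ext_alg l)) !addr0.
Qed.

Lemma tens0r (a : A) : a (x) 0 = 0.
Proof.
by apply: (addrI (a (x) 0)); rewrite -[LHS](@tensDr k A (ext_alg l)) !addr0.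
Qed.

Lemma tensNl (a : A) (b : l) : (- a) (x) b = - (a (x) b).
Proof.
apply: (addrI (a (x) b)).
by rewrite -[LHS](@tensDl k A (ext_alg l)) !subrr tens0l.
Qed.

Lemma tens_snorm_snorm : is_snorm N.
Proof.
apply: (@gen_snorm_snorm R T _ g w eq) => //.
- by move=> x x' y y' -> ->.
- by move=> x x' y y' -> ->.
- move=> [a b] [a' b']; exists (a * a', b * b'); rewrite /g /w /=.
  split; first exact: (@tensM k A (ext_alg l)).
  by rewrite vnormM mulrACA ler_wpM2r ?snormM // mulr_ge0 // vnorm_ge0.
- move=> [a b]; exists (- a, b); rewrite /g /w /= tensNl; split=> //.
  by rewrite (sn_N (snorm_alg_snorm A)).
- exact: tensor_sum.
Qed.

Lemma tens_snorm_le (a : A) (b : l) : N (a (x) b) <= snorm a * vnorm b.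
Proof.
apply: (@gen_snorm_le R T _ g w eq _ [:: (a, b)]) => //.
- by rewrite big_seq1.
- exact: (w0 (a, b)).
- by move=> i; rewrite inE => /eqP ->.
Qed.

Lemma tens_snorm_ge x c :
  (forall s : seq (A * l), x = \sum_(u <- s) (u.1 (x) u.2) ->
    c <= \big[Num.max/0]_(u <- s) (snorm u.1 * vnorm u.2)) -> c <= N x.
Proof. by move=> h; apply: (@gen_snorm_ge R T _ g w eq (@tensor_sum k A (ext_alg l))). Qed.

End TensorSeminorm.

(** * Orthogonal families *)

Section LinearForms.
Variables (R : realType) (K : valued_field R) (V : lmodType K).
Implicit Types (U W : set V) (u v w : V).

Definition subspace U := U 0 /\ forall a u v, U u -> U v -> U (a *: u + v).
Definition lin_form (f : V -> K) := forall a u v, f (a *: u + v) = a * f u + f v.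

Lemma subspaceD U u v : subspace U -> U u -> U v -> U (u + v).
Proof. by move=> [_ h] hu hv; rewrite -[u]scale1r; apply: h. Qed.

Lemma subspaceZ U a u : subspace U -> U u -> U (a *: u).
Proof. by move=> [h0 h] hu; rewrite -[_ *: _]addr0; apply: h. Qed.

Lemma subspaceB U u v : subspace U -> U u -> U v -> U (u - v).
Proof. by move=> hU hu hv; rewrite -scaleN1r; apply: subspaceD => //; apply: subspaceZ. Qed.

Lemma lin_form0 f : lin_form f -> f 0 = 0.
Proof. by move=> h; have := h (-1) 0 0; rewrite scaler0 addr0 mulN1r addNr. Qed.

Lemma lin_formD f u v : lin_form f -> f (u + v) = f u + f v.
Proof. by move=> h; rewrite -{1}[u]scale1r h mul1r. Qed.

Lemma lin_formZ f a u : lin_form f -> f (a *: u) = a * f u.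
Proof. by move=> h; rewrite -[_ *: _]addr0 h (lin_form0 h) addr0. Qed.

Lemma lin_formB f u v : lin_form f -> f (u - v) = f u - f v.
Proof. by move=> h; rewrite addrC -scaleN1r h mulN1r addrC. Qed.

Lemma lin_form_sum f (I : Type) (s : seq I) (F : I -> V) : lin_form f ->
  f (\sum_(i <- s) F i) = \sum_(i <- s) f (F i).
Proof.
by move=> h; apply: (big_morph f (fun u v => lin_formD u v h) (lin_form0 h)).
Qed.

(** A maximal subspace containing [U] and avoiding [w] is a hyperplane complementary to [w], and [f]
    reads off the coefficient of [w]. The form is defined on all of [V], as the universal property
    of the tensor product requires. *)
Lemma separating_form U w : subspace U -> ~ U w ->
  exists2 f, lin_form f & (forall u, U u -> f u = 0) /\ f w = 1.
Proof.
(* Testing the union of [U] and [W] rather than [W] keeps the empty set, the union of the empty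
   chain, inside [P]. *)
move=> hU Uw; pose P W := subspace (fun v => U v \/ W v) /\ ~ W w.
have [F sF totF|W [[hW Ww] maxW]] := @Zorn_bigcup V P.
  split; last by case=> X /sF[].
  split=> [|a u v]; first by left; case: hU.
  case: (pselect (exists X, F X)) => [[X0 FX0]|nF]; last first.
    case=> [Uu|[X /= FX]]; last by case: nF; exists X.
    case=> [Uv|[X /= FX]]; last by case: nF; exists X.
    by left; case: hU => _; apply.
  have up X u' v' : F X -> (U u' \/ X u') -> (U v' \/ X v') ->
      U (a *: u' + v') \/ (\bigcup_(X in F) X)%classic (a *: u' + v').
    move=> FX hu hv; have [[_ hX] _] := sF _ FX.
    by have [h|h] := hX a _ _ hu hv; [left|right; exists X].
  case=> [Uu|[X /= FX Xu]] [Uv|[Y /= FY Yv]].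
  - by apply: (up X0) => //; left.
  - by apply: (up Y) => //; [left|right].
  - by apply: (up X) => //; [right|left].
  - have [XY|YX] := totF _ _ FX FY.
      by apply: (up Y) => //; right => //; apply: XY.
    by apply: (up X) => //; right => //; apply: YX.
pose H v := U v \/ W v.
have Hw : ~ H w by case.
have hc v : exists c, H (v - c *: w).
  have [Hv|nHv] := pselect (H v); first by exists 0; rewrite scale0r subr0.
  (* [W'] is spanned by [H] and [v]. If it avoided [w], maximality would put [v] in [H]; so
     [w - c *: v] lies in [H], with [c] nonzero. *)
  pose W' x := exists c, H (x - c *: v).
  have HW' x : H x -> W' x by move=> Hx; exists 0; rewrite scale0r subr0.
  have hW' : subspace W'.
    split=> [|a x y [c Hc] [d Hd]]; first by apply: HW'; case: hW.
    exists (a * c + d); have -> : a *: x + y - (a * c + d) *: v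
      = a *: (x - c *: v) + (y - d *: v).
      by rewrite scalerBr scalerDl scalerA opprD addrACA.
    by case: hW => _; apply.
  have [c Hc] : W' w.
    apply: contrapT => nW'w; apply: (maxW W').
      split=> [x Wx|h]; first by apply: HW'; right.
      apply: nHv; right; apply: h; exists 1; rewrite scale1r subrr.
      by case: hW.
    split=> //; have -> : (fun x => U x \/ W' x) = W'; last by [].
    by apply: funext => x; apply: propext; split=> [[Ux|//]|]; [apply: HW'; left|right].
  have c0 : c != 0.
    by apply/negP => /eqP c0; apply: Hw; move: Hc; rewrite c0 scale0r subr0.
  exists c^-1; have -> : v - c^-1 *: w = (- c^-1) *: (w - c *: v).
    by rewrite scalerBr scalerA mulNr mulVf // scaleN1r opprK scaleNr addrC.
  exact: subspaceZ.
have [f hf] := choice hc.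
have f_uniq v c : H (v - c *: w) -> f v = c.
  move=> Hc; apply/eqP; rewrite -subr_eq0; apply/negPn/negP => d0; apply: Hw.
  rewrite -[w](scalerK d0); apply: subspaceZ => //.
  have -> : (f v - c) *: w = (v - c *: w) - (v - f v *: w).
    by rewrite opprB [RHS]addrC addrA subrK scalerBl.
  exact: subspaceB.
exists f => [a u v|]; last split=> [u Uu|].
- apply: f_uniq; have -> : a *: u + v - (a * f u + f v) *: w
    = a *: (u - f u *: w) + (v - f v *: w).
    by rewrite scalerBr scalerDl scalerA opprD addrACA.
  by case: hW => _; apply; apply: hf.
- by apply: f_uniq; rewrite scale0r subr0; left.
- by apply: f_uniq; rewrite scale1r subrr; case: hW.
Qed.

Lemma dual_forms n (e : 'I_n -> V) : family_free e ->
  exists phi : 'I_n -> V -> K,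
    (forall i, lin_form (phi i)) /\ forall i j, phi i (e j) = (i == j)%:R.
Proof.
move=> free_e.
suff h i : exists f, lin_form f /\ forall j, f (e j) = (i == j)%:R.
  have [phi hphi] := choice h; exists phi.
  by split=> [i|i j]; case: (hphi i).
pose U v := exists2 c : 'I_n -> K, v = \sum_j c j *: e j & c i = 0.
have hU : subspace U.
  split=> [|a _ _ [c -> ci] [d -> di]].
    by exists (fun=> 0) => //; rewrite big1 // => j _; rewrite scale0r.
  exists (fun j => a * c j + d j); last by rewrite ci di mulr0 addr0.
  rewrite scaler_sumr -big_split; apply: eq_bigr => j _.
  by rewrite scalerDl scalerA.
have delta j : e j = \sum_m (m == j)%:R *: e m.
  rewrite (bigD1 j) //= eqxx scale1r big1 ?addr0 // => m /negPf->.
  by rewrite scale0r.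
have nUi : ~ U (e i).
  case=> c ei ci; have := free_e (fun j => c j - (j == i)%:R).
  move=> /(_ _ i); rewrite ci eqxx sub0r => h.
  suff /eqP : - 1 = 0 :> K by rewrite oppr_eq0 oner_eq0.
  apply: h; under eq_bigr do rewrite scalerBl.
  by rewrite sumrB -ei -delta subrr.
have [f hf [fU fi]] := separating_form hU nUi.
exists f; split=> // j; have [<-//|ij] := eqVneq i j.
by apply: fU; exists (fun m => (m == j)%:R); rewrite -?delta // (negPf ij).
Qed.

(** The sum of [U] and the span of [g], built one vector at a time to serve as the induction
    parameter of the projection argument. *)
Fixpoint extend U (g : seq V) : set V :=
  if g is w :: g' then [set v | exists c, extend U g' (v - c *: w)]%classic else U.

Lemma extend_sub U g u : U u -> extend U g u.
Proof.
by elim: g => //= w g IHg Uu; exists 0; rewrite scale0r subr0; apply: IHg.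
Qed.

Lemma subspace_extend U g : subspace U -> subspace (extend U g).
Proof.
move=> hU; elim: g => //= w g IHg; split=> [|a u v [c hc] [d hd]].
  by exists 0; rewrite scale0r subr0; case: IHg.
exists (a * c + d); have -> : a *: u + v - (a * c + d) *: w
  = a *: (u - c *: w) + (v - d *: w).
  by rewrite scalerBr scalerDl scalerA opprD addrACA.
by case: IHg => _; apply.
Qed.

Lemma extend_mem U g v : subspace U -> v \in g -> extend U g v.
Proof.
move=> hU; elim: g => //= w g IHg; rewrite inE => /predU1P[->|/IHg h].
  by exists 1; rewrite scale1r subrr; case: (subspace_extend g hU).
by exists 0; rewrite scale0r subr0.
Qed.

End LinearForms.

Section AlmostContractiveProjection.
Variables (R : realType) (k : valued_field R) (V : lmodType k) (N : V -> R).
Hypothesis N_ge0 : forall v, 0 <= N v.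
Hypothesis ND : forall u v, N (u + v) <= Num.max (N u) (N v).
Hypothesis NZ : forall a v, N (a *: v) = vnorm a * N v.
Hypothesis N_eq0 : forall v, N v = 0 -> v = 0.

Let NB u v : N (u - v) <= Num.max (N u) (N v).
Proof.
apply: le_trans (ND _ _) _.
by rewrite -scaleN1r NZ vnormN vnorm1 mul1r.
Qed.

Let small_scale (T : seq V) (f : V -> R) : (forall v, 0 <= f v) ->
  (forall v, v = 0 -> f v = 0) ->
  exists2 d, 0 < d & forall v, v \in T -> f v * d <= N v.
Proof.
move=> f0 fv0; elim: T => [|v T [d d0 hd]]; first by exists 1.
have [v0|v0] := eqVneq v 0.
  exists d => // u; rewrite inE => /predU1P[->|]; last exact: hd.
  by rewrite fv0 // mul0r N_ge0.
have Nv : 0 < N v.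
  by rewrite lt_neqAle N_ge0 andbT eq_sym; apply: contra v0 => /eqP/N_eq0->.
have f1 : 0 < f v + 1 by rewrite ltr_wpDl.
exists (Num.min d (N v / (f v + 1))); first by rewrite lt_min d0 divr_gt0.
move=> u; rewrite inE => /predU1P[->|uT].
  apply: (@le_trans _ _ (f v * (N v / (f v + 1)))).
    by rewrite ler_wpM2l // ge_min lexx orbT.
  rewrite mulrCA ler_piMr // ler_pdivrMr // mul1r lerDl //.
by apply: le_trans (hd u uT); rewrite ler_wpM2l // ge_min lexx.
Qed.

(** Vectors [w] are removed one at a time by projecting along [w - w'], with [w'] a nearly best
    approximation of [w] in the smaller space. Finiteness of [T] matters when [w] lies in the
    closure of that space: [chi] is then unbounded, but a [w'] close enough to [w] keeps the
    projection under control on [T], because nonzero vectors have nonzero norm. *)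
Lemma almost_contractive_forms n (e : 'I_n -> V) (T : seq V) (C : R) :
  family_free e -> 1 < C ->
  exists phi : 'I_n -> V -> k,
    [/\ forall i, lin_form (phi i), forall i j, phi i (e j) = (i == j)%:R &
      forall v, v \in T -> N (\sum_i phi i v *: e i) <= C * N v].
Proof.
move=> free_e; pose U := family_span e.
have hU : subspace U.
  split=> [|a _ _ [c ->] [d ->]].
    by exists (fun=> 0); rewrite big1 // => j _; rewrite scale0r.
  exists (fun j => a * c j + d j); rewrite scaler_sumr -big_split.
  by apply: eq_bigr => j _; rewrite scalerDl scalerA.
have Ue i : U (e i).
  exists (fun j => (j == i)%:R); rewrite (bigD1 i) //= eqxx scale1r big1 ?addr0 //.
  by move=> m /negPf->; rewrite scale0r.
suff h g : forall S : seq V, (forall v, v \in S -> extend U g v) -> forall C : R, 1 < C ->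
  exists phi : 'I_n -> V -> k,
    [/\ forall i, lin_form (phi i), forall i j, phi i (e j) = (i == j)%:R &
      forall v, v \in S -> N (\sum_i phi i v *: e i) <= C * N v].
  by move=> C1; apply: (h T T) => // v; apply: extend_mem.
elim: g => [|w g IHg] S hS {}C C1.
  have [phi [lphi dphi]] := dual_forms free_e; exists phi; split=> // v /hS[c ev].
  suff -> : \sum_i phi i v *: e i = v by rewrite ler_peMl // ltW.
  rewrite ev; apply: eq_bigr => i _; congr (_ *: _).
  rewrite lin_form_sum // (bigD1 i) //= lin_formZ // dphi eqxx mulr1 big1 ?addr0 //.
  by move=> j ji; rewrite lin_formZ // dphi eq_sym (negPf ji) mulr0.
pose U' := extend U g; have hU' : subspace U' := subspace_extend g hU.
have [U'w|nU'w] := pselect (U' w).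
  apply: IHg => // v /hS[c hc]; rewrite -[v](subrK (c *: w)).
  by apply: subspaceD => //; apply: subspaceZ.
have [chi lchi [chiU chiw]] := separating_form hU' nU'w.
have hS' v : v \in S -> U' (v - chi v *: w).
  move=> /hS[c hc]; suff -> : chi v = c by [].
  apply/eqP; rewrite -subr_eq0.
  by have := chiU _ hc; rewrite lin_formB // lin_formZ // chiw mulr1 => ->.
(* One factor [C1'] pays for the present projection, the other for the induction hypothesis. *)
have [C1' hC1 hCC] := exists_gt1_pow 2 C1.
have [w' U'w' hw'] : exists2 w', U' w' &
    forall v, v \in S -> vnorm (chi v) * N (w - w') <= C1' * N v.
  pose D := inf [set N (w - u) | u in U']%classic.
  have D_ge0 r : [set N (w - u) | u in U']%classic r -> 0 <= r by case=> u _ <-.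
  have Dne : exists r, [set N (w - u) | u in U']%classic r.
    by exists (N (w - 0)); exists 0 => //; case: hU'.
  have [D0|D0] := ltP 0 D.
    have [||_ [u U'u <-] uD] := @inf_lt_mem _ [set N (w - u) | u in U']%classic (C1' * D).
      by rewrite ltr_pMl.
      by [].
    exists u => // v vS; have [c0|c0] := eqVneq (chi v) 0.
      by rewrite c0 vnorm0 mul0r mulr_ge0 // ltW // (lt_trans ltr01).
    have vn : 0 < vnorm (chi v) by rewrite vnorm_gt0.
    apply: le_trans (ler_wpM2l (ltW vn) (ltW uD)) _.
    rewrite mulrCA ler_wpM2l //; first by rewrite ltW // (lt_trans ltr01).
    (* This exhibits [N v] as [vnorm (chi v)] times the distance from [w] to a point of [U'], hence
       at least [vnorm (chi v) * D]. *)
    have -> : N v = vnorm (chi v) * N (w - (- (chi v)^-1 *: (v - chi v *: w))).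
      rewrite -NZ scaleNr opprK scalerDr scalerA divff // scale1r.
      by rewrite addrC subrK.
    rewrite (ler_wpM2l (ltW vn)) //.
    apply: (inf_le_mem D_ge0); exists (- (chi v)^-1 *: (v - chi v *: w)) => //.
    by apply: subspaceZ => //; apply: hS'.
  have [||d d0 hd] := @small_scale S (fun v => vnorm (chi v)).
  - by move=> v; apply: vnorm_ge0.
  - by move=> v ->; rewrite lin_form0 // vnorm0.
  have [|//|_ [u U'u <-] ud] := @inf_lt_mem _ [set N (w - u) | u in U']%classic d.
    exact: le_lt_trans D0 d0.
  exists u => // v vS; apply: (@le_trans _ _ (N v)); last by rewrite ler_peMl // ltW.
  by apply: le_trans (hd v vS); rewrite ler_wpM2l ?vnorm_ge0 // ltW.
pose pi v := v - chi v *: (w - w').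
have lpi a u v : pi (a *: u + v) = a *: pi u + pi v.
  by rewrite /pi lchi scalerDl -scalerA scalerBr opprD addrACA.
have [|phi [lphi dphi hphi]] := IHg (map pi S) _ C1' hC1.
  move=> _ /mapP[v vS ->]; have -> : pi v = (v - chi v *: w) + chi v *: w'.
    by rewrite /pi scalerBr opprB addrA addrAC.
  by apply: subspaceD; [|apply: hS'|apply: subspaceZ].
exists (fun i v => phi i (pi v)); split=> [i a u v|i j|v vS].
- by rewrite lpi lphi.
- by rewrite /pi chiU ?scale0r ?subr0 //; apply: extend_sub.
apply: le_trans (hphi _ (map_f pi vS)) _.
apply: (@le_trans _ _ (C1' * (C1' * N v))); last first.
  by rewrite mulrA -expr2 ler_wpM2r // ltW.
rewrite ler_wpM2l //; first by rewrite ltW // (lt_trans ltr01).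
apply: le_trans (NB _ _) _; rewrite NZ ge_max hw' // andbT.
by rewrite ler_peMl // ltW.
Qed.

End AlmostContractiveProjection.

Lemma le_of_gt1_mul (R : realType) (a b : R) : 0 <= a ->
  (forall C, 1 < C -> a <= C * b) -> a <= b.
Proof.
move=> a0 h; apply: (@le_of_lt1_scaling R 0 1) => // t _ t0 t1.
by rewrite expr1 mulrC -ler_pdivlMr // mulrC h // invf_gt1.
Qed.

Section OrthogonalFamilies.
Variables (R : realType) (k : valued_field R) (V : lmodType k) (N : V -> R).
Hypothesis N_ge0 : forall v, 0 <= N v.
Hypothesis ND : forall u v, N (u + v) <= Num.max (N u) (N v).
Hypothesis NZ : forall a v, N (a *: v) = vnorm a * N v.
Hypothesis N_eq0 : forall v, N v = 0 -> v = 0.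

(** A termwise variant of [r_orthogonal]. Nonzero norms are included so that such a family is free
    as soon as [0 < t]. *)
Definition norm_orthogonal (t : R) n (e : 'I_n -> V) :=
  (forall i, 0 < N (e i)) /\
  forall (c : 'I_n -> k) i, t * (vnorm (c i) * N (e i)) <= N (\sum_j c j *: e j).

Lemma norm_orthogonal_free t n (e : 'I_n -> V) : 0 < t -> norm_orthogonal t e -> family_free e.
Proof.
move=> t0 [e0 he] c ec i; have N0 : N 0 = 0.
  by rewrite -[0 in LHS](scale0r 0) NZ vnorm0 mul0r.
apply/eqP; rewrite -vnorm_eq0 eq_le vnorm_ge0 andbT.
by have := he c i; rewrite ec N0 pmulr_rle0 // pmulr_lle0.
Qed.

Definition cons_family n (v : V) (e : 'I_n -> V) (i : 'I_n.+1) : V :=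
  if unlift ord0 i is Some j then e j else v.

Lemma cons_family0 n v (e : 'I_n -> V) : cons_family v e ord0 = v.
Proof. by rewrite /cons_family unlift_none. Qed.

Lemma cons_familyS n v (e : 'I_n -> V) i : cons_family v e (lift ord0 i) = e i.
Proof. by rewrite /cons_family liftK. Qed.

Lemma cons_family_sum n v (e : 'I_n -> V) (c : 'I_n.+1 -> k) :
  \sum_i c i *: cons_family v e i = c ord0 *: v + \sum_i c (lift ord0 i) *: e i.
Proof.
rewrite big_ord_recl cons_family0; congr (_ + _).
by apply: eq_bigr => i _; rewrite cons_familyS.
Qed.

Definition cons_coef n (a : k) (c : 'I_n -> k) (i : 'I_n.+1) : k :=
  if unlift ord0 i is Some j then c j else a.

Lemma cons_coef_sum n v (e : 'I_n -> V) a (c : 'I_n -> k) :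
  \sum_i cons_coef a c i *: cons_family v e i = a *: v + \sum_i c i *: e i.
Proof.
rewrite cons_family_sum /cons_coef unlift_none; congr (_ + _).
by apply: eq_bigr => i _; rewrite liftK.
Qed.

Lemma exists_free_spanning (s : seq V) :
  exists n (e : 'I_n -> V), family_free e /\ forall v, v \in s -> family_span e v.
Proof.
elim: s => [|v s [n [e [free_e he]]]].
  by exists 0%N, (fun=> 0); split=> // c _ [].
have [hv|hv] := pselect (family_span e v).
  by exists n, e; split=> // u; rewrite inE => /predU1P[->|/he].
exists n.+1, (cons_family v e); split=> [c|u].
  rewrite cons_family_sum => h.
  have c0 : c ord0 = 0.
    apply/eqP; apply: contrapT => /negP c0; apply: hv.
    exists (fun i => - (c ord0)^-1 * c (lift ord0 i)).
    have /(congr1 (fun x => (c ord0)^-1 *: x)) := h.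
    rewrite scaler0 scalerDr scalerA mulVf // scale1r => /eqP.
    rewrite addr_eq0 => /eqP ->; rewrite scaler_sumr -sumrN.
    by apply: eq_bigr => i _; rewrite scalerA mulNr scaleNr.
  move: h; rewrite c0 scale0r add0r => /free_e cS i.
  by case: (unliftP ord0 i) => [j ->|->].
rewrite inE => /predU1P[->|/he[c ->]].
  exists (cons_coef 1 (fun=> 0)); rewrite cons_coef_sum scale1r big1 ?addr0 //.
  by move=> i _; rewrite scale0r.
by exists (cons_coef 0 c); rewrite cons_coef_sum scale0r add0r.
Qed.

(* e_0 is corrected by a nearly best approximation from the span of the other
   vectors; the distance is positive because e is r-orthogonal. *)
Lemma improve_orthogonal r t n (e : 'I_n -> V) : 0 < r -> 0 < t -> t < 1 ->
  norm_orthogonal r e ->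
  exists e' : 'I_n -> V, norm_orthogonal t e' /\ family_span e = family_span e'.
Proof.
move=> r0; elim: n e t => [|n IHn] e t t0 t1 [e0 he].
  by exists e; split=> //; split=> [[]//|c []].
have ti : 1 < t^-1 by rewrite invf_gt1.
(* One factor [C] is lost in the choice of [u], another in the orthogonality of [f']. *)
have [C C1 Ct] := exists_gt1_pow 2 ti; have C0 := lt_trans ltr01 C1.
pose f i := e (lift ord0 i).
have ef : e = cons_family (e ord0) f.
  apply: funext => i; case: (unliftP ord0 i) => [j ->|->].
    by rewrite cons_familyS.
  by rewrite cons_family0.
have [|||f' [[f'0 hf'] spanf]] := IHn f C^-1.
- by rewrite invr_gt0.
- by rewrite invf_lt1.
- split=> [i|c i]; first exact: e0.
  have := he (cons_coef 0 c) (lift ord0 i).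
  by rewrite {2}ef cons_coef_sum scale0r add0r /cons_coef liftK.
pose D := inf [set N (e ord0 - u) | u in family_span f]%classic.
have D_ge0 z : [set N (e ord0 - u) | u in family_span f]%classic z -> 0 <= z.
  by case=> u _ <-.
have Dne : exists z, [set N (e ord0 - u) | u in family_span f]%classic z.
  exists (N (e ord0 - 0)); exists 0 => //; exists (fun=> 0).
  by rewrite big1 // => i _; rewrite scale0r.
have D0 : 0 < D.
  apply: (@lt_le_trans _ _ (r * N (e ord0))); first exact: mulr_gt0.
  apply: le_inf_mem => // _ [_ [c ->] <-].
  have := he (cons_coef 1 (fun i => - c i)) ord0.
  rewrite {2}ef cons_coef_sum /cons_coef unlift_none vnorm1 mul1r scale1r.
  by under eq_bigr do rewrite scaleNr; rewrite sumrN.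
have [|//|_ [u hu <-] uD] := @inf_lt_mem _
  [set N (e ord0 - u) | u in family_span f]%classic (C * D).
  by rewrite ltr_pMl.
exists (cons_family (e ord0 - u) f'); split; [split=> [i|c i]|].
- case: (unliftP ord0 i) => [j ->|->]; first by rewrite cons_familyS.
  rewrite cons_family0; apply: lt_le_trans D0 _.
  by apply: (inf_le_mem D_ge0); exists u.
- rewrite cons_family_sum; set w := \sum_j _; set v := _ + w.
  have hw : family_span f w by rewrite spanf; exists (fun j => c (lift ord0 j)).
  have cN : vnorm (c ord0) * N (e ord0 - u) <= C * N v.
    have [c0|c0] := eqVneq (c ord0) 0.
      by rewrite c0 vnorm0 mul0r mulr_ge0 // ltW.
    have cp : 0 < vnorm (c ord0) by rewrite vnorm_gt0.
    apply: le_trans (ler_wpM2l (ltW cp) (ltW uD)) _.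
    rewrite mulrCA (ler_wpM2l (ltW C0)) //.
    have -> : v = c ord0 *: (e ord0 - (u - (c ord0)^-1 *: w)).
      by rewrite opprB addrA scalerBr scalerDr scalerA divff // scale1r addrAC -scalerBr.
    rewrite NZ (ler_wpM2l (ltW cp)) //; apply: (inf_le_mem D_ge0).
    exists (u - (c ord0)^-1 *: w) => //.
    case: hu hw => [a ->] [b ->]; exists (fun j => a j - (c ord0)^-1 * b j).
    rewrite scaler_sumr -sumrB; apply: eq_bigr => j _.
    by rewrite scalerBl scalerA.
  have wN : N w <= C * N v.
    have -> : w = v - c ord0 *: (e ord0 - u) by rewrite /v addrC addKr.
    apply: le_trans (ND _ _) _; rewrite -scaleN1r !NZ vnormN vnorm1 mul1r ge_max cN andbT.
    by rewrite ler_peMl // ltW.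
  have Ct' x : 0 <= x -> t * (C * (C * x)) <= x.
    move=> x0; rewrite mulrA mulrA -[X in _ <= X]mul1r ler_wpM2r //.
    by rewrite -mulrA -expr2 mulrC -ler_pdivlMr // mul1r ltW.
  case: (unliftP ord0 i) => [j ->|->].
    rewrite cons_familyS; apply: le_trans (Ct' _ (N_ge0 v)).
    rewrite (ler_wpM2l (ltW t0)) //; apply: (@le_trans _ _ (C * N w)).
      by rewrite -ler_pdivrMl // (hf' (fun j => c (lift ord0 j)) j).
    by rewrite (ler_wpM2l (ltW C0)).
  rewrite cons_family0; apply: le_trans (Ct' _ (N_ge0 v)).
  rewrite (ler_wpM2l (ltW t0)) //; apply: le_trans cN _.
  by rewrite (ler_wpM2l (ltW C0)) // ler_peMl // ltW.
- rewrite {1}ef; apply/seteqP; split=> _ [c ->]; rewrite cons_family_sum.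
    have : family_span f' (c ord0 *: u + \sum_i c (lift ord0 i) *: f i).
      rewrite -spanf; case: hu => a ->; exists (fun j => c ord0 * a j + c (lift ord0 j)).
      rewrite scaler_sumr -big_split; apply: eq_bigr => j _.
      by rewrite scalerDl scalerA.
    case=> b hb; exists (cons_coef (c ord0) b).
    by rewrite cons_coef_sum -hb addrA scalerBr subrK.
  have : family_span f (- (c ord0 *: u) + \sum_i c (lift ord0 i) *: f' i).
    have [d hd] : family_span f (\sum_i c (lift ord0 i) *: f' i).
      by rewrite spanf; exists (fun i => c (lift ord0 i)).
    case: hu => a ->; exists (fun j => - (c ord0 * a j) + d j); rewrite hd.
    rewrite scaler_sumr -sumrN -big_split; apply: eq_bigr => j _.
    by rewrite scalerDl scalerA scaleNr.
  case=> b hb; exists (cons_coef (c ord0) b).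
  by rewrite cons_coef_sum -hb addrA scalerBr.
Qed.

(** The length [n] is fixed before [t]: the tame case loses a factor [t ^+ (2 * n)] and then lets
    [t] tend to 1. This is possible because all the families are bases of one subspace, the span of
    [s]. *)
Lemma weakly_cartesian_orthogonal (s : seq V) : weakly_cartesian N ->
  exists n, forall t, 0 < t -> t < 1 -> exists e : 'I_n -> V,
    norm_orthogonal t e /\ forall v, v \in s -> family_span e v.
Proof.
move=> wc; have [n0 [e0 [free0 span0]]] := exists_free_spanning s.
have [|n [e [[free_e eW] [r [r0 r1 he]]]]] := wc (family_span e0).
  by exists n0, e0.
have orth_e : norm_orthogonal r e.
  split=> [i|c i].
    rewrite lt_neqAle N_ge0 andbT eq_sym; apply/negP => /eqP/N_eq0 ei.
    have h : \sum_j (j == i)%:R *: e j = 0.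
      by rewrite (bigD1 i) //= ei scaler0 add0r big1 // => j /negPf->; rewrite scale0r.
    by have /eqP := free_e _ h i; rewrite eqxx oner_eq0.
  apply: le_trans (he c); rewrite -NZ (ler_wpM2l (ltW r0)) //.
  by apply: (bigmax0_ge (fun i => N (c i *: e i))); rewrite mem_index_enum.
exists n => t t0 t1; have [e' [he' spane]] := improve_orthogonal r0 t0 t1 orth_e.
by exists e'; split=> // v /span0; rewrite -spane -eW.
Qed.

End OrthogonalFamilies.

Section AlgebraAsNormedSpace.
Variables (R : realType) (k : valued_field R) (A : normed_alg k).
Local Notation V := (alg_vect A).
Local Notation N := (@snorm R k A : V -> R).

Lemma alg_normD (u v : V) : N (u + v) <= Num.max (N u) (N v).
Proof. exact: snormD. Qed.

Lemma alg_normZ (a : k) (v : V) : N (a *: v) = vnorm a * N v.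
Proof. exact: snormZ. Qed.

Lemma weakly_cartesian_alg_orthogonal (s : seq A) : weakly_cartesian_alg A ->
  exists n, forall t, 0 < t -> t < 1 -> exists e : 'I_n -> A,
    norm_orthogonal N t (e : 'I_n -> V) /\ forall a, a \in s -> family_span (e : 'I_n -> V) a.
Proof.
exact: (@weakly_cartesian_orthogonal R k V N (@snorm_ge0 _ _ _) alg_normD alg_normZ
  (@snorm0_eq0 _ _ A) s).
Qed.

End AlgebraAsNormedSpace.

(** * Lower bounds for the tensor product seminorm *)

Section TensorLowerBound.
Variables (R : realType) (k : valued_field R) (A : normed_alg k).
Variable l : valued_ext k.
Local Notation T := (base_change A l).
Local Notation N := (tensor_snorm A l).
Local Notation "a (x) b" := (@tens k A (ext_alg l) a b : T)
  (at level 40, left associativity).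

(** Tensoring [phi i] with the identity of [l] isolates [b i]. The forms depend on the
    representation [s], being controlled only on its left components; this suffices because the
    seminorm is an infimum over representations. *)
Lemma tens_coefficients n (e : 'I_n -> A) (b : 'I_n -> l) (s : seq (A * l)) (C : R) :
  family_free (e : 'I_n -> alg_vect A) -> 1 < C ->
  \sum_i e i (x) b i = \sum_(u <- s) u.1 (x) u.2 ->
  exists phi : 'I_n -> A -> k,
    (forall i, b i = \sum_(u <- s) ext_map l (phi i u.1) * u.2) /\
    forall u, u \in s -> snorm (\sum_i alg_map A (phi i u.1) * e i) <= C * snorm u.1.
Proof.
move=> free_e C1 es.
have [phi [lphi dphi hphi]] := @almost_contractive_forms R k (alg_vect A)
  (@snorm R k A) (@snorm_ge0 _ _ _) (@alg_normD _ _ A) (@alg_normZ _ _ A) (@snorm0_eq0 _ _ A) n e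
  (map fst s) C free_e C1.
exists phi; split=> [i|u us]; last by apply: hphi; apply: map_f.
pose f (a : A) (d : l) : l := ext_map l (phi i a) * d.
have [|||h [[hD hf] _]] := @tensor_univ k A (ext_alg l) l f.
- by move=> a a' d; rewrite /f (lin_formD _ _ (lphi i)) rmorphD mulrDl.
- by move=> a d d'; rewrite /f mulrDr.
- move=> c a d; rewrite /f; have -> : phi i (alg_map A c * a) = c * phi i a.
    have hz := lin_formZ (c : k) (a : alg_vect A) (lphi i). exact: hz.
  by rewrite rmorphM mulrCA mulrA.
have h0 : h 0 = 0 by apply: (addrI (h 0)); rewrite -hD !addr0.
have := congr1 h es; rewrite !(big_morph h hD h0) => eh.
have -> : \sum_(u <- s) ext_map l (phi i u.1) * u.2
    = \sum_(u <- s) h (u.1 (x) u.2) by apply: eq_bigr => u _; rewrite hf.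
rewrite -eh (bigD1 i) //= hf /f dphi eqxx rmorph1 mul1r big1 ?addr0 // => j ji.
by rewrite hf /f dphi eq_sym (negPf ji) rmorph0 mul0r.
Qed.

Local Notation orth t e := (norm_orthogonal (V := alg_vect A) (@snorm R k A) t e).

(** Each representation makes [b i] a sum of products [phi i u.1 * u.2]. Orthogonality bounds [t]
    times the norm of [phi i u.1] times that of [e i] by the norm of the projection of [u.1], which
    is nearly contractive. *)
Lemma tens_orthogonal_ge n t (e : 'I_n -> A) (b : 'I_n -> l) i : 0 < t -> orth t e ->
  t * (snorm (e i) * vnorm (b i)) <= N (\sum_j e j (x) b j).
Proof.
move=> t0 he; apply: tens_snorm_ge => s es; set M := \big[_/_]_(_ <- _) _.
have M0 : 0 <= M by apply: bigmax0_ge0.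
apply: le_of_gt1_mul => [|C C1].
  by rewrite !mulr_ge0 ?snorm_ge0 ?vnorm_ge0 // ltW.
have [phi [hb hphi]] := tens_coefficients (norm_orthogonal_free (@alg_normZ _ _ A) t0 he) C1 es.
have te : 0 < t * snorm (e i) by case: he => e0 _; rewrite mulr_gt0.
have C0 : 0 < C := lt_trans ltr01 C1.
rewrite mulrA mulrC -ler_pdivlMr //; rewrite (hb i).
apply: (sn_sum (vnorm_snorm _)) => [|u us].
  exact: divr_ge0 (mulr_ge0 (ltW C0) M0) (ltW te).
rewrite ler_pdivlMr // vnormM ext_norm.
apply: (@le_trans _ _ (C * (snorm u.1 * vnorm u.2))); last first.
  rewrite (ler_wpM2l (ltW C0)) //.
  exact: (bigmax0_ge (fun u : A * l => snorm u.1 * vnorm u.2)).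
have -> : vnorm (phi i u.1) * vnorm u.2 * (t * snorm (e i))
  = t * (vnorm (phi i u.1) * snorm (e i)) * vnorm u.2 by ring.
rewrite [leRHS]mulrA ler_wpM2r ?vnorm_ge0 //.
by apply: le_trans (hphi u us); case: he => _; apply.
Qed.

Lemma tens_sum_le (I : eqType) (s : seq I) (a : I -> A) (b : I -> l) c : 0 <= c ->
  (forall i, i \in s -> snorm (a i) * vnorm (b i) <= c) ->
  N (\sum_(i <- s) a i (x) b i) <= c.
Proof.
move=> c0 h; apply: (sn_sum (tens_snorm_snorm A l)) => // i /h.
exact/le_trans/tens_snorm_le.
Qed.

Lemma tens_snorm1 (a : A) : N (a (x) 1) = snorm a.
Proof.
apply/eqP; rewrite eq_le; apply/andP; split.
  by apply: le_trans (tens_snorm_le _ _) _; rewrite vnorm1 mulr1.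
have [->|a0] := eqVneq (snorm a) 0; first exact: (sn_ge0 (tens_snorm_snorm A l)).
have ha : orth 1 (fun _ : 'I_1 => a).
  split=> [_|c i]; first by rewrite lt_neqAle eq_sym a0 snorm_ge0.
  by rewrite mul1r big_ord1 -alg_normZ (ord1 i).
by have := tens_orthogonal_ge (fun=> 1) ord0 ltr01 ha; rewrite big_ord1 mul1r vnorm1 mulr1.
Qed.

Lemma tens_expand n (e : 'I_n -> A) (s : seq (A * l)) :
  (forall u, u \in s -> family_span (e : 'I_n -> alg_vect A) u.1) ->
  exists b : 'I_n -> l, \sum_(u <- s) u.1 (x) u.2 = \sum_i e i (x) b i.
Proof.
elim: s => [|[a d] s IHs] h.
  by exists (fun=> 0); rewrite big_nil big1 // => i _; apply: tens0r.
have [|b hb] := IHs; first by move=> u us; apply: h; rewrite inE us orbT.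
have [c /= ea] := h _ (mem_head _ _).
exists (fun i => ext_map l (c i) * d + b i); rewrite big_cons hb /= ea.
under [RHS]eq_bigr do rewrite (@tensDr k A (ext_alg l)).
rewrite big_split /=; congr (_ + _).
rewrite (big_morph (fun a : A => a (x) d) (fun a a' => @tensDl k A (ext_alg l) a a' d) (tens0l A d)).
by apply: eq_bigr => i _; apply: (@tens_bal k A (ext_alg l)).
Qed.

End TensorLowerBound.

Section ChangeOfExtension.
Variables (R : realType) (k : valued_field R) (A : seminormed_alg k).
Variables (l m : valued_ext k) (sigma : {rmorphism l -> m}).
Hypothesis sigma_ext : forall c, sigma (ext_map l c) = ext_map m c.
Hypothesis sigma_norm : forall x, vnorm (sigma x) = vnorm x.

(** A contractive ring morphism does not raise the growth rate of powers. The last clause records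
    this because in the tame case an element is controlled through the growth of its powers. *)
Lemma base_change_map : exists h : base_change A l -> base_change A m,
  [/\ {morph h : x y / x + y},
    forall a b, h (@tens k A (ext_alg l) a b) = @tens k A (ext_alg m) a (sigma b) &
    forall x c, powbounded (tensor_snorm A l) c x ->
      powbounded (tensor_snorm A m) c (h x)].
Proof.
pose f (a : A) (b : l) : base_change A m := @tens k A (ext_alg m) a (sigma b).
have [|||h [[hD hf] _]] := @tensor_univ k A (ext_alg l) (base_change A m) f.
- by move=> a a' d; apply: (@tensDl k A (ext_alg m)).
- by move=> a d d'; rewrite /f rmorphD; apply: (@tensDr k A (ext_alg m)).
- move=> c a d; rewrite /f rmorphM /= sigma_ext.
  exact: (@tens_bal k A (ext_alg m)).
have h0 : h 0 = 0 by apply: (addrI (h 0)); rewrite -hD !addr0.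
have hM x y : h (x * y) = h x * h y.
  have [s ->] := tensor_sum x; have [t ->] := tensor_sum y.
  rewrite mulr_suml !(big_morph h hD h0) mulr_suml; apply: eq_bigr => u _.
  rewrite mulr_sumr !(big_morph h hD h0) mulr_sumr; apply: eq_bigr => v _.
  rewrite !hf (@tensM k A (ext_alg l)) hf /f rmorphM.
  exact: (esym (@tensM k A (ext_alg m) _ _ _ _)).
have h1 : h 1 = 1 by rewrite -[1](@tens11 k A (ext_alg l)) hf /f rmorph1.
have hX x n : h (x ^+ n) = h x ^+ n.
  by elim: n => [|n IHn]; rewrite ?expr0 // !exprS hM IHn.
have hN x : tensor_snorm A m (h x) <= tensor_snorm A l x.
  apply: tens_snorm_ge => s ->; rewrite (big_morph h hD h0).
  apply: (sn_sum (tens_snorm_snorm A m)) => [|u us]; first exact: bigmax0_ge0.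
  rewrite hf; apply: le_trans (tens_snorm_le _ _) _; rewrite sigma_norm.
  exact: (bigmax0_ge (fun u : A * l => snorm u.1 * vnorm u.2)).
exists h; split=> // x c [C hC]; exists C => n.
by rewrite -hX; apply: le_trans (hN _) (hC n).
Qed.

End ChangeOfExtension.

(** * The wild case *)

Section FrobeniusModP.
Variables (R : realType) (B : comPzRingType) (N : B -> R) (p : nat).
Hypotheses (hN : is_snorm N) (pp : prime p).

Let frob_add c (x y : B) : N x <= c -> N y <= c ->
  exists2 z, (x + y) ^+ p = x ^+ p + y ^+ p + z *+ p & N z <= c ^+ p.
Proof.
case: p pp => // -[//|q] pq xc yc; have c0 := le_trans (sn_ge0 hN x) xc.
(* The two extreme binomial terms are split off. In the remaining ones both exponents are positive,
   so [sn_XS] bounds them without any control of [N 1]. *)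
exists (\sum_(i < q.+1) (x ^+ (q.+1 - i) * y ^+ i.+1) *+ ('C(q.+2, i.+1) %/ q.+2)).
  rewrite exprDn big_ord_recl big_ord_recr /= subn0 expr0 mulr1 bin0 mulr1n.
  rewrite subnn expr0 mul1r binn mulr1n [X in _ + X = _]addrC addrA.
  congr (_ + _); rewrite -sumrMnl; apply: eq_bigr => i _.
  rewrite /bump /= !add1n -mulrnA divnK ?subSS //.
  by apply: prime_dvd_bin => //=; rewrite ltnS; apply: ltn_ord.
apply: (sn_sum hN) => [|i _]; first exact: exprn_ge0.
apply: le_trans (sn_Mn hN _ _) _; apply: le_trans (sn_M hN _ _) _.
have -> : c ^+ q.+2 = c ^+ (q.+1 - i) * c ^+ i.+1.
  by rewrite -exprD addnS subnK // ltnW.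
have le u n : N u <= c -> N (u ^+ n.+1) <= c ^+ n.+1.
  move=> uc; apply: le_trans (sn_XS hN _ _) _.
  by rewrite lerXn2r // nnegrE ?(sn_ge0 hN).
apply: ler_pM; rewrite ?(sn_ge0 hN) ?le //.
by rewrite subSn -1?ltnS // le.
Qed.

Lemma frobenius_sum (I : eqType) (s : seq I) (x : I -> B) M : 0 <= M ->
  (forall i, i \in s -> N (x i) ^+ p <= M) ->
  exists2 z, (\sum_(i <- s) x i) ^+ p = \sum_(i <- s) x i ^+ p + z *+ p & N z <= M.
Proof.
move=> M0 hM; have [c c0 cM] := exists_nth_root (prime_gt0 pp) M0.
have {}hM i : i \in s -> N (x i) <= c.
  by move=> /hM; rewrite -cM ler_pXn2r ?prime_gt0 // nnegrE (sn_ge0 hN).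
rewrite -cM; elim: s hM => [|i s IHs] h.
  exists 0; last by rewrite (sn_0 hN) exprn_ge0.
  by rewrite !big_nil mul0rn addr0 expr0n gtn_eqF // prime_gt0.
have h' j : j \in s -> N (x j) <= c by move=> js; apply: h; rewrite inE js orbT.
have [z ez hz] := IHs h'.
have [z' ez' hz'] := frob_add (h _ (mem_head _ _)) (sn_sum hN c0 h').
exists (z + z'); last by apply: le_trans (sn_D hN _ _) _; rewrite ge_max hz hz'.
by rewrite !big_cons ez' ez mulrnDl !addrA.
Qed.

End FrobeniusModP.

Section PthPowerDistance.
Variables (R : realType) (F : valued_field R) (p : nat).
Implicit Types a c : F.

Lemma pdist_le a c : pdist p a <= vnorm (a - c ^+ p).
Proof. by apply: inf_le_mem => [_ [d _ <-]|]; [apply: vnorm_ge0|exists c]. Qed.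

Lemma pdist_lt a e : pdist p a < e -> exists c, vnorm (a - c ^+ p) < e.
Proof.
move=> /inf_lt_mem[|_ [c _ <-] hc]; last by exists c.
by exists (vnorm (a - 0 ^+ p)), 0.
Qed.

End PthPowerDistance.

Section WildCase.
Variables (R : realType) (k : valued_field R) (p : nat) (A : normed_alg k).
Hypotheses (pp : prime p) (p1 : vnorm (p%:R : k) < 1).

(** Thickness speaks of [p]-regular elements only, but failure of regularity, in [k] or in [l],
    already puts [c] within about the norm of [p * c] of a p-th power. Averaging with 1 in [r]
    leaves room to choose [d] near an infimum. *)
Lemma p_versal_approx (l : valued_ext k) : p_versal p l ->
  exists2 r : R, 0 <= r < 1 &
    forall c : k, exists d : l, vnorm (ext_map l c - d ^+ p) <= r * vnorm c.
Proof.
case=> r0 r01 hl; pose r := (Num.max r0 (vnorm (p%:R : k)) + 1) / 2.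
have m1 : Num.max r0 (vnorm (p%:R : k)) < 1 by rewrite gt_max r01.
have [] := midf_lt m1; rewrite -/r gt_max => /andP[r0r pr] r1.
have rp : 0 < r by apply: le_lt_trans pr; apply: vnorm_ge0.
exists r => [|c]; first by rewrite ltW.
have [->|c0] := eqVneq c 0.
  by exists 0; rewrite rmorph0 expr0n gtn_eqF ?prime_gt0 // subr0 !vnorm0 mulr0.
have cp : 0 < vnorm c by rewrite vnorm_gt0.
have pk : pdist p c <= vnorm c.
  by have := pdist_le p c 0; rewrite expr0n gtn_eqF ?prime_gt0 // subr0.
have [hk|hk] := pselect (p_regular p c); last first.
  have : pdist p c < r * vnorm c.
    move: hk => /negP; rewrite -leNgt vnormM => /le_lt_trans; apply.
    by rewrite ltr_pM2r.
  move=> /pdist_lt[d hd]; exists (ext_map l d).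
  by rewrite -rmorphXn -rmorphB ext_norm ltW.
have : pdist p (ext_map l c) < r * vnorm c.
  have [hl'|hl'] := pselect (p_regular p (ext_map l c)); last first.
    move: hl' => /negP; rewrite -leNgt => /le_lt_trans; apply.
    by rewrite -(rmorph_nat (ext_map l)) -rmorphM ext_norm vnormM ltr_pM2r.
  have := hl c hk; rewrite /pnorm !asboolT // => /le_lt_trans; apply.
  apply: (@lt_le_trans _ _ (r * pdist p c)); last by rewrite (ler_wpM2l (ltW rp)).
  rewrite ltr_pM2r //; apply: le_lt_trans hk; exact: vnorm_ge0.
by move=> /pdist_lt[d hd]; exists d; apply: ltW.
Qed.

Local Notation orth t e := (norm_orthogonal (V := alg_vect A) (@snorm R k A) t e).

Section Tensor.
Variable m : valued_ext k.
Local Notation T := (base_change A m).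
Local Notation N := (tensor_snorm A m).
Local Notation "a (x) b" := (@tens k A (ext_alg m) a b : T)
  (at level 40, left associativity).

Lemma tensX (a : A) (b : m) n : (a (x) b) ^+ n = a ^+ n (x) b ^+ n.
Proof.
elim: n => [|n IHn]; first by rewrite !expr0.
by rewrite !exprS IHn; apply: (@tensM k A (ext_alg m)).
Qed.

Lemma tens_natr n : (n%:R : T) = 1 (x) n%:R.
Proof.
elim: n => [|n IHn].
  apply: (addrI (1 (x) 0)); rewrite addr0 -[RHS](@tensDr k A (ext_alg m)).
  by rewrite addr0.
by rewrite !mulrS IHn (@tensDr k A (ext_alg m)).
Qed.

Lemma tens_snorm_natr (x : T) n : snorm (1 : A) = 1 -> N (x *+ n) <= vnorm (n%:R : k) * N x.
Proof.
move=> n1; have -> : x *+ n = (1 (x) n%:R) * x by rewrite -tens_natr mulr_natl.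
apply: le_trans (sn_M (tens_snorm_snorm A m) _ _) _.
rewrite ler_wpM2r ?(sn_ge0 (tens_snorm_snorm A m)) //.
apply: le_trans (tens_snorm_le _ _) _; rewrite n1 mul1r.
by rewrite -(rmorph_nat (ext_map m)) ext_norm.
Qed.

Lemma spectral_snorm : spectral N -> forall (a : A) n, snorm (a ^+ n) = snorm a ^+ n.
Proof.
move=> hs a n; rewrite -!(tens_snorm1 m) -hs tensX.
by rewrite expr1n.
Qed.

Lemma tens_frobenius n (e : 'I_n -> A) (b : 'I_n -> m) M : snorm (1 : A) = 1 -> 0 <= M ->
  (forall i, (snorm (e i) * vnorm (b i)) ^+ p <= M) ->
  exists2 z, (\sum_i e i (x) b i) ^+ p = \sum_i e i ^+ p (x) b i ^+ p + z &
    N z <= vnorm (p%:R : k) * M.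
Proof.
move=> n1 M0 hM.
have [|z ez hz] := frobenius_sum (tens_snorm_snorm A m) pp (s := index_enum 'I_n)
  (x := fun i => e i (x) b i) M0.
  move=> i _; apply: le_trans (hM i).
  rewrite lerXn2r ?nnegrE ?mulr_ge0 ?snorm_ge0 ?vnorm_ge0 ?(sn_ge0 (tens_snorm_snorm A m)) //.
  exact: tens_snorm_le.
exists (z *+ p); first by rewrite ez; congr (_ + _); apply: eq_bigr => i _; rewrite tensX.
apply: le_trans (tens_snorm_natr _ _ n1) _.
by rewrite ler_wpM2l ?vnorm_ge0.
Qed.

End Tensor.

(** With [M] the largest norm of a term, spectrality over [l] gives the p-th power of the sum of the
    [e i] tensored with [d i] a norm at least [t ^+ p * M]. Dropping the cross terms costs at most
    the norm of [p] times [M], and replacing [d i ^+ p] by [c i] at most [r * M]. Both are strictly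
    smaller, whence the two conditions on [t ^+ p]. *)
Lemma orthogonal_pth_powers (l : valued_ext k) (r t : R) n (e : 'I_n -> A) :
  spectral (tensor_snorm A l) ->
  0 <= r -> (forall c : k, exists d : l, vnorm (ext_map l c - d ^+ p) <= r * vnorm c) ->
  0 < t -> r < t ^+ p -> vnorm (p%:R : k) < t ^+ p -> r < 1 ->
  orth t e -> orth (t ^+ p) (fun i => e i ^+ p : A).
Proof.
move=> hs r0 hr t0 rt pt r1 he; have hX := spectral_snorm hs.
have n1 : snorm (1 : A) = 1 by have := hX 1 0; rewrite !expr0.
split=> [i|c i]; first by rewrite hX exprn_gt0 //; case: he.
pose F i := vnorm (c i) * snorm (e i) ^+ p.
rewrite hX -/(F i).
have [i0 _ hi0'] := @arg_maxP _ _ _ i xpredT F isT.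
have hi0 j : F j <= F i0 by apply: hi0'.
apply: (@le_trans _ _ (t ^+ p * F i0)).
  by rewrite ler_wpM2l ?exprn_ge0 ?hi0 // ltW.
set M := F i0; have M0 : 0 <= M by rewrite mulr_ge0 ?vnorm_ge0 // exprn_ge0 // snorm_ge0.
have [M00|Mn0] := eqVneq M 0; first by rewrite M00 mulr0 snorm_ge0.
have Mp : 0 < M by rewrite lt_neqAle eq_sym Mn0.
have [d hd] := choice (fun i => hr (c i)).
have c0 j : 0 <= vnorm (c j) by apply: vnorm_ge0.
have dle j : vnorm (d j) ^+ p <= vnorm (c j).
  rewrite -vnormX -[d j ^+ p](subKr (ext_map l (c j))).
  apply: le_trans (sn_B (vnorm_snorm _) _ _) _; rewrite ext_norm ge_max lexx /=.
  by apply: le_trans (hd j) _; rewrite ler_piMl // ltW.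
(* As [r < 1], the difference [c i0 - d i0 ^+ p] is too small to account for the norm of [c i0]. *)
have dge : vnorm (c i0) <= vnorm (d i0) ^+ p.
  have := vnormD (ext_map l (c i0) - d i0 ^+ p) (d i0 ^+ p).
  rewrite subrK ext_norm vnormX le_max => /orP[|//] /le_trans /(_ (hd i0)).
  have ci0 : 0 < vnorm (c i0).
    rewrite lt_neqAle c0 andbT eq_sym; apply/negP => /eqP h.
    by move: Mn0; rewrite /M /F h mul0r eqxx.
  by rewrite ler_pMl // leNgt r1.
have [|z ez hz] := @tens_frobenius l n e d M n1 M0.
  move=> j; apply: le_trans (hi0 j); rewrite exprMn mulrC.
  by rewrite ler_wpM2r ?exprn_ge0 ?snorm_ge0.
pose E := \sum_j @tens k A (ext_alg l) (e j ^+ p) (ext_map l (c j) - d j ^+ p) : base_change A l.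
have hE : tensor_snorm A l E <= r * M.
  apply: tens_sum_le => [|j _]; first exact: mulr_ge0.
  rewrite hX; apply: (@le_trans _ _ (snorm (e j) ^+ p * (r * vnorm (c j)))).
    by rewrite ler_wpM2l ?exprn_ge0 ?snorm_ge0.
  rewrite mulrCA ler_wpM2l // mulrC; exact: hi0.
set S := \sum_j _.
have eS : @tens k A (ext_alg l) S 1 = (\sum_j @tens k A (ext_alg l) (e j) (d j)) ^+ p - z + E
    :> base_change A l.
  rewrite ez addrK /E -big_split /= /S.
  rewrite (big_morph (fun a : A => @tens k A (ext_alg l) a 1)
    (fun a a' => @tensDl k A (ext_alg l) a a' 1) (tens0l A 1)).
  apply: eq_bigr => j _; rewrite -[RHS](@tensDr k A (ext_alg l)) addrC subrK.
  rewrite -[ext_map l (c j)]mulr1; exact: (@tens_bal k A (ext_alg l)).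
have hT := tens_snorm_snorm A l.
have hy : t ^+ p * M <= tensor_snorm A l ((\sum_j @tens k A (ext_alg l) (e j) (d j)) ^+ p).
  rewrite hs; apply: (@le_trans _ _ ((t * (snorm (e i0) * vnorm (d i0))) ^+ p)).
    rewrite !exprMn (ler_wpM2l (exprn_ge0 _ (ltW t0))) // /M /F mulrC.
    by rewrite ler_wpM2l // exprn_ge0 // snorm_ge0.
  rewrite lerXn2r ?nnegrE ?(sn_ge0 hT) //.
    by rewrite !mulr_ge0 ?snorm_ge0 ?vnorm_ge0 // ltW.
  exact: tens_orthogonal_ge.
rewrite leNgt; apply/negP => hlt; move: hy; apply/negP; rewrite -ltNge.
have -> : (\sum_j @tens k A (ext_alg l) (e j) (d j)) ^+ p
  = (@tens k A (ext_alg l) S 1 : base_change A l) - E + z by rewrite eS addrK subrK.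
apply: le_lt_trans (sn_D hT _ _) _; rewrite gt_max; apply/andP; split.
  apply: le_lt_trans (sn_B hT _ _) _; rewrite gt_max tens_snorm1 hlt /=.
  by apply: le_lt_trans hE _; rewrite ltr_pM2r.
by apply: le_lt_trans hz _; rewrite ltr_pM2r.
Qed.

Lemma wild_geometrically_spectral (l : valued_ext k) : weakly_cartesian_alg A ->
  p_versal p l -> spectral (tensor_snorm A l) -> geometrically_spectral A.
Proof.
move=> wc /p_versal_approx[r /andP[r0 r1] hr] hs m.
have hX := spectral_snorm hs.
have n1 : snorm (1 : A) = 1 by have := hX 1 0; rewrite !expr0.
have hT := tens_snorm_snorm A m.
have N1 : tensor_snorm A m 1 = 1 by rewrite -n1 -(tens_snorm1 m).
(* It is enough to test p-th powers, which the Frobenius expansion controls. *)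
apply: (power_mult_of_prime hT N1 (prime_gt1 pp)) => x.
have [s ->] := tensor_sum x; set y := \sum_(_ <- _) _.
have [n hn] := weakly_cartesian_alg_orthogonal (map fst s) wc.
pose q := Num.max r (vnorm (p%:R : k)).
have q0 : 0 <= q by rewrite le_max r0.
have q1 : q < 1 by rewrite gt_max r1.
(* q < t ^+ p as soon as u^-1 < t. *)
have [u u1 hu] : exists2 u, 1 < u & u ^+ p * q < 1.
  have [q00|qn0] := eqVneq q 0; first by exists 2; rewrite ?q00 ?mulr0 // ltr1n.
  have qp : 0 < q by rewrite lt_neqAle eq_sym qn0.
  have [|u u1 hu] := @exists_gt1_pow R p q^-1; first by rewrite invf_gt1.
  by exists u => //; rewrite -ltr_pdivlMr // mul1r.
have up : 0 < u := lt_trans ltr01 u1.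
apply: (@le_of_lt1_scaling R u^-1 p).
- by rewrite invf_lt1.
- by rewrite exprn_ge0 // (sn_ge0 hT).
move=> t ut t0 t1; have [e [he spane]] := hn t t0 t1.
have qt : q < t ^+ p.
  apply: (@lt_trans _ _ (u^-1 ^+ p)).
    by rewrite exprVn -[X in _ < X]mul1r ltr_pdivlMr ?exprn_gt0 // mulrC.
  by rewrite ltrXn2r ?prime_gt0 ?nnegrE ?invr_ge0 ?ltW // gtn_eqF ?prime_gt0.
have [rt pt] : r < t ^+ p /\ vnorm (p%:R : k) < t ^+ p.
  by move: qt; rewrite gt_max => /andP.
have [|b hb] := @tens_expand R k A m n e s.
  by move=> w ws; apply: spane; apply: map_f.
have -> : y = \sum_i @tens k A (ext_alg m) (e i) (b i) by [].
have hp := orthogonal_pth_powers hs r0 hr t0 rt pt r1 he.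
pose F i := snorm (e i) * vnorm (b i).
have F0 i : 0 <= F i by rewrite mulr_ge0 ?snorm_ge0 ?vnorm_ge0.
pose M := \big[Num.max/0]_i F i.
have M0 : 0 <= M by apply: bigmax0_ge0.
have FM i : F i <= M by apply: bigmax0_ge; rewrite mem_index_enum.
have yM : tensor_snorm A m (\sum_i @tens k A (ext_alg m) (e i) (b i)) <= M.
  by apply: tens_sum_le => // i _; apply: FM.
apply: (@le_trans _ _ (t ^+ p * M ^+ p)).
  by rewrite ler_wpM2l ?exprn_ge0 ?(ltW t0) // lerXn2r // nnegrE (sn_ge0 hT).
have [M00|Mn0] := eqVneq M 0.
  by rewrite M00 expr0n gtn_eqF ?prime_gt0 // mulr0 (sn_ge0 hT).
have Mp : 0 < M ^+ p by rewrite exprn_gt0 // lt_neqAle eq_sym Mn0.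
have [i0 Mi0] : exists i, M = F i.
  have [|i _ Mi] := @bigmax0_attained _ _ (index_enum 'I_n) F; last by exists i.
  by rewrite -/M lt_neqAle eq_sym Mn0.
have [|z ez hz] := @tens_frobenius m n e b (M ^+ p) n1 (ltW Mp).
  by move=> i; apply: lerXn2r; rewrite ?nnegrE //; [apply: F0|apply: FM].
rewrite ez leNgt; apply/negP => hlt.
have h : t ^+ p * M ^+ p <= tensor_snorm A m (\sum_i @tens k A (ext_alg m) (e i ^+ p) (b i ^+ p)).
  have := tens_orthogonal_ge (fun i => b i ^+ p) i0 _ hp; rewrite hX vnormX -exprMn Mi0.
  by apply; rewrite exprn_gt0.
move: h; apply/negP; rewrite -ltNge; set S := \sum_i _ in hlt *.
rewrite -[S](addrK z); apply: le_lt_trans (sn_B hT _ _) _; rewrite gt_max hlt /=.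
by apply: le_lt_trans hz _; rewrite ltr_pM2r.
Qed.

End WildCase.

(** * Two embeddings with distant images *)

Section DominatingCoefficients.
Variables (R : realType) (l : valued_field R) (delta : R).
Hypothesis delta0 : 0 < delta.
Implicit Types P G S : {poly l}.

(** The first index at which the Gauss norm of radius [delta] is attained, a vertex of the Newton
    polygon. Choosing the first one makes these indices add under multiplication. *)
Definition dominating P j :=
  (forall i, vnorm P`_i * delta ^+ i <= vnorm P`_j * delta ^+ j) /\
  (forall i, (i < j)%N -> vnorm P`_i * delta ^+ i < vnorm P`_j * delta ^+ j).

Lemma coef_norm_ge0 P i : 0 <= vnorm P`_i * delta ^+ i.
Proof. by rewrite mulr_ge0 ?vnorm_ge0 // exprn_ge0 // ltW. Qed.

Lemma exists_dominating P : exists j, dominating P j.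
Proof.
pose a i := vnorm P`_i * delta ^+ i.
have [j hj hj'] : exists2 j, (forall i, (i < size P)%N -> a i <= a j) &
    forall i, (i < j)%N -> a i < a j.
  elim: (size P) => [|n [j hj hj']]; first by exists 0%N.
  have [le|lt] := lerP (a n) (a j).
    exists j => // i; rewrite ltnS leq_eqVlt => /predU1P[->//|]; exact: hj.
  exists n => i; last by move=> /hj/le_lt_trans; apply.
  rewrite ltnS leq_eqVlt => /predU1P[->//|/hj/le_trans]; apply; exact: ltW.
exists j; split=> // i; have [/hj//|h] := ltnP i (size P).
by rewrite nth_default // vnorm0 mul0r coef_norm_ge0.
Qed.

Lemma sum_norm_lt (I : eqType) (s : seq I) (F : I -> l) c : 0 < c ->
  (forall i, i \in s -> vnorm (F i) < c) -> vnorm (\sum_(i <- s) F i) < c.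
Proof.
move=> c0; elim: s => [|i s IHs] h; first by rewrite big_nil vnorm0.
rewrite big_cons; apply: le_lt_trans (vnormD _ _) _.
rewrite gt_max h ?mem_head //= IHs // => j js.
by apply: h; rewrite inE js orbT.
Qed.

(** Every other term of this coefficient has its left index below [j] or its right index below [g],
    so it is strictly smaller and nothing cancels. *)
Lemma dominating_coefM P G j g : dominating P j -> dominating G g ->
  0 < vnorm P`_j * delta ^+ j -> 0 < vnorm G`_g * delta ^+ g ->
  vnorm (P * G)`_(j + g) * delta ^+ (j + g)
    = (vnorm P`_j * delta ^+ j) * (vnorm G`_g * delta ^+ g).
Proof.
move=> [Pj Pj'] [Gg Gg'] P0 G0; rewrite exprD mulrACA; congr (_ * _).
have jg : (j < (j + g).+1)%N by rewrite ltnS leq_addr.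
rewrite coefM (bigD1 (Ordinal jg)) //= addKn -vnormM.
have dn n : 0 < delta ^+ n by rewrite exprn_gt0.
have c0 : 0 < vnorm (P`_j * G`_g).
  rewrite vnormM mulr_gt0 //.
    by move: P0; rewrite pmulr_lgt0.
  by move: G0; rewrite pmulr_lgt0.
apply: (sn_max_eq (vnorm_snorm l)); rewrite -big_filter; apply: sum_norm_lt => // i.
rewrite mem_filter => /andP[ij _].
have ijg : (i <= j + g)%N by rewrite -ltnS.
rewrite -(ltr_pM2r (dn (j + g)%N)) !vnormM.
have -> : vnorm P`_i * vnorm G`_(j + g - i) * delta ^+ (j + g)
    = (vnorm P`_i * delta ^+ i) * (vnorm G`_(j + g - i) * delta ^+ (j + g - i)).
  by rewrite mulrACA -exprD subnKC.
rewrite exprD [ltRHS]mulrACA.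
have [lt_ij|] := ltnP i j.
  apply: (@le_lt_trans _ _ (vnorm P`_i * delta ^+ i * (vnorm G`_g * delta ^+ g))).
    by rewrite ler_wpM2l ?coef_norm_ge0.
  by rewrite ltr_pM2r // Pj'.
rewrite leq_eqVlt => /predU1P[eij|lt_ji].
  by case/eqP: ij; apply: val_inj.
apply: (@le_lt_trans _ _ (vnorm P`_j * delta ^+ j * (vnorm G`_(j + g - i) * delta ^+ (j + g - i)))).
  by rewrite ler_wpM2r ?coef_norm_ge0.
rewrite ltr_pM2l // Gg' //.
by rewrite ltn_subLR // ltn_add2r.
Qed.

(* The lowest dominating index of P is at most d - 1, so the one of P * G is
   less than n, where 'X^n has no coefficient: S has to compensate it. *)
Lemma Xn_remainder_large n d P G S : (0 < d <= n)%N ->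
  'X^n = P * G + S -> (size S <= d)%N -> P \is monic -> size P = d.+1 ->
  delta <= vnorm P`_d.-1 ->
  exists j g m, [/\ dominating P j, dominating G g,
    vnorm S`_m * delta ^+ m = (vnorm P`_j * delta ^+ j) * (vnorm G`_g * delta ^+ g),
    0 < vnorm G`_g * delta ^+ g &
    delta ^+ n <= (vnorm P`_j * delta ^+ j) * (vnorm G`_g * delta ^+ g)].
Proof.
case/andP=> d0 dn eX sS mP sP hP.
have eG : P * G = 'X^n - S by rewrite eX addrK.
have sSn : (size S < size ('X^n : {poly l}))%N by rewrite size_polyXn ltnS (leq_trans sS).
have sPG : size (P * G) = n.+1.
  by rewrite eG size_polyDl ?size_polyXn ?size_polyN -?(size_polyXn l n).
have mPG : P * G \is monic.
  by rewrite eG monicE lead_coefDl ?size_polyN // lead_coefXn.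
have mG : G \is monic by rewrite -(monicMl _ mP).
have sG : size G = (n - d).+1.
  have := sPG; rewrite size_monicM ?monic_neq0 // sP addSn /= => e.
  have : (size G = n.+1 - d)%N by rewrite -e addKn.
  by rewrite subSn.
have [j dj] := exists_dominating P; have [g dg] := exists_dominating G.
have Pd : P`_d = 1 by move: mP; rewrite monicE lead_coefE sP => /eqP.
have Gd : G`_(n - d) = 1 by move: mG; rewrite monicE lead_coefE sG => /eqP.
have Pge : delta ^+ d <= vnorm P`_j * delta ^+ j.
  by case: dj => h _; have := h d; rewrite Pd vnorm1 mul1r.
have Gge : delta ^+ (n - d) <= vnorm G`_g * delta ^+ g.
  by case: dg => h _; have := h (n - d)%N; rewrite Gd vnorm1 mul1r.
have Pp : 0 < vnorm P`_j * delta ^+ j by apply: lt_le_trans Pge; rewrite exprn_gt0.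
have Gp : 0 < vnorm G`_g * delta ^+ g by apply: lt_le_trans Gge; rewrite exprn_gt0.
have nz (Q : {poly l}) i : 0 < vnorm Q`_i * delta ^+ i -> (i < size Q)%N.
  by move=> h; rewrite ltnNge; apply/negP => hi; move: h; rewrite nth_default // vnorm0 mul0r ltxx.
(* The bound on the subleading coefficient makes the index [d.-1] at least as good as [d]. *)
have jd : (j < d)%N.
  have := nz _ _ Pp; rewrite sP ltnS leq_eqVlt => /predU1P[ej|//].
  case: dj => _ /(_ d.-1); rewrite ej prednK // leqnn => /(_ isT).
  have ed : delta ^+ d = delta * delta ^+ d.-1 by rewrite -exprS prednK.
  rewrite Pd vnorm1 mul1r ltNge ed.
  by rewrite ler_wpM2r ?exprn_ge0 // ltW.
have gn : (g <= n - d)%N by have := nz _ _ Gp; rewrite sG ltnS.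
exists j, g, (j + g)%N; split=> //; last first.
  by rewrite -[n in leLHS](subnKC dn) exprD ler_pM // exprn_ge0 // ltW.
rewrite -(dominating_coefM dj dg Pp Gp); congr (_ * _).
have lt_n : (j + g < n)%N.
  by rewrite -[X in (_ < X)%N](subnKC dn) -addSn leq_add.
by rewrite eG coefB coefXn (ltn_eqF lt_n) sub0r vnormN.
Qed.

End DominatingCoefficients.

Section PzEvaluation.
(* Polynomials over B are not available since B may be the zero ring. *)
Variables (l : fieldType) (B : comPzRingType) (iota : {rmorphism l -> B}) (x : B).
Implicit Types P Q : {poly l}.

Definition pz_eval P : B := \sum_(i < size P) iota P`_i * x ^+ i.

Lemma pz_evalE n P : (size P <= n)%N -> pz_eval P = \sum_(i < n) iota P`_i * x ^+ i.
Proof.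
move=> sP; rewrite /pz_eval (big_ord_widen n (fun i => iota P`_i * x ^+ i)) //.
rewrite big_mkcond; apply: eq_bigr => i _; case: ltnP => // h.
by rewrite nth_default // rmorph0 mul0r.
Qed.

Lemma pz_evalD P Q : pz_eval (P + Q) = pz_eval P + pz_eval Q.
Proof.
pose n := maxn (size P) (size Q).
rewrite !(@pz_evalE n) ?leq_maxl ?leq_maxr ?size_polyD // -big_split.
by apply: eq_bigr => i _; rewrite coefD rmorphD mulrDl.
Qed.

Lemma pz_eval0 : pz_eval 0 = 0.
Proof. by rewrite /pz_eval size_poly0 big_ord0. Qed.

Lemma pz_evalZ c P : pz_eval (c *: P) = iota c * pz_eval P.
Proof.
rewrite (@pz_evalE (size P)) ?size_scale_leq // mulr_sumr.
by apply: eq_bigr => i _; rewrite coefZ rmorphM mulrA.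
Qed.

Lemma pz_eval1 : pz_eval 1 = 1.
Proof. by rewrite /pz_eval size_poly1 big_ord1 coef1 rmorph1 mulr1. Qed.

Lemma pz_evalMX P : pz_eval (P * 'X) = pz_eval P * x.
Proof.
rewrite (@pz_evalE (size P).+1); last first.
  by apply: leq_trans (size_polyMleq _ _) _; rewrite size_polyX addn2.
rewrite big_ord_recl coefMX rmorph0 mul0r add0r mulr_suml.
by apply: eq_bigr => i _; rewrite coefMX exprSr mulrA.
Qed.

Lemma pz_evalM P Q : pz_eval (P * Q) = pz_eval P * pz_eval Q.
Proof.
elim/poly_ind: P Q => [|P c IHP] Q; first by rewrite mul0r pz_eval0 mul0r.
rewrite mulrDl -mulrA mul_polyC !pz_evalD pz_evalZ IHP.
rewrite ['X * Q]mulrC !pz_evalMX -[c%:P]alg_polyC pz_evalZ pz_eval1 mulr1.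
by rewrite mulrDl mulrA mulrAC.
Qed.

Lemma pz_evalXn P n : pz_eval (P ^+ n) = pz_eval P ^+ n.
Proof.
elim: n => [|n IHn]; first by rewrite !expr0 pz_eval1.
by rewrite !exprS pz_evalM IHn.
Qed.

Lemma pz_evalX : pz_eval 'X = x.
Proof. by rewrite -['X]mul1r pz_evalMX pz_eval1 mul1r. Qed.

Lemma pz_evalC c : pz_eval c%:P = iota c.
Proof. by rewrite -alg_polyC pz_evalZ pz_eval1 mulr1. Qed.

Lemma pz_eval_sum (I : Type) (s : seq I) (F : I -> {poly l}) :
  pz_eval (\sum_(i <- s) F i) = \sum_(i <- s) pz_eval (F i).
Proof. exact: (big_morph pz_eval pz_evalD pz_eval0). Qed.

End PzEvaluation.

(** * The difference of the two copies of an element in the self tensor product *)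

Section SelfTensor.
Variables (R : realType) (k : valued_field R) (l : valued_ext k).

Lemma ext_norm_scale c (x : l) : vnorm (alg_map (ext_alg l) c * x) = vnorm c * vnorm x.
Proof. by rewrite vnormM ext_norm. Qed.

Lemma vnormM_le (x y : l) : vnorm (x * y) <= vnorm x * vnorm y.
Proof. by rewrite vnormM. Qed.

Definition ext_seminormed_alg : seminormed_alg k :=
  @SeminormedAlg R k (ext_alg l) (@vnorm R l) (@vnorm_ge0 R l) (@vnormD R l)
    vnormM_le ext_norm_scale.

Definition ext_normed_alg : normed_alg k :=
  @NormedAlg R k ext_seminormed_alg (@vnorm0_eq0 R l).

Local Notation T := (base_change ext_normed_alg l).
Local Notation N := (tensor_snorm ext_normed_alg l).
Local Notation "a (x) b" := (@tens k (ext_alg l) (ext_alg l) a b : T)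
  (at level 40, left associativity).

Let hT : is_snorm N := tens_snorm_snorm ext_normed_alg l.

Definition tens_inl (a : l) : T := a (x) 1.
Definition tens_inr (b : l) : T := 1 (x) b.

Lemma tens_inl_zmod : zmod_morphism tens_inl.
Proof.
move=> a b; apply: (addIr (tens_inl b)); rewrite subrK.
by rewrite -[LHS](@tensDl k (ext_alg l) (ext_alg l)) subrK.
Qed.

Lemma tens_inl_monoid : monoid_morphism tens_inl.
Proof.
split=> // a b.
rewrite -[RHS]/(@tens k (ext_alg l) (ext_alg l) a 1
  * @tens k (ext_alg l) (ext_alg l) b 1).
by rewrite (@tensM k (ext_alg l) (ext_alg l)) mulr1.
Qed.

HB.instance Definition _ := GRing.isZmodMorphism.Build l T tens_inl tens_inl_zmod.
HB.instance Definition _ := GRing.isMonoidMorphism.Build l T tens_inl tens_inl_monoid.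

Lemma tens_inr_zmod : zmod_morphism tens_inr.
Proof.
move=> a b; apply: (addIr (tens_inr b)); rewrite subrK.
by rewrite -[LHS](@tensDr k (ext_alg l) (ext_alg l)) subrK.
Qed.

Lemma tens_inr_monoid : monoid_morphism tens_inr.
Proof.
split=> // a b.
rewrite -[RHS]/(@tens k (ext_alg l) (ext_alg l) 1 a
  * @tens k (ext_alg l) (ext_alg l) 1 b).
by rewrite (@tensM k (ext_alg l) (ext_alg l)) mulr1.
Qed.

HB.instance Definition _ := GRing.isZmodMorphism.Build l T tens_inr tens_inr_zmod.
HB.instance Definition _ := GRing.isMonoidMorphism.Build l T tens_inr tens_inr_monoid.

Lemma tens_inl_ext c : tens_inl (ext_map l c) = tens_inr (ext_map l c).
Proof.
have := @tens_bal k (ext_alg l) (ext_alg l) c 1 1; rewrite !mulr1; exact.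
Qed.

Lemma tens_inlr a b : tens_inl a * tens_inr b = a (x) b.
Proof.
rewrite -[LHS]/(@tens k (ext_alg l) (ext_alg l) a 1
  * @tens k (ext_alg l) (ext_alg l) 1 b).
by rewrite (@tensM k (ext_alg l) (ext_alg l)) mulr1 mul1r.
Qed.

Lemma tens_inl_norm a : N (tens_inl a) = vnorm a.
Proof. exact: (@tens_snorm1 R k ext_normed_alg l a). Qed.

Lemma tens_inr_norm b : N (tens_inr b) <= vnorm b.
Proof.
apply: le_trans (@tens_snorm_le R k ext_normed_alg l 1 b) _.
by rewrite -[snorm _]/(vnorm (1 : l)) vnorm1 mul1r.
Qed.

Section Difference.
Variables (b : l) (delta : R).
Hypothesis delta0 : 0 < delta.
Hypothesis dist_le : forall c : k, delta <= vnorm (b - ext_map l c).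
Hypothesis dist_near : forall e, delta < e -> exists c : k, vnorm (b - ext_map l c) < e.
Hypothesis tame : forall n, (0 < n)%N -> vnorm (n%:R : k) = 1.

Let f : T := tens_inl b - tens_inr b.
Let ev := pz_eval tens_inr f.

(** Taylor expansion at [b]. Since [ev] sends ['X] to [f] and constants to the right factor, it
    sends ['X + b%:P] to the left copy of [b], and [shift Q] to the left copy of the value of [Q] at
    [b]. *)
Definition shift (Q : {poly k}) : {poly l} := map_poly (ext_map l) Q \Po ('X + b%:P).

Lemma shiftE n (Q : {poly k}) : (size Q <= n)%N ->
  shift Q = \sum_(i < n) ext_map l Q`_i *: ('X + b%:P) ^+ i.
Proof.
move=> sQ; rewrite /shift comp_polyE size_map_poly.
rewrite (big_ord_widen n (fun i => (map_poly (ext_map l) Q)`_i *: ('X + b%:P) ^+ i)) //.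
rewrite big_mkcond; apply: eq_bigr => i _; rewrite coef_map; case: ltnP => // h.
by rewrite nth_default // rmorph0 scale0r.
Qed.

Lemma ev_Xb : ev ('X + b%:P) = tens_inl b.
Proof. by rewrite /ev pz_evalD pz_evalX pz_evalC /f subrK. Qed.

Lemma ev_shift Q : ev (shift Q) = tens_inl (map_poly (ext_map l) Q).[b].
Proof.
rewrite (shiftE (leqnn _)) /ev pz_eval_sum horner_coef size_map_poly rmorph_sum.
apply: eq_bigr => i _; rewrite pz_evalZ pz_evalXn -/ev ev_Xb coef_map /=.
by rewrite -tens_inl_ext -rmorphXn -rmorphM.
Qed.

Lemma shift_coef0 Q : (shift Q)`_0 = (map_poly (ext_map l) Q).[b].
Proof. by rewrite -horner_coef0 horner_comp !hornerE. Qed.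

Lemma size_shift (Q : {poly k}) : size (shift Q) = size Q.
Proof. by rewrite size_comp_poly2 ?size_map_poly // size_XaddC. Qed.

(* |Q(b)| is the Gauss norm of Q on the disc of center b and radius delta. *)
Definition gauss_bound d := forall Q : {poly k}, (size Q <= d)%N ->
  forall j, vnorm (shift Q)`_j * delta ^+ j <= vnorm (map_poly (ext_map l) Q).[b].

Lemma gauss_bound1 : gauss_bound 1.
Proof.
move=> Q sQ j; rewrite -shift_coef0; case: j => [|j]; first by rewrite expr0 mulr1.
by rewrite nth_default ?vnorm0 ?mul0r ?vnorm_ge0 // size_shift (leq_trans sQ).
Qed.

Lemma gauss_bound_free d : gauss_bound d ->
  family_free ((fun i : 'I_d => b ^+ i) : 'I_d -> alg_vect ext_normed_alg).
Proof.
move=> gd c ec i.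
pose c' n := if insub n is Some j then c j else 0.
pose Q := \poly_(n < d) c' n.
have cQ (j : 'I_d) : Q`_j = c j by rewrite coef_poly ltn_ord /c' valK.
have Qb : (map_poly (ext_map l) Q).[b] = 0.
  rewrite (@horner_coef_wide _ d) ?size_map_poly ?size_poly //.
  rewrite -[RHS]ec; apply: eq_bigr => j _.
  by rewrite coef_map cQ.
suff Q0 : Q = 0 by rewrite -cQ Q0 coef0.
apply/eqP; rewrite -size_poly_eq0 -size_shift size_poly_eq0; apply/eqP/polyP => j.
have := gd Q (size_poly _ _) j; rewrite Qb vnorm0 coef0 => h.
apply/vnorm0_eq0/eqP; rewrite eq_le vnorm_ge0 andbT.
by move: h; rewrite pmulr_lle0 // exprn_gt0.
Qed.

(** In powers of ['X + b%:P], [S] evaluates to a combination of powers of [b] tensored with elements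
    of [l]. For each representation of it, [tens_coefficients] rewrites [S] as a combination of
    shifted polynomials over [k], whose values at [b] are the projections of the left components;
    [gauss_bound] applies to each. *)
Lemma gauss_bound_tens d (S : {poly l}) j : gauss_bound d -> (size S <= d)%N ->
  vnorm S`_j * delta ^+ j <= N (ev S).
Proof.
move=> gd sS; pose r := S \Po ('X + (- b)%:P).
have sr : (size r <= d)%N by rewrite size_comp_poly2 // size_XaddC.
have eS : S = \sum_(i < d) r`_i *: ('X + b%:P) ^+ i.
  rewrite -[S](comp_polyXaddC_K _ (- b)) -/r polyCN opprK comp_polyE.
  rewrite (big_ord_widen d (fun i => r`_i *: ('X + b%:P) ^+ i)) //.
  rewrite big_mkcond; apply: eq_bigr => i _; case: ltnP => // h.
  by rewrite nth_default // scale0r.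
have evS : ev S = \sum_(i < d) b ^+ i (x) r`_i.
  rewrite {1}eS /ev pz_eval_sum; apply: eq_bigr => i _.
  by rewrite pz_evalZ pz_evalXn -/ev ev_Xb -rmorphXn mulrC tens_inlr.
rewrite evS; apply: tens_snorm_ge => s es; set M := \big[_/_]_(_ <- _) _.
have M0 : 0 <= M by apply: bigmax0_ge0.
have dj : 0 < delta ^+ j by rewrite exprn_gt0.
apply: le_of_gt1_mul => [|C C1]; first by rewrite mulr_ge0 ?vnorm_ge0 // ltW.
have C0 : 0 < C := lt_trans ltr01 C1.
have [phi [hr hphi]] := @tens_coefficients R k ext_normed_alg l d (fun i => b ^+ i)
  (fun i => r`_i) s C (gauss_bound_free gd) C1 es.
pose c' u n := if insub n is Some i then phi i u else 0.
pose Q u := \poly_(n < d) c' u n.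
have cQ u (i : 'I_d) : (Q u)`_i = phi i u by rewrite coef_poly ltn_ord /c' valK.
have -> : S = \sum_(u <- s) u.2 *: shift (Q u.1).
  rewrite {1}eS; under eq_bigr do rewrite hr scaler_suml.
  rewrite exchange_big; apply: eq_bigr => u _.
  rewrite (@shiftE d) ?size_poly // scaler_sumr; apply: eq_bigr => i _.
  by rewrite cQ scalerA mulrC.
rewrite -ler_pdivlMr // coef_sum.
apply: (sn_sum (vnorm_snorm l)) => [|u us].
  by rewrite divr_ge0 ?mulr_ge0 // ltW.
rewrite ler_pdivlMr // coefZ vnormM -mulrA.
apply: (@le_trans _ _ (vnorm u.2 * (C * vnorm u.1))).
  rewrite ler_wpM2l ?vnorm_ge0 //; apply: le_trans (gd _ (size_poly _ _) j) _.
  apply: le_trans (hphi u us).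
  rewrite (@horner_coef_wide _ d) ?size_map_poly ?size_poly //.
  rewrite le_eqVlt; apply/orP; left; apply/eqP; congr (vnorm _).
  by apply: eq_bigr => i _; rewrite coef_map cQ.
rewrite mulrCA (ler_wpM2l (ltW C0)) // mulrC.
exact: (bigmax0_ge (fun u : l * l => vnorm u.1 * vnorm u.2)).
Qed.

(** This is [d.+1] times the difference between [b] and the mean of the roots of [P]. In the tame
    case the mean lies in [k] and [d.+1] has norm 1, so the coefficient has norm at least
    [delta]. *)
Lemma coef_shift_pred (P : {poly k}) d : P \is monic -> size P = d.+2 ->
  (shift P)`_d = b *+ d.+1 + ext_map l P`_d.
Proof.
move=> mP sP; have cXb i j : (('X + b%:P) ^+ i)`_j = b ^+ (i - j) *+ 'C(i, j).
  rewrite addrC exprDn coef_sum.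
  have [ji|ij] := ltnP j i.+1; last first.
    rewrite bin_small // mulr0n big1 // => m _.
    rewrite coefMn -rmorphXn coefCM coefXn gtn_eqF ?mulr0 ?mul0rn //.
    by apply: leq_trans ij; rewrite ltn_ord.
  rewrite (bigD1 (Ordinal ji)) //= big1 ?addr0 => [|m mj].
    by rewrite coefMn -rmorphXn coefCM coefXn eqxx mulr1.
  rewrite coefMn -rmorphXn coefCM coefXn eq_sym [_ == _ :> nat]negbTE ?mulr0 ?mul0rn //.
rewrite (@shiftE d.+2) ?sP // coef_sum !big_ord_recr /= big1 ?add0r => [|i _].
  rewrite !coefZ !cXb subnn expr0 binn mulr1n mulr1 subSnn expr1 binSn addrC.
  by move: mP; rewrite monicE lead_coefE sP => /eqP ->; rewrite rmorph1 mul1r.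
by rewrite coefZ cXb bin_small ?mulr0n ?mulr0.
Qed.

(** [f] is unchanged when an element of [k] is subtracted from [b]. *)
Lemma tens_diff_norm c : N f <= vnorm (b - ext_map l c).
Proof.
have -> : f = tens_inl (b - ext_map l c) - tens_inr (b - ext_map l c).
  have -> : tens_inl (b - ext_map l c) = tens_inl b - tens_inl (ext_map l c) by exact: rmorphB.
  have -> : tens_inr (b - ext_map l c) = tens_inr b - tens_inr (ext_map l c) by exact: rmorphB.
  by rewrite /f tens_inl_ext opprB addrA subrK.
apply: le_trans (sn_B hT _ _) _; rewrite ge_max tens_inl_norm lexx /=.
exact: tens_inr_norm.
Qed.

(** As long as the Gauss bound reaches degree [n], it applies to ['X^n] itself. Otherwise a monic
    [P] of the first degree where it fails plays the part of a minimal polynomial of [b]. Division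
    by [shift P] leaves a remainder within reach of the bound, while the multiple of [shift P] is
    negligible because [P] is abnormally small at [b]. *)
Lemma tens_diff_power n : delta ^+ n <= N (f ^+ n).
Proof.
have [gn|ngn] := pselect (gauss_bound n.+1).
  have := @gauss_bound_tens _ 'X^n n gn; rewrite size_polyXn leqnn coefXn eqxx.
  rewrite vnorm1 mul1r => /(_ isT); rewrite /ev pz_evalXn pz_evalX; exact.
have [d [gd ngd d0 dn]] : exists d, [/\ gauss_bound d, ~ gauss_bound d.+1, (0 < d)%N & (d <= n)%N].
  elim: n ngn => [|n IHn] ngn; first by case: ngn; apply: gauss_bound1.
  have [gn|/IHn[d [gd ngd d0 dn]]] := pselect (gauss_bound n.+1); first by exists n.+1.
  by exists d; split=> //; apply: leqW.
have [Q [sQ [j0 hj0]]] : exists Q : {poly k}, (size Q <= d.+1)%N /\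
    exists j, vnorm (map_poly (ext_map l) Q).[b] < vnorm (shift Q)`_j * delta ^+ j.
  apply: contrapT => h; apply: ngd => Q sQ j; rewrite leNgt; apply/negP => hj.
  by apply: h; exists Q; split=> //; exists j.
have {}sQ : size Q = d.+1.
  apply/eqP; rewrite eqn_leq sQ ltnNge; apply/negP => sQ'.
  by have := gd Q sQ' j0; rewrite leNgt hj0.
have Q0 : lead_coef Q != 0 by rewrite lead_coef_eq0 -size_poly_eq0 sQ.
pose P := (lead_coef Q)^-1 *: Q.
have sP : size P = d.+1 by rewrite size_scale ?invr_eq0.
have mP : P \is monic by rewrite monicE lead_coefZ mulVf.
have shP : shift P = ext_map l (lead_coef Q)^-1 *: shift Q.
  by rewrite /shift map_polyZ comp_polyZ.
have Pb : vnorm (map_poly (ext_map l) P).[b] < vnorm (shift P)`_j0 * delta ^+ j0.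
  rewrite shP coefZ map_polyZ hornerZ !vnormM -mulrA ltr_pM2l //.
  by rewrite vnorm_gt0 fmorph_eq0 invr_eq0.
have msP : shift P \is monic.
  rewrite monicE lead_coef_comp ?size_XaddC // lead_coefXaddC expr1n mulr1.
  by rewrite lead_coef_map (monicP mP) rmorph1.
have ssP : size (shift P) = d.+1 by rewrite size_shift.
have subP : delta <= vnorm (shift P)`_d.-1.
  case: (d) d0 sP => // d' _ sP'; rewrite (coef_shift_pred mP sP') /=.
  have dn0 : d'.+1%:R != 0 :> k by rewrite -vnorm_eq0 tame ?oner_eq0.
  have -> : b *+ d'.+1 + ext_map l P`_d'
      = ext_map l d'.+1%:R * (b - ext_map l (- P`_d' / d'.+1%:R)).
    rewrite mulrBr -rmorphM mulrC [X in _ = _ - ext_map l X]mulrC divfK //.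
    by rewrite rmorphN opprK rmorph_nat mulr_natr.
  by rewrite vnormM ext_norm tame // mul1r.
have eX := divp_eq ('X^n : {poly l}) (shift P); rewrite mulrC in eX.
set G := _ %/ _ in eX; set S := _ %% _ in eX.
have sS : (size S <= d)%N.
  by rewrite -ltnS -ssP ltn_modp monic_neq0.
have dn' : (0 < d <= n)%N by rewrite d0.
have [j [g [m [[Pj _] [Gg _] eS G0 ge]]]] := Xn_remainder_large delta0 dn' eX sS msP ssP subP.
set gP := vnorm (shift P)`_j * delta ^+ j in eS ge.
set gG := vnorm G`_g * delta ^+ g in eS ge G0.
have {}Pb : vnorm (map_poly (ext_map l) P).[b] < gP := lt_le_trans Pb (Pj j0).
have gP0 : 0 < gP by apply: le_lt_trans Pb; apply: vnorm_ge0.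
have efn : f ^+ n = ev (shift P) * ev G + ev S.
  by rewrite -pz_evalM -pz_evalD -eX pz_evalXn pz_evalX.
(* [N f] is only bounded by the norm of [b - ext_map l c], not by [delta], which costs up to the
   n-th power of their ratio in [ev G]. The value of [P] at [b] lies strictly below [gP], so some
   [c] close enough to [b] makes this loss affordable. *)
have [c hc] : exists c : k,
    vnorm (map_poly (ext_map l) P).[b] * (vnorm (b - ext_map l c) / delta) ^+ n < gP.
  have [Pb0|Pb0] := eqVneq (vnorm (map_poly (ext_map l) P).[b]) 0.
    by exists 0; rewrite Pb0 mul0r.
  have Pbp : 0 < vnorm (map_poly (ext_map l) P).[b].
    by rewrite lt_neqAle eq_sym Pb0 vnorm_ge0.
  have [|u u1 hu] := @exists_gt1_pow R n (gP / vnorm (map_poly (ext_map l) P).[b]).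
    by rewrite ltr_pdivlMr // mul1r.
  have [|c hc] := @dist_near (u * delta); first by rewrite ltr_pMl.
  exists c; rewrite mulrC -ltr_pdivlMr //; apply: le_lt_trans hu.
  rewrite lerXn2r ?nnegrE ?divr_ge0 ?vnorm_ge0 ?(ltW delta0) ?(ltW (lt_trans ltr01 u1)) //.
  by rewrite ler_pdivrMr // ltW.
set e := vnorm (b - ext_map l c) in hc.
have e1 : 1 <= e / delta by rewrite ler_pdivlMr // mul1r; apply: dist_le.
have sG : (size G <= n.+1)%N.
  by rewrite -(size_polyXn l n) leq_divp.
have N1 : N 1 = 1 by rewrite -[1](rmorph1 tens_inl) tens_inl_norm vnorm1.
have Gle : N (ev G) <= (e / delta) ^+ n * gG.
  have c0 : 0 <= (e / delta) ^+ n * gG.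
    by rewrite mulr_ge0 ?(ltW G0) // exprn_ge0 // (le_trans ler01).
  rewrite /ev (pz_evalE _ _ sG); apply: (sn_sum hT) => // i _.
  apply: le_trans (sn_M hT _ _) _.
  apply: (@le_trans _ _ (vnorm G`_i * e ^+ i)).
    apply: ler_pM; rewrite ?(sn_ge0 hT) ?tens_inr_norm //.
    apply: le_trans (sn_X hT _ _ _) _; first by rewrite N1.
    by apply: lerXn2r; rewrite ?nnegrE ?(sn_ge0 hT) ?vnorm_ge0 ?tens_diff_norm.
  have -> : vnorm G`_i * e ^+ i = (e / delta) ^+ i * (vnorm G`_i * delta ^+ i).
    by rewrite mulrCA -exprMn divfK // gt_eqF.
  apply: ler_pM.
  - by rewrite exprn_ge0 // (le_trans ler01).
  - exact: coef_norm_ge0.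
  - by rewrite ler_weXn2l // -ltnS.
  - exact: Gg.
have PGlt : N (ev (shift P) * ev G) < gP * gG.
  apply: le_lt_trans (sn_M hT _ _) _; rewrite ev_shift tens_inl_norm.
  apply: le_lt_trans (ler_wpM2l (vnorm_ge0 _) Gle) _.
  by rewrite mulrA ltr_pM2r.
have Sge : gP * gG <= N (ev S) by rewrite -eS; apply: gauss_bound_tens gd sS.
apply: le_trans ge _; rewrite leNgt; apply/negP => hlt.
move: Sge; apply/negP; rewrite -ltNge.
have -> : ev S = f ^+ n - ev (shift P) * ev G by rewrite efn addrAC subrr add0r.
by apply: le_lt_trans (sn_B hT _ _) _; rewrite gt_max hlt.
Qed.

Lemma exists_two_embeddings : exists (m : valued_ext k) (sigma tau : {rmorphism l -> m}),
  [/\ forall c, sigma (ext_map l c) = ext_map m c,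
    forall c, tau (ext_map l c) = ext_map m c,
    forall x, vnorm (sigma x) = vnorm x, forall x, vnorm (tau x) = vnorm x &
    delta <= vnorm (sigma b - tau b)].
Proof.
have [M hM [MN M1 MM Mf]] := exists_multiplicative_snorm hT delta0 tens_diff_power.
have [F [h hF]] := exists_valued_field hM M1 MM.
have isom (i : {rmorphism l -> T}) : (forall x, N (i x) <= vnorm x) ->
    forall x, M (i x) = vnorm x.
  move=> hi; apply: contractive_field_morphism_isometric => // x.
  exact: le_trans (MN _) (hi x).
have hl x : M (tens_inl x) = vnorm x.
  by apply: (isom tens_inl) => y; rewrite tens_inl_norm.
have hr x : M (tens_inr x) = vnorm x.
  by apply: (isom tens_inr) => y; apply: tens_inr_norm.
pose sigma : {rmorphism l -> F} := (h \o tens_inl)%FUN.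
pose tau : {rmorphism l -> F} := (h \o tens_inr)%FUN.
pose iota : {rmorphism k -> F} := (sigma \o ext_map l)%FUN.
have hiota c : vnorm (iota c) = vnorm c by rewrite /= hF hl ext_norm.
exists (ValuedExt hiota), sigma, tau; split.
- by [].
- by move=> c /=; rewrite tens_inl_ext.
- by move=> x /=; rewrite hF.
- by move=> x /=; rewrite hF.
- by rewrite /= -rmorphB hF.
Qed.

End Difference.
End SelfTensor.

(** * The tame case *)

Section TameCase.
Variables (R : realType) (k : valued_field R) (A : normed_alg k).
Hypothesis tame : forall n, (0 < n)%N -> vnorm (n%:R : k) = 1.
Hypothesis snormX : forall (a : A) n, snorm (a ^+ n) = snorm a ^+ n.

Local Notation orth t e := (norm_orthogonal (V := alg_vect A) (@snorm R k A) t e).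
Local Notation tens m a b := (@tens k A (ext_alg m) a b : base_change A m).

Let snorm1 : snorm (1 : A) = 1.
Proof. by have := snormX 1 0; rewrite !expr0. Qed.

Lemma orthogonal_tail t n (e : 'I_n.+1 -> A) : orth t e -> orth t (fun i => e (lift ord0 i)).
Proof.
case=> e0 he; split=> [i|c i]; first exact: e0.
have := he (cons_coef 0 c) (lift ord0 i); rewrite /cons_coef liftK.
by rewrite big_ord_recl unlift_none scale0r add0r; under eq_bigr do rewrite liftK.
Qed.

Section Step.
Variables (t : R) (n : nat).
Hypotheses (t0 : 0 < t) (t1 : t < 1).
(** One factor [t^-1] pays for the orthogonality of the [e i], the other for choosing [c] near a
    distance that need not be attained. *)
Let u := t^-1 ^+ 2.

Hypothesis IH : forall (m : valued_ext k) (e : 'I_n -> A) (b : 'I_n -> m) (s : R),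
  0 < s -> orth t e -> powbounded (tensor_snorm A m) s (\sum_i tens m (e i) (b i)) ->
  tensor_snorm A m (\sum_i tens m (e i) (b i)) <= s * u ^+ n.

Let ti1 : 1 < t^-1. Proof. by rewrite invf_gt1. Qed.
Let u1 : 1 < u. Proof. by rewrite exprn_egt1 // ltW. Qed.
Let u0 : 0 < u := lt_trans ltr01 u1.

(* The difference of the two base changes of x no longer involves e_0. *)
Lemma tame_coefficient_near (m : valued_ext k) (e : 'I_n.+1 -> A) (b : 'I_n.+1 -> m) s i :
  0 < s -> orth t e -> b ord0 = 1 ->
  powbounded (tensor_snorm A m) s (\sum_i tens m (e i) (b i)) ->
  exists c : k, snorm (e (lift ord0 i)) * vnorm (b (lift ord0 i) - ext_map m c)
    <= s * u ^+ n.+1.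
Proof.
move=> s0 he b0 hx; set b' := b (lift ord0 i); set a := e (lift ord0 i).
have a0 : 0 < snorm a by case: he => h _; apply: h.
pose P := [set vnorm (b' - ext_map m c) | c in [set: k]]%classic.
have P0 r : P r -> 0 <= r by case=> c _ <-; apply: vnorm_ge0.
have Pne : exists r, P r by exists (vnorm (b' - ext_map m 0)), 0.
suff h : inf P < s * u ^+ n.+1 / snorm a.
  have [//|_ [c _ <-] hc] := inf_lt_mem h; exists c.
  by rewrite mulrC -ler_pdivlMr // ltW.
have B0 : 0 < s * u ^+ n.+1 / snorm a.
  by apply: divr_gt0 => //; apply: mulr_gt0 => //; apply: exprn_gt0.
(* The embeddings exist for a positive distance to [k]; at distance 0 any close enough [c]
   serves. *)
have [d0|d0] := ltP 0 (inf P); last exact: le_lt_trans d0 B0.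
have [||M [sigma [tau [sk tk sn tn hd]]]] := @exists_two_embeddings R k m b' (inf P) d0 _ _ tame.
- by move=> c; apply: (inf_le_mem P0); exists c.
- by move=> r /inf_lt_mem[//|_ [c _ <-] hc]; exists c.
have [hs [sD sE sP]] := base_change_map A sk sn.
have [ht [tD tE tP]] := base_change_map A tk tn.
have z (h : base_change A m -> base_change A M) : {morph h : x y / x + y} -> h 0 = 0.
  by move=> hD; apply: (addrI (h 0)); rewrite -hD !addr0.
have ediff : hs (\sum_i tens m (e i) (b i)) - ht (\sum_i tens m (e i) (b i))
   = \sum_j tens M (e (lift ord0 j)) (sigma (b (lift ord0 j)) - tau (b (lift ord0 j))).
  rewrite !(big_morph _ sD (z _ sD)) !(big_morph _ tD (z _ tD)) -sumrB.
  rewrite big_ord_recl sE tE b0 !rmorph1 subrr add0r; apply: eq_bigr => j _.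
  rewrite sE tE; apply: (addIr (tens M (e (lift ord0 j)) (tau (b (lift ord0 j))))).
  by rewrite subrK -[RHS](@tensDr k A (ext_alg M)) subrK.
have := powboundedB (tens_snorm_snorm A M) (ltW s0) (sP _ _ hx) (tP _ _ hx).
rewrite ediff => /(IH s0 (orthogonal_tail he)) hN.
have := tens_orthogonal_ge (fun j => sigma (b (lift ord0 j)) - tau (b (lift ord0 j))) i
  t0 (orthogonal_tail he).
move=> /le_trans /(_ hN); rewrite -/a -/b' => hab.
rewrite ltr_pdivlMr //; apply: (@le_lt_trans _ _ (t^-1 * (s * u ^+ n))).
  rewrite ler_pdivlMl //; apply: le_trans hab.
  by rewrite (ler_wpM2l (ltW t0)) // mulrC (ler_wpM2l (ltW a0)).
rewrite exprS mulrCA ltr_pM2l // (ltr_pM2r (exprn_gt0 n u0)).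
by rewrite /u expr2 ltr_pMl ?invr_gt0.
Qed.

Lemma tame_bound_step (m : valued_ext k) (e : 'I_n.+1 -> A) (b : 'I_n.+1 -> m) s :
  0 < s -> orth t e -> b ord0 = 1 ->
  powbounded (tensor_snorm A m) s (\sum_i tens m (e i) (b i)) ->
  tensor_snorm A m (\sum_i tens m (e i) (b i)) <= s * u ^+ n.+1.
Proof.
move=> s0 he b0 hx.
have hT := tens_snorm_snorm A m.
have [c hc] := choice (fun i => tame_coefficient_near i s0 he b0 hx).
set B := s * u ^+ n.+1 in hc *.
have un : 1 <= u ^+ n.+1 by rewrite exprn_ege1 // ltW.
have sB : s <= B by rewrite ler_peMr // ltW.
have B0 : 0 < B := lt_le_trans s0 sB.
pose y := \sum_i tens m (e (lift ord0 i)) (b (lift ord0 i) - ext_map m (c i)).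
pose a : A := e ord0 + \sum_i alg_map A (c i) * e (lift ord0 i).
have yB : tensor_snorm A m y <= B.
  by apply: tens_sum_le => [|i _]; [apply: ltW|apply: hc].
have ex : \sum_i tens m (e i) (b i) = tens m a 1 + y.
  rewrite big_ord_recl b0 [tens m a 1](@tensDl k A (ext_alg m)) -addrA; congr (_ + _).
  rewrite (big_morph (fun a : A => tens m a 1)
    (fun a a' => @tensDl k A (ext_alg m) a a' 1) (tens0l A 1)) -big_split.
  apply: eq_bigr => i _ /=.
  rewrite (@tens_bal k A (ext_alg m)) mulr1 -[RHS](@tensDr k A (ext_alg m)).
  by rewrite addrC subrK.
(* [a] is the difference of [x] and [y], so its powers grow at rate at most [B];
   power-multiplicativity on [A] turns this rate into a bound of the norm. *)
have aB : snorm a <= B.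
  have : powbounded (tensor_snorm A m) B (tens m a 1).
    rewrite -[tens m a 1](addrK y) -ex; apply: (powboundedB hT) (ltW B0) _ _.
      exact: powbounded_le (ltW s0) sB hx.
    exact: powbounded_norm.
  case=> C hC; apply: (@bounded_powers_le _ _ _ C) => // [|j]; first exact: snorm_ge0.
  by have := hC j; rewrite tensX expr1n tens_snorm1 snormX.
rewrite ex; apply: le_trans (sn_D hT _ _) _.
by rewrite ge_max tens_snorm1 aB.
Qed.

End Step.

(** If the first coefficient is 0 the sum is shorter. Otherwise dividing by it, under which both
    sides scale alike, makes it 1, and the two embeddings then cancel its term. *)
Lemma tame_bound t n (m : valued_ext k) (e : 'I_n -> A) (b : 'I_n -> m) s :
  0 < t -> t < 1 -> 0 < s -> orth t e ->
  powbounded (tensor_snorm A m) s (\sum_i tens m (e i) (b i)) ->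
  tensor_snorm A m (\sum_i tens m (e i) (b i)) <= s * (t^-1 ^+ 2) ^+ n.
Proof.
move=> t0 t1; elim: n m e b s => [|n IHn] m e b s s0 he hx.
  by rewrite big_ord0 (sn_0 (tens_snorm_snorm A m)) mulr1 ltW.
have hT := tens_snorm_snorm A m.
have u1 : 1 <= t^-1 ^+ 2 by rewrite exprn_ege1 // invf_ge1 // ltW.
have [b0|b0] := eqVneq (b ord0) 0.
  move: hx; rewrite big_ord_recl b0 tens0r add0r => hx.
  apply: le_trans (IHn _ _ _ _ s0 (orthogonal_tail he) hx) _.
  rewrite ler_pM2l // [_ ^+ n.+1]exprS ler_peMl // exprn_ge0 // (le_trans ler01) //.
have bp : 0 < vnorm (b ord0) by rewrite vnorm_gt0.
pose b' i := b i / b ord0.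
have N1 d : tensor_snorm A m (tens m 1 d) <= vnorm d.
  by apply: le_trans (tens_snorm_le _ _) _; rewrite snorm1 mul1r.
have scale d (g : 'I_n.+1 -> m) :
    (\sum_i tens m (e i) (g i)) * tens m 1 d = \sum_i tens m (e i) (g i * d).
  rewrite mulr_suml; apply: eq_bigr => i _.
  by rewrite (@tensM k A (ext_alg m)) mulr1.
have ex : \sum_i tens m (e i) (b i) = (\sum_i tens m (e i) (b' i)) * tens m 1 (b ord0).
  by rewrite scale; apply: eq_bigr => i _; rewrite /b' divfK.
have hx' : powbounded (tensor_snorm A m) (s / vnorm (b ord0)) (\sum_i tens m (e i) (b' i)).
  rewrite -scale -vnormV; apply: (powboundedM hT) => //; rewrite ?vnorm_ge0 ?(ltW s0) //.
  exact: powbounded_norm.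
have s'0 : 0 < s / vnorm (b ord0) by rewrite divr_gt0.
have b'0 : b' ord0 = 1 by rewrite /b' divff.
have := tame_bound_step t0 t1 (fun m e b s => IHn m e b s) s'0 he b'0 hx'.
rewrite ex => h; apply: le_trans (sn_M hT _ _) _.
apply: (@le_trans _ _ (s / vnorm (b ord0) * (t^-1 ^+ 2) ^+ n.+1 * vnorm (b ord0))).
  by apply: ler_pM; rewrite ?(sn_ge0 hT).
by rewrite mulrAC divfK // gt_eqF.
Qed.

Lemma tame_geometrically_spectral : weakly_cartesian_alg A -> geometrically_spectral A.
Proof.
move=> wc m; have hT := tens_snorm_snorm A m.
have N1 : tensor_snorm A m 1 = 1 by rewrite -snorm1 -(tens_snorm1 m).
apply: (power_mult_of_prime hT N1 (isT : (1 < 2)%N)) => x.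
have h0 := sn_ge0 hT (x ^+ 2).
suff h : tensor_snorm A m x <= Num.sqrt (tensor_snorm A m (x ^+ 2)).
  rewrite -[leRHS]sqr_sqrtr //; apply: lerXn2r; rewrite ?nnegrE ?(sn_ge0 hT) //.
  exact: sqrtr_ge0.
apply: le_of_gt => s hs; have s0 : 0 < s := le_lt_trans (sqrtr_ge0 _) hs.
have hx : powbounded (tensor_snorm A m) s x.
  apply: powbounded_sqr => //; apply: powbounded_norm => //.
  rewrite -[leLHS]sqr_sqrtr //; apply: lerXn2r; rewrite ?nnegrE ?sqrtr_ge0 //; exact: ltW.
have [w ew] := tensor_sum x.
have [n hn] := weakly_cartesian_alg_orthogonal (map fst w) wc.
apply: (@le_of_lt1_scaling R 0 (2 * n)) => //; first exact: (sn_ge0 hT).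
move=> t _ t0 t1; have [e [he spane]] := hn t t0 t1.
have [|b hb] := @tens_expand R k A m n e w.
  by move=> v vw; apply: spane; apply: map_f.
have exb : x = \sum_i tens m (e i) (b i) by rewrite ew; exact: hb.
have := @tame_bound t n m e b s t0 t1 s0 he; rewrite -exb => /(_ hx).
by rewrite -exprM exprVn ler_pdivlMr ?exprn_gt0 // mulrC.
Qed.

End TameCase.

(** * Adjoining p-th roots *)

(* B is meant to be the polynomial ring k[X_a : a in k], M its monomials and
   form the linear form sending a monomial to its value under X_a = a ^ (1 / p)
   if all its exponents are multiples of p, and to 0 otherwise; it vanishes on
   the ideal generated by the X_a ^ p - a. *)
Section RootExtension.
Variables (R : realType) (k : valued_field R) (p : nat).
Variables (B : comPzRingType) (M : eqType) (one : M) (mul : M -> M -> M).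
Variables (var : k -> M) (mon : k -> M -> B).
Hypothesis mul1 : forall m, mul one m = m.
Hypothesis monM : forall c d m m', mon c m * mon d m' = mon (c * d) (mul m m').
Hypothesis monB : forall c d m, mon (c - d) m = mon c m - mon d m.
Hypothesis mon1 : mon 1 one = 1.
Hypothesis mon_span : forall f, exists s : seq (k * M), f = \sum_(i <- s) mon i.1 i.2.
Variables (value : M -> k) (form : B -> k).
Hypothesis value1 : value one = 1.
Hypothesis value_varX : forall a m, value (iter p (mul (var a)) m) = a * value m.
Hypothesis formD : forall f g, form (f + g) = form f + form g.
Hypothesis form_mon : forall c m, form (mon c m) = c * value m.
Variable weight : M -> R.
Hypothesis weight_ge0 : forall m, 0 <= weight m.
Hypothesis weight1 : weight one = 1.
Hypothesis weightM : forall m m', weight (mul m m') = weight m * weight m'.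
Hypothesis value_norm : forall m, vnorm (value m) <= weight m.

Let form0 : form 0 = 0.
Proof. by apply: (addrI (form 0)); rewrite -formD !addr0. Qed.

Let formB f g : form (f - g) = form f - form g.
Proof. by apply: (addIr (form g)); rewrite -formD !subrK. Qed.

Definition mon_const (c : k) : B := mon c one.

Lemma mon_const_zmod : zmod_morphism mon_const.
Proof. by move=> c d; apply: monB. Qed.

Lemma mon_const_monoid : monoid_morphism mon_const.
Proof. by split=> // c d; rewrite /mon_const monM mul1. Qed.

HB.instance Definition _ := GRing.isZmodMorphism.Build k B mon_const mon_const_zmod.
HB.instance Definition _ := GRing.isMonoidMorphism.Build k B mon_const mon_const_monoid.

Let root_var (a : k) : B := mon 1 (var a).

Let root_varX a n c m : root_var a ^+ n * mon c m = mon c (iter n (mul (var a)) m).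
Proof.
elim: n => [|n IHn]; first by rewrite expr0 mul1r.
by rewrite exprS -mulrA IHn monM mul1r.
Qed.

(** Congruence modulo the largest ideal inside the kernel of [form]. That ideal contains each
    [X_a ^ p - a] but not 1, since [form] takes the value 1 there. *)
Let rel (f g : B) := forall h, form ((f - g) * h) = 0.

Let rel_refl f g : f = g -> rel f g.
Proof. by move=> -> h; rewrite subrr mul0r. Qed.

Let root_var_rel a : rel (root_var a ^+ p - mon_const a) 0.
Proof.
move=> h; rewrite subr0; have [s ->] := mon_span h.
rewrite mulr_sumr (big_morph _ formD form0) big1 // => -[c m] _ /=.
rewrite mulrBl formB root_varX /mon_const monM mul1 !form_mon value_varX.
by rewrite mulrCA mulrA subrr.
Qed.

Let gen (i : k * M) : B := mon i.1 i.2.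
Let wt (i : k * M) : R := vnorm i.1 * weight i.2.
Let N := gen_snorm gen wt rel.

Let gen_span f : exists s, rel f (\sum_(i <- s) gen i).
Proof. by have [s ef] := mon_span f; exists s; apply: rel_refl. Qed.

Let root_snorm : is_snorm N.
Proof.
apply: gen_snorm_snorm => //.
- by move=> i; rewrite mulr_ge0 ?vnorm_ge0.
- exact: rel_refl.
- move=> x x' y y' hx hy h.
  have -> : (x - y - (x' - y')) * h = (x - x') * h - (y - y') * h by ring.
  by rewrite formB hx hy subr0.
- move=> x x' y y' hx hy h.
  have -> : (x * y - x' * y') * h = (x - x') * (y * h) + (y - y') * (x' * h) by ring.
  by rewrite formD hx hy addr0.
- move=> [c m] [c' m']; exists (c * c', mul m m').
  by rewrite /gen /wt /= monM vnormM weightM mulrACA.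
- move=> [c m]; exists (- c, m); rewrite /gen /wt /= vnormN; split=> //.
  by rewrite -[- c]sub0r monB -(subrr 0) monB subrr sub0r.
Qed.

Lemma exists_root_extension_of_monomials : exists l : valued_ext k,
  forall a, exists d : l, d ^+ p = ext_map l a.
Proof.
(* The multiplicative seminorm is sought with [f = 1] and [s = 1], so only [1 <= N 1] is at stake. A
   combination congruent to 1 has value 1 under [form], and [form] is bounded by the weights. *)
have N1 n : 1 ^+ n <= N (1 ^+ n).
  rewrite !expr1n; apply: gen_snorm_ge => // s hs.
  have e1 : 1 = \sum_(i <- s) i.1 * value i.2.
    have := hs 1; rewrite mulr1 formB -{1}mon1 form_mon mul1r value1 => /eqP.
    rewrite subr_eq0 => /eqP ->; rewrite (big_morph _ formD form0).
    by apply: eq_bigr => i _; rewrite form_mon.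
  rewrite -(vnorm1 k) e1.
  apply: (sn_sum (vnorm_snorm k)) => [|i si]; first exact: bigmax0_ge0.
  apply: le_trans (bigmax0_ge wt si); rewrite vnormM.
  by rewrite ler_wpM2l ?vnorm_ge0.
have [N' hN' [N'N N'1 N'M _]] := exists_multiplicative_snorm root_snorm ltr01 N1.
have [F [h hF]] := exists_valued_field hN' N'1 N'M.
have NC c : N (mon_const c) <= vnorm c.
  apply: (@gen_snorm_le _ _ _ _ _ _ _ [:: (c, one)]); rewrite ?vnorm_ge0 //.
    by apply: rel_refl; rewrite big_seq1.
  by move=> i; rewrite inE => /eqP ->; rewrite /wt /= weight1 mulr1.
pose iota : {rmorphism k -> F} := (h \o mon_const)%FUN.
have hiota c : vnorm (iota c) = vnorm c.
  rewrite /= hF; apply: (contractive_field_morphism_isometric hN' N'1 N'M) => x.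
  exact: le_trans (N'N _) (NC x).
exists (ValuedExt hiota) => a; exists (h (root_var a)); apply/eqP.
rewrite -subr_eq0 -rmorphXn -rmorphB; apply/eqP/vnorm0_eq0; rewrite hF.
apply/eqP; rewrite eq_le (sn_ge0 hN') andbT; apply: le_trans (N'N _) _.
by apply: (@gen_snorm_le _ _ _ _ _ _ _ [::]) => //; rewrite big_nil; apply: root_var_rel.
Qed.

End RootExtension.

From mathcomp Require Import finmap monalg.

Section MonomialAlgebra.
Variables (R : realType) (k : valued_field R) (p : nat).
Hypothesis p0 : (0 < p)%N.
Local Notation M := (cmonom k).

Lemma prod_finsupp (S : comPzRingType) (F : k -> nat -> S) (m : M) (D : {fset k}) :
  (forall a, F a 0%N = 1) -> (finsupp m `<=` D)%fset ->
  \prod_(a <- finsupp m) F a (m a) = \prod_(a <- D) F a (m a).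
Proof.
move=> F0 sD; apply: big_fset_incl => // a _ am.
by have /eqP -> : m a == 0%N by rewrite cmE_eq0.
Qed.

(** The coordinate on 1 of [X_a ^ j] modulo [X_a ^ p - a], in the basis of the powers of [X_a] with
    exponent below [p]. *)
Definition root_pow (a : k) (j : nat) : k := if (p %| j)%N then a ^+ (j %/ p) else 0.
Definition root_mon (m : M) : k := \prod_(a <- finsupp m) root_pow a (m a).

Lemma root_pow0 a : root_pow a 0 = 1.
Proof. by rewrite /root_pow dvdn0 div0n expr0. Qed.

Lemma root_powD a j : root_pow a (p + j) = a * root_pow a j.
Proof.
rewrite /root_pow dvdn_addr //; case: ifP => _; last by rewrite mulr0.
by rewrite divnDl // divnn p0 add1n exprS.
Qed.

Lemma iter_mulcmE a n (m : M) b : iter n (mulcm (ucm a)) m b = ((a == b) * n + m b)%N.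
Proof.
elim: n => [|n IHn]; first by rewrite muln0.
by rewrite /= mulcmE ucmE IHn addnA mulnS.
Qed.

Lemma root_mon_varX a m : root_mon (iter p (mulcm (ucm a)) m) = a * root_mon m.
Proof.
set m' := iter _ _ _; pose D := (a |` (finsupp m `|` finsupp m'))%fset.
have aD : a \in D by rewrite !inE eqxx.
have sm : (finsupp m `<=` D)%fset.
  by apply/fsubsetP => b; rewrite !inE => ->; rewrite orbT.
have ss : (finsupp m' `<=` D)%fset.
  by apply/fsubsetP => b; rewrite !inE => ->; rewrite !orbT.
rewrite /root_mon (prod_finsupp root_pow0 sm) (prod_finsupp root_pow0 ss).
rewrite !(big_fsetD1 a aD) /= iter_mulcmE eqxx mul1n root_powD -mulrA.
congr (_ * (_ * _)); rewrite big_seq [RHS]big_seq; apply: eq_bigr => b.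
by rewrite !inE iter_mulcmE eq_sym => /andP[/negPf->].
Qed.

Definition root_abs (a : k) : R :=
  xget 0 [set r | 0 <= r /\ r ^+ p = vnorm a]%classic.

Lemma root_absP a : 0 <= root_abs a /\ root_abs a ^+ p = vnorm a.
Proof.
have [r r0 rp] := exists_nth_root p0 (vnorm_ge0 a).
exact: (@xgetPex _ 0 [set r | 0 <= r /\ r ^+ p = vnorm a]%classic (ex_intro _ r (conj r0 rp))).
Qed.

(** The absolute value that a monomial is bound to have once each [X_a] is a p-th root of [a]. *)
Definition mon_weight (m : M) : R := \prod_(a <- finsupp m) root_abs a ^+ m a.

Lemma mon_weight_ge0 m : 0 <= mon_weight m.
Proof. by apply: prodr_ge0 => a _; rewrite exprn_ge0 //; case: (root_absP a). Qed.

Lemma mon_weightM m m' : mon_weight (mulcm m m') = mon_weight m * mon_weight m'.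
Proof.
pose D := ((finsupp m `|` finsupp m') `|` finsupp (mulcm m m'))%fset.
have F0 a : root_abs a ^+ 0 = 1 by rewrite expr0.
rewrite /mon_weight !(@prod_finsupp _ (fun a j => root_abs a ^+ j) _ D F0); last first.
- by apply/fsubsetP => b; rewrite !inE => ->; rewrite !orbT.
- by apply/fsubsetP => b; rewrite !inE => ->.
- by apply/fsubsetP => b; rewrite !inE => ->; rewrite !orbT.
by rewrite -big_split; apply: eq_bigr => a _; rewrite mulcmE exprD.
Qed.

Lemma root_mon_norm m : vnorm (root_mon m) <= mon_weight m.
Proof.
rewrite /root_mon /mon_weight; elim/big_ind2: _ => [|x r y s hx hy|a _].
- by rewrite vnorm1.
- by rewrite vnormM; apply: ler_pM; rewrite ?vnorm_ge0.
have [a0 ap] := root_absP a; rewrite /root_pow; case: ifP => [/dvdnP[j ->]|_].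
  by rewrite mulnK // vnormX -ap -exprM mulnC.
by rewrite vnorm0 exprn_ge0.
Qed.

Lemma exists_root_extension : exists l : valued_ext k,
  forall a, exists d : l, d ^+ p = ext_map l a.
Proof.
pose mon (c : k) (m : M) : malg M k := mkmalgU m c.
apply: (@exists_root_extension_of_monomials R k p (malg M k) M (onecm k) (@mulcm k)
  (@ucm k) mon _ _ _ _ _ root_mon (mmap idfun root_mon) _ root_mon_varX _ _
  mon_weight mon_weight_ge0 _ mon_weightM root_mon_norm).
- exact: mul0cm.
- by move=> c d m m'; apply: fgmulUU.
- by move=> c d m; apply: monalgUB.
- reflexivity.
- move=> f; exists [seq (mcoeff m f, m) | m <- msupp f].
  rewrite big_map; exact: (monalgE f).
- by rewrite /root_mon mdom1 big_seq_fset0.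
- exact: mmapD.
- by move=> c m; apply: mmapU.
- by rewrite /mon_weight mdom1 big_seq_fset0.
Qed.

End MonomialAlgebra.

(** * Existence of p-versal extensions and the equivalence *)

Section PVersalExtensions.
Variables (R : realType) (k : valued_field R).

(** Thickness 0: every element of [k] is at distance 0 from the p-th powers of [l], so none stays
    [p]-regular there. *)
Lemma p_versal_of_roots p (l : valued_ext k) :
  (forall a, exists d : l, d ^+ p = ext_map l a) -> p_versal p l.
Proof.
move=> hl; exists 0 => [|a _]; first exact: ltr01.
rewrite mul0r /pnorm asboolF // /p_regular; have [d ed] := hl a.
apply/negP; rewrite -leNgt (le_trans (pdist_le _ _ d)) //.
by rewrite ed subrr vnorm0 vnorm_ge0.
Qed.

Lemma exists_p_versal p : (0 < p)%N -> exists l : valued_ext k, p_versal p l.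
Proof.
by move=> /(exists_root_extension k)[l hl]; exists l; apply: p_versal_of_roots.
Qed.

Lemma residue_char0_tame : [pchar residue_field k] =i pred0 ->
  forall n, (0 < n)%N -> vnorm (n%:R : k) = 1.
Proof.
move=> h n; elim/ltn_ind: n => n IHn n0.
have [n1|n1] := leqP n 1.
  have -> : n = 1%N by apply/eqP; rewrite eqn_leq n1.
  exact: vnorm1.
have q1 : vnorm ((pdiv n)%:R : k) = 1.
  apply/eqP; rewrite eq_le vnorm_nat leNgt; apply/negP => lt1.
  by have := h (pdiv n); rewrite residue_pchar pdiv_prime // lt1.
rewrite -(divnK (pdiv_dvd n)) natrM vnormM q1 mulr1 IHn //.
  by rewrite ltn_Pdiv // prime_gt1 // pdiv_prime.
by rewrite divn_gt0 ?pdiv_gt0 // pdiv_leq.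
Qed.

End PVersalExtensions.

Theorem theorem5p3p1 (R : realType) (k : valued_field R) (p : nat)
    (hp : residual_exp_char k p) (A : normed_alg k)
    (hA : weakly_cartesian_alg A) :
  geometrically_spectral A <->
  exists2 l : valued_ext k, p_versal p l & spectral (tensor_snorm A l).
Proof.
split=> [gs|[l pl sl]].
  have p0 : (0 < p)%N.
    by case: hp => [|[-> //]]; rewrite residue_pchar => /andP[/prime_gt0].
  by have [l pl] := exists_p_versal k p0; exists l.
case: hp => [|[_ char0]].
  rewrite residue_pchar => /andP[pp p1].
  by move=> m; apply: (wild_geometrically_spectral pp p1 hA pl sl).
have tame := residue_char0_tame char0; have snormX := spectral_snorm sl.
by move=> m; apply: (tame_geometrically_spectral tame snormX hA).
Qed.
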